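(* Let $E_n \subseteq \mathbb{T}$ ($n\ge1$) be Lebesgue measurable. The following are equivalent: (a) $\sum_{n \geq 1} m(E_n) < \infty$; (b) $v = \pi \sum_{n \geq 1} \chi_{E_n} \in L^1(\mathbb{T},m)$; (c) $\prod_{n \geq 1} f_{E_n}$ converges absolutely and locally uniformly on $\mathbb{D}$. Moreover, the product in (c) belongs to $\mathsf{R}^{+}$ if and only if $v \in L\log L$.
   Context: $\mathbb{D}$ is the open unit disk, $\mathbb{T}$ the unit circle, $m$ normalized Lebesgue measure, $\chi_E$ the characteristic function of $E$. For measurable $E\subseteq\mathbb{T}$, $f_E(z) = \exp\big[i\pi\int_E \frac{\zeta+z}{\zeta-z}\,dm(\zeta)\big]$, $z\in\mathbb{D}$. A product of functions converges absolutely and locally uniformly if $\sum|1-w_n(z)|$ converges uniformly on compact subsets of $\mathbb{D}$. The Smirnov class is $N^+ = \{f/g : f,g \in H^\infty,\ g \text{ outer}\}$, and $\mathsf{R}^+$ is the set of $f\in N^+$ whose radial boundary values are real a.e.~on $\mathbb{T}$. $L\log L$ is the set of measurable $w$ on $\mathbb{T}$ with $\int_{\mathbb{T}}|w|\log^+|w|\,dm<\infty$. *)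

(* Defs.v *)
From HB Require Import structures.
From mathcomp Require Import all_boot all_order all_algebra.
From mathcomp Require Import all_classical all_reals all_analysis.
From mathcomp Require Import measurable_realfun complex.
Set Implicit Arguments.
Unset Strict Implicit.
Unset Printing Implicit Defensive.
Import Order.TTheory GRing.Theory Num.Theory.
Import numFieldNormedType.Exports.
Local Open Scope classical_set_scope.
Local Open Scope ring_scope.

(* The unit circle T is parametrized by the angle t in [0, 2pi[,        *)
(* zeta = e^{it}.  Lebesgue measurable subsets of T correspond to      *)
(* (completed-)Lebesgue measurable subsets of [0, 2pi[, and the         *)
(* normalized Lebesgue measure m on T is lambda / (2 pi).               *)

(* the real line with the sigma-algebra of Lebesgue measurable sets *)
Definition LT (R : realType) :=
  caratheodory_type (R := R) ((wlength (R := R) idfun)^*)%mu.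
HB.instance Definition _ (R : realType) :=
  Measurable.on (LT R).

(* the (completed) Lebesgue measure *)
Definition lam {R : realType} : set (LT R) -> \bar R :=
  @completed_lebesgue_measure R.

(* parameter interval of the circle *)
Definition TT {R : realType} : set R := `[0, 2 * pi[%classic.

(* normalized Lebesgue measure m(E) of (the image on T of) E ⊆ [0,2pi[ *)
Definition mT {R : realType} (E : set R) : \bar R :=
  (lam (E : set (LT R)) * ((2 * pi)^-1)%:E)%E.

(* integral w.r.t. m over T of a nonnegative extended-real function *)
Definition intT {R : realType} (w : R -> \bar R) : \bar R :=
  (\int[lam]_(x in (TT : set (LT R))) w x * ((2 * pi)^-1)%:E)%E.

(* modulus of a complex number (real valued) *)
Definition cabs {R : realType} (z : R[i]) : R :=
  Num.sqrt (complex.Re z ^+ 2 + complex.Im z ^+ 2).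

(* the open unit disk *)
Definition Dsk {R : realType} : set R[i] := [set z | cabs z < 1].

(* e^{it} *)
Definition expi {R : realType} (t : R) : R[i] := Complex (cos t) (sin t).

(* complex exponential e^{a + ib} = e^a (cos b + i sin b) *)
Definition cexp {R : realType} (w : R[i]) : R[i] :=
  Complex (expR (complex.Re w) * cos (complex.Im w))
          (expR (complex.Re w) * sin (complex.Im w)).

(* Schwarz-type integral  \int_T (zeta + z)/(zeta - z) u(zeta) dm(zeta),
   computed via real and imaginary parts *)
Definition schwarz {R : realType} (u : R -> R) (z : R[i]) : R[i] :=
  let k t := (expi t + z) / (expi t - z) in
  Complex
    (Rintegral lam (TT : set (LT R)) (fun t => complex.Re (k t) * u t) / (2 * pi))
    (Rintegral lam (TT : set (LT R)) (fun t => complex.Im (k t) * u t) / (2 * pi)).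

(* f_E(z) = exp[ i pi \int_E (zeta+z)/(zeta-z) dm(zeta) ] *)
Definition fE {R : realType} (E : set R) (z : R[i]) : R[i] :=
  cexp (Complex 0 pi * schwarz (\1_E) z).

(* v = pi * sum_n chi_{E_n} (extended-real valued) *)
Definition vfun {R : realType} (E : nat -> set R) (t : R) : \bar R :=
  (pi%:E * \sum_(0 <= n <oo) ((\1_(E n) t : R)%:E))%E.

(* L^1(T, m) *)
Definition L1T {R : realType} (w : R -> \bar R) : Prop :=
  measurable_fun (TT : set (LT R)) w /\
  (intT (fun t => `|w t|) < +oo)%E.

(* |y| log^+ |y| on extended reals (+oo at infinite values) *)
Definition LlogL_phi {R : realType} (y : \bar R) : \bar R :=
  match y with
  | r%:E => (`|r| * Num.max 0 (ln `|r|))%:E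
  | _ => +oo%E
  end.

(* L log L *)
Definition LlogL {R : realType} (w : R -> \bar R) : Prop :=
  measurable_fun (TT : set (LT R)) w /\
  (intT (fun t => LlogL_phi (w t)) < +oo)%E.

(* the product prod_n w_n converges absolutely and locally uniformly on D:
   sum_n |1 - w_n(z)| converges uniformly on compact subsets of D *)
Definition prod_abs_loc_unif {R : realType} (w : nat -> R[i] -> R[i]) : Prop :=
  forall K : set (R[i])^o, compact K -> K `<=` Dsk ->
  exists S : R[i] -> R, forall eps : R, 0 < eps ->
    exists N : nat, forall M : nat, (N <= M)%N -> forall z, K z ->
      `| \sum_(n < M) cabs (1 - w n z) - S z | < eps.

(* F is the (pointwise) value on D of the infinite product prod_n w_n *)
Definition prod_value {R : realType} (w : nat -> R[i] -> R[i]) (F : R[i] -> R[i]) : Prop :=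
  forall z, Dsk z -> forall eps : R, 0 < eps ->
    exists N : nat, forall M : nat, (N <= M)%N ->
      cabs (\prod_(n < M) w n z - F z) < eps.

(* holomorphic on D (complex differentiable at each point of D) *)
Definition holo {R : realType} (f : R[i] -> R[i]) : Prop :=
  forall z, Dsk z -> exists d : R[i], forall eps : R, 0 < eps ->
    exists del : R, 0 < del /\
      forall h : R[i], 0 < cabs h < del -> Dsk (z + h) ->
        cabs ((f (z + h) - f z) / h - d) < eps.

(* H^infinity of the disk *)
Definition Hinf {R : realType} (f : R[i] -> R[i]) : Prop :=
  holo f /\ exists M : R, forall z, Dsk z -> cabs (f z) <= M.

(* outer function: g = c exp( \int (zeta+z)/(zeta-z) log psi(zeta) dm ),
   |c| = 1, with u = log psi in L^1(T) *)
Definition outer {R : realType} (g : R[i] -> R[i]) : Prop :=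
  exists c : R[i], cabs c = 1 /\
  exists u : R -> R,
    lam.-integrable (TT : set (LT R)) (fun t : LT R => (u t)%:E) /\
    forall z, Dsk z -> g z = c * cexp (schwarz u z).

(* Smirnov class N^+ = { f/g : f, g in H^infinity, g outer } *)
Definition Nplus {R : realType} (F : R[i] -> R[i]) : Prop :=
  exists f g : R[i] -> R[i],
    [/\ Hinf f, Hinf g, outer g & forall z, Dsk z -> F z = f z / g z].

(* radial boundary values of F exist and are real for a.e. point of T *)
Definition radial_real_ae {R : realType} (F : R[i] -> R[i]) : Prop :=
  {ae lam, forall t : LT R, TT t ->
     exists L : R, forall eps : R, 0 < eps ->
       exists del : R, 0 < del /\
         forall r : R, 0 < r -> 1 - del < r < 1 ->
           cabs (F (Complex r 0 * expi t) - Complex L 0) < eps}.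

(* R^+ : functions in N^+ with real radial boundary values a.e. *)
Definition Rplus {R : realType} (F : R[i] -> R[i]) : Prop :=
  Nplus F /\ radial_real_ae F.

(* Main.v *)
(* Let P v and Q v be the Poisson and conjugate Poisson integrals of v; the
   product is F = exp (i (P v + i Q v)), so |F| = exp (- Q v).  The modulus of
   1 - f_E(z) is comparable to m(E), which links (a) and (c).

   With V = P v + i Q v, the mean over circles of Re ((1 + V) log (1 + V)) equals
   its value at 0.  Pointwise estimates of this quantity bound the mean of |Q v|
   by that of phi(v), phi(x) = (1 + x) log (1 + x), and conversely the mean of
   phi(P v) by that of |Q v|.

   If F = f / g with f bounded and log |g| = P u, then - Q v <= C + P |u|; as Q v
   has mean zero, the means of |Q v| are bounded, hence so are those of phi(P v),
   and Fatou's lemma gives v in L log L.  Conversely, if v is in L log L, splitting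
   v into a bounded part (handled in L^2) and a tail (handled by the estimate for
   a large multiple of v) shows that Q v is Cauchy in L^1 along radii tending to
   1, so Q v = P h with h in L^1.  Then g = exp of the Schwarz integral of
   - max(0, - h) is outer and F = (F g) / g is in N^+; the boundary values
   exp (- h + i v) are real because v takes its values in pi N. *)
Require Import Defs.
From HB Require Import structures.
From mathcomp Require Import all_boot all_order all_algebra.
From mathcomp Require Import all_classical all_reals all_analysis.
From mathcomp Require Import measurable_realfun complex.
From mathcomp Require Import ring lra.
Set Implicit Arguments.
Unset Strict Implicit.
Unset Printing Implicit Defensive.
Import Order.TTheory GRing.Theory Num.Theory.
Import numFieldNormedType.Exports.
Local Open Scope classical_set_scope.
Local Open Scope ring_scope.

(** * Calculus rules for derivatives of real functions *)

Section real_derivatives.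
Context {R : realType}.
Implicit Types (f g : R -> R) (x a b : R).

(** Holomorphic functions are handled as pairs of real functions of (r, t) obeying the polar
    Cauchy-Riemann equations, recorded by [conj_pair]. The mean value property then rests on
    differentiation under the integral sign and periodicity in t. As [conj_pair] is stable under
    sums, products, dilations and the logarithm of a function with real part at least 1, it covers
    (1 + V) log (1 + V), squares and products of two kernels. Since v >= 0, the function 1 + V has
    real part at least 1, so atan gives its argument and no branch is chosen.

    The bound for the mean of |Q v| contains a constant 2 pi that does not scale with v. Applying it
    to a multiple of v and dividing by the factor makes this constant small; hence the condition L
    log L is used for all multiples of v at once.

    To identify Q v with P h, two radii are composed: P at radius rho applied to Q v at radius r is
    Q v at radius rho r.

    The sets E_n are Lebesgue measurable, while Fubini and Lebesgue differentiation are applied to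
    Borel functions on the line. Each E_n is therefore replaced by a Borel subset with null
    difference, which changes no integral. *)

Lemma isd_eq f x a b : is_derive x 1 f a -> a = b -> is_derive x 1 f b.
Proof. by move=> + <-. Qed.

Lemma isdD f g x a b : is_derive x 1 f a -> is_derive x 1 g b ->
  is_derive x 1 (fun y => f y + g y) (a + b).
Proof. exact: is_deriveD. Qed.

Lemma isdB f g x a b : is_derive x 1 f a -> is_derive x 1 g b ->
  is_derive x 1 (fun y => f y - g y) (a - b).
Proof. exact: is_deriveB. Qed.

Lemma isdN f x a : is_derive x 1 f a -> is_derive x 1 (fun y => - f y) (- a).
Proof. exact: is_deriveN. Qed.

Lemma isdM f g x a b : is_derive x 1 f a -> is_derive x 1 g b ->
  is_derive x 1 (fun y => f y * g y) (a * g x + f x * b).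
Proof.
move=> df dg; have h := is_deriveM df dg; apply: isd_eq h _.
by rewrite /GRing.scale/= addrC [g x * a]mulrC.
Qed.

Lemma isdV f x a : is_derive x 1 f a -> f x != 0 ->
  is_derive x 1 (fun y => (f y)^-1) (- a / f x ^+ 2).
Proof.
move=> df fx0; have h := is_deriveV fx0 df; apply: isd_eq h _.
by rewrite /GRing.scale/= !mulNr mulrC.
Qed.

Lemma isdcomp (h : R -> R) f x a b : is_derive (f x) 1 h b ->
  is_derive x 1 f a -> is_derive x 1 (fun y => h (f y)) (b * a).
Proof. by move=> dh df; exact: (is_derive1_comp (f := h) (g := f)). Qed.

Lemma isd_cst (c x : R) : is_derive x 1 (fun=> c) 0.
Proof. exact: is_derive_cst. Qed.

Lemma isd_id x : is_derive x 1 (fun y : R => y) 1.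
Proof. exact: is_derive_id. Qed.

Lemma isd_sqr x : is_derive x 1 (fun y : R => y ^+ 2) (2 * x).
Proof.
apply: isd_eq (isdM (isd_id x) (isd_id x)) _.
by rewrite mul1r mulr1 mulr_natl mulr2n.
Qed.

Lemma isd_cont f x a : is_derive x 1 f a -> {for x, continuous f}.
Proof. by move=> [df _]; exact/differentiable_continuous/derivable1_diffP. Qed.

End real_derivatives.

(** * The Poisson kernel and its conjugate *)

Section kernel.
Context {R : realType}.
Implicit Types r x t rho : R.

(* kre r x + i kim r x = (1 + z) / (1 - z) at z = r e^{ix} *)
Definition kden r x : R := 1 - 2 * r * cos x + r ^+ 2.
Definition kre r x : R := (1 - r ^+ 2) / kden r x.
Definition kim r x : R := 2 * r * sin x / kden r x.
(* real and imaginary parts of the derivative 2 e^{ix} / (1 - r e^{ix})^2 in r *)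
Definition kre1 r x : R := 2 * ((1 + r ^+ 2) * cos x - 2 * r) / kden r x ^+ 2.
Definition kim1 r x : R := 2 * (1 - r ^+ 2) * sin x / kden r x ^+ 2.

(** [kden r x] is the square of the modulus of 1 - r e^{ix}, so this is the reverse triangle
    inequality; r may be negative. *)
Lemma kden_ge r x : (1 - `|r|) ^+ 2 <= kden r x.
Proof.
have c1 := cos_le1 x; have c2 := cos_geN1 x; rewrite /kden.
have h : `|r * cos x| <= `|r|.
  by rewrite normrM ler_piMr// ler_norml c2 c1.
have : r * cos x <= `|r| by apply: le_trans h; exact: ler_norm.
have : `|r| ^+ 2 = r ^+ 2 by exact: real_normK (num_real r).
nra.
Qed.

Lemma kden_lb rho r x : `|r| <= rho -> rho < 1 -> (1 - rho) ^+ 2 <= kden r x.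
Proof.
move=> rr r1; apply: le_trans (kden_ge r x); have r0 := normr_ge0 r.
by rewrite ler_pXn2r ?nnegrE//; lra.
Qed.

Lemma kden_gt0 r x : `|r| < 1 -> 0 < kden r x.
Proof.
move=> r1; apply: lt_le_trans (kden_ge r x).
by rewrite exprn_gt0// subr_gt0.
Qed.

Lemma kden_neq0 r x : `|r| < 1 -> kden r x != 0.
Proof. by move=> r1; rewrite gt_eqF// kden_gt0. Qed.

Lemma kden_is_derive_r r x : is_derive r 1 (kden ^~ x) (2 * r - 2 * cos x).
Proof.
apply: isd_eq (isdD (isdB (isd_cst 1 r) (isdM (isdM (isd_cst 2 r) (isd_id r))
  (isd_cst (cos x) r))) (isd_sqr r)) _.
ring.
Qed.

Lemma kden_is_derive_x r x : is_derive x 1 (kden r) (2 * r * sin x).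
Proof.
apply: isd_eq (isdD (isdB (isd_cst 1 x) (isdM (isd_cst (2 * r) x)
  (is_derive_cos x))) (isd_cst (r ^+ 2) x)) _.
ring.
Qed.

Lemma kre_is_derive_r r x : `|r| < 1 -> is_derive r 1 (kre ^~ x) (kre1 r x).
Proof.
move=> r1; have d0 := kden_neq0 x r1.
apply: isd_eq (isdM (isdB (isd_cst 1 r) (isd_sqr r))
  (isdV (kden_is_derive_r r x) d0)) _.
by rewrite /kre1; move: d0; rewrite /kden => d0; field.
Qed.

Lemma kim_is_derive_r r x : `|r| < 1 -> is_derive r 1 (kim ^~ x) (kim1 r x).
Proof.
move=> r1; have d0 := kden_neq0 x r1.
apply: isd_eq (isdM (isdM (isdM (isd_cst 2 r) (isd_id r)) (isd_cst (sin x) r))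
  (isdV (kden_is_derive_r r x) d0)) _.
by rewrite /kim1; move: d0; rewrite /kden => d0; field.
Qed.

(** Polar Cauchy-Riemann equation: for K(r e^{ix}), the derivative in x is i r times the derivative
    in r. Its imaginary part is [kim_is_derive_x]. *)
Lemma kre_is_derive_x r x : `|r| < 1 -> is_derive x 1 (kre r) (- r * kim1 r x).
Proof.
move=> r1; have d0 := kden_neq0 x r1.
apply: isd_eq (isdM (isd_cst (1 - r ^+ 2) x) (isdV (kden_is_derive_x r x) d0)) _.
by rewrite /kim1; field.
Qed.

Lemma kim_is_derive_x r x : `|r| < 1 -> is_derive x 1 (kim r) (r * kre1 r x).
Proof.
move=> r1; have d0 := kden_neq0 x r1.
apply: isd_eq (isdM (isdM (isd_cst (2 * r) x) (is_derive_sin x))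
  (isdV (kden_is_derive_x r x) d0)) _.
have e : sin x ^+ 2 = 1 - cos x ^+ 2 by rewrite -(cos2Dsin2 x); ring.
transitivity (2 * r * (cos x * kden r x - 2 * r * sin x ^+ 2) / kden r x ^+ 2).
  by field.
rewrite e /kre1 mulrA; congr (_ / _); rewrite /kden; ring.
Qed.

Lemma kden_lb_sqr rho r x : `|r| <= rho -> rho < 1 -> (1 - rho) ^+ 4 <= kden r x ^+ 2.
Proof.
move=> rr r1; have -> : (1 - rho) ^+ 4 = ((1 - rho) ^+ 2) ^+ 2 by rewrite -exprM.
rewrite ler_pXn2r ?nnegrE ?sqr_ge0 ?kden_lb//.
by rewrite ltW// kden_gt0// (le_lt_trans rr).
Qed.

Lemma kre1_ub rho r x : `|r| <= rho -> rho < 1 ->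
  `|kre1 r x| <= 8 / (1 - rho) ^+ 4.
Proof.
move=> rr r1; rewrite /kre1 normrM.
have d4 : (1 - rho) ^+ 4 <= kden r x ^+ 2 := kden_lb_sqr x rr r1.
have r0 := normr_ge0 r.
have ra : `|r| <= 1 by lra.
have p4 : 0 < (1 - rho) ^+ 4 by rewrite exprn_gt0//; lra.
apply: ler_pM => //.
- have c1 := cos_le1 x; have c2 := cos_geN1 x.
  move: ra; rewrite !ler_norml => /andP[? ?]; apply/andP; split; nra.
- rewrite ger0_norm ?invr_ge0 ?sqr_ge0// lef_pV2 ?posrE//.
  exact: lt_le_trans d4.
Qed.

Lemma kim1_ub rho r x : `|r| <= rho -> rho < 1 ->
  `|kim1 r x| <= 8 / (1 - rho) ^+ 4.
Proof.
move=> rr r1; rewrite /kim1 normrM.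
have d4 : (1 - rho) ^+ 4 <= kden r x ^+ 2 := kden_lb_sqr x rr r1.
have r0 := normr_ge0 r.
have ra : `|r| <= 1 by lra.
have p4 : 0 < (1 - rho) ^+ 4 by rewrite exprn_gt0//; lra.
apply: ler_pM => //.
- have s1 := sin_le1 x; have s2 := sin_geN1 x.
  move: ra; rewrite !ler_norml => /andP[? ?].
  have : 0 <= 1 - r ^+ 2 <= 1 by nra.
  by move: (1 - _) => y /andP[? ?]; apply/andP; split; nra.
- rewrite ger0_norm ?invr_ge0 ?sqr_ge0// lef_pV2 ?posrE//.
  exact: lt_le_trans d4.
Qed.

Lemma kre_ge0 r x : `|r| < 1 -> 0 <= kre r x.
Proof.
move=> r1; rewrite /kre divr_ge0 ?(ltW (kden_gt0 x r1))//.
by rewrite subr_ge0 -[r ^+ 2]real_normK ?num_real// exprn_ile1// ltW.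
Qed.

Lemma kre_ub rho r x : `|r| <= rho -> rho < 1 -> `|kre r x| <= 2 / (1 - rho) ^+ 2.
Proof.
move=> rr r1; have r0 := normr_ge0 r.
have ra : `|r| < 1 by lra.
have p2 : 0 < (1 - rho) ^+ 2 by rewrite exprn_gt0//; lra.
have d2 := kden_lb x rr r1.
rewrite /kre normrM; apply: ler_pM => //.
  by move: (ltW ra); rewrite !ler_norml => /andP[? ?]; apply/andP; split; nra.
rewrite ger0_norm ?invr_ge0 ?(ltW (kden_gt0 x ra))// lef_pV2 ?posrE//.
exact: kden_gt0.
Qed.

Lemma kim_ub rho r x : `|r| <= rho -> rho < 1 -> `|kim r x| <= 2 / (1 - rho) ^+ 2.
Proof.
move=> rr r1; have r0 := normr_ge0 r.
have ra : `|r| < 1 by lra.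
have p2 : 0 < (1 - rho) ^+ 2 by rewrite exprn_gt0//; lra.
have d2 := kden_lb x rr r1.
rewrite /kim normrM; apply: ler_pM => //.
  have s1 := sin_le1 x; have s2 := sin_geN1 x.
  by move: (ltW ra); rewrite !ler_norml => /andP[? ?]; apply/andP; split; nra.
rewrite ger0_norm ?invr_ge0 ?(ltW (kden_gt0 x ra))// lef_pV2 ?posrE//.
exact: kden_gt0.
Qed.

Lemma continuous_kden r : continuous (kden r).
Proof. move=> x; exact: isd_cont (kden_is_derive_x r x). Qed.

Lemma continuous_kre1 r : `|r| < 1 -> continuous (kre1 r).
Proof.
move=> r1 x; apply: cvgM.
  apply: cvgM; first exact: cvg_cst.
  apply: cvgB; last exact: cvg_cst.
  by apply: cvgM; [exact: cvg_cst|exact: continuous_cos].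
apply: cvgV; first by rewrite expf_neq0// kden_neq0.
by apply: cvgM; exact: continuous_kden.
Qed.

Lemma continuous_kim1 r : `|r| < 1 -> continuous (kim1 r).
Proof.
move=> r1 x; apply: cvgM.
  apply: cvgM; first exact: cvg_cst.
  exact: continuous_sin.
apply: cvgV; first by rewrite expf_neq0// kden_neq0.
by apply: cvgM; exact: continuous_kden.
Qed.

Lemma continuous_kre r : `|r| < 1 -> continuous (kre r).
Proof. move=> r1 x; exact: isd_cont (kre_is_derive_x x r1). Qed.

Lemma continuous_kim r : `|r| < 1 -> continuous (kim r).
Proof. move=> r1 x; exact: isd_cont (kim_is_derive_x x r1). Qed.

Lemma kden_periodic r x : kden r (x + 2 * pi) = kden r x.
Proof. by rewrite /kden [2 * pi]mulr_natl cosD2pi. Qed.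

Lemma kre_periodic r x : kre r (x + 2 * pi) = kre r x.
Proof. by rewrite /kre kden_periodic. Qed.

Lemma kim_periodic r x : kim r (x + 2 * pi) = kim r x.
Proof. by rewrite /kim kden_periodic [2 * pi]mulr_natl sinD2pi. Qed.

Lemma kre0 x : kre 0 x = 1.
Proof. by rewrite /kre /kden expr0n/= mulr0 mul0r subr0 addr0 divr1. Qed.

Lemma kim0 x : kim 0 x = 0.
Proof. by rewrite /kim mulr0 !mul0r. Qed.

Lemma kreN r x : kre r (- x) = kre r x.
Proof. by rewrite /kre /kden cosN. Qed.

Lemma kimN r x : kim r (- x) = - kim r x.
Proof. by rewrite /kim /kden cosN sinN mulrN mulNr. Qed.

End kernel.

(** * Differentiation under the integral sign and products with bounded factors *)

Section differentiation_under_integral_sign.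
Context {R : realType} d (S : measurableType d) (nu : {measure set S -> \bar R}).
Context (D : set S) (mD : measurable D).
Implicit Types f df : R -> S -> R.

Lemma is_derive_Rintegral f df (G : S -> R) (y u v : R) : u < y < v ->
  (forall x, u < x < v -> nu.-integrable D (EFin \o f x)) ->
  (forall x s, u < x < v -> D s -> is_derive x 1 (f ^~ s) (df x s)) ->
  nu.-integrable D (EFin \o G) ->
  (forall x s, u < x < v -> D s -> `|df x s| <= G s) ->
  is_derive y 1 (fun x => Rintegral nu D (f x)) (Rintegral nu D (df y)).
Proof.
move=> yuv intf derf intG dfG.
have Iuv x : `]u, v[%classic x <-> u < x < v by rewrite /= in_itv.
have d1E x s : u < x < v -> D s -> partial1of2 f x s = df x s.
  by move=> xuv Ds; rewrite partial1of2E; have [_ ->] := derf x s xuv Ds.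
have intf' x : `]u, v[%classic x -> nu.-integrable D (EFin \o f x).
  by move=> /Iuv; exact: intf.
have derf' x s : `]u, v[%classic x -> D s -> derivable (f ^~ s) x 1.
  by move=> /Iuv xuv Ds; have [] := derf x s xuv Ds.
(* [G] is known to dominate on [D] only; its absolute value is a majorant that is nonnegative
   everywhere. *)
have G0 s : 0 <= `|G s| by [].
have intG' : nu.-integrable D (EFin \o (fun s => `|G s|)).
  exact: integrable_norm.
have Gub x s : `]u, v[%classic x -> D s -> `|partial1of2 f x s| <= `|G s|.
  move=> /Iuv xuv Ds; rewrite d1E//; apply: le_trans (ler_norm _).
  exact: dfG.
have Iy : `]u, v[%classic y by exact/Iuv.
have := derivable_under_integral mD Iy intf' derf' G0 intG' Gub.
have := differentiation_under_integral mD Iy intf' derf' G0 intG' Gub.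
rewrite derive1E => e h; apply: DeriveDef => //.
rewrite e; apply: eq_Rintegral => s /set_mem Ds.
exact: d1E.
Qed.

Lemma measurable_L1 (f : S -> R) : nu.-integrable D (EFin \o f) -> measurable_fun D f.
Proof. by move=> /measurable_int/measurable_EFinP. Qed.

Lemma integrable_Mbdd (f : S -> R) (g : S -> R) (C : R) :
  nu.-integrable D (EFin \o g) -> measurable_fun D f ->
  (forall s, D s -> `|f s| <= C) -> nu.-integrable D (EFin \o (fun s => f s * g s)).
Proof.
move=> ig mf fC.
have ig' : nu.-integrable D (EFin \o (fun s => C * g s)).
  by have := integrableZl mD C ig; apply: eq_integrable.
apply: le_integrable ig' => //.
  apply/measurable_EFinP/measurable_funM => //.
  exact: measurable_L1.
move=> s Ds /=; rewrite lee_fin !normrM ler_wpM2r//.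
by apply: le_trans (ler_norm _); exact: fC.
Qed.

Lemma le_norm_RintegralM (f : S -> R) (g : S -> R) (C : R) :
  nu.-integrable D (EFin \o g) -> measurable_fun D f ->
  (forall s, D s -> `|f s| <= C) ->
  `|Rintegral nu D (fun s => f s * g s)| <= C * Rintegral nu D (fun s => `|g s|).
Proof.
move=> ig mf fC.
have ifg := integrable_Mbdd ig mf fC.
apply: le_trans (le_normr_Rintegral mD ifg) _.
rewrite -RintegralZl//; last exact: integrable_norm.
apply: le_Rintegral => //.
- exact: (integrable_norm (f := fun s => f s * g s)).
- have ing := integrable_norm ig.
  by have := integrableZl mD C ing; apply: eq_integrable.
- by move=> s Ds; rewrite normrM ler_wpM2r// fC.
Qed.

End differentiation_under_integral_sign.

(** * Integration over one period *)

Section circle_integral.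
Context {R : realType}.
Notation mu := (@lebesgue_measure R).
Implicit Types f g : R -> R.

Lemma pi2_gt0 : 0 < 2 * pi :> R.
Proof. by rewrite mulr_gt0// pi_gt0. Qed.

Lemma measurable_TT : measurable (TT : set (measurableTypeR R)).
Proof. exact: measurable_itv. Qed.

Lemma mu_TT : mu TT = (2 * pi)%:E.
Proof.
by rewrite /TT lebesgue_measure_itv/= lte_fin pi2_gt0 oppr0 adde0.
Qed.

Lemma continuous_measurable_TT f : continuous f ->
  measurable_fun (TT : set (measurableTypeR R)) f.
Proof.
by move=> cf; apply: measurable_funTS; exact: continuous_measurable_fun.
Qed.

Lemma integrable_cst_TT (c : R) : mu.-integrable TT (EFin \o (fun=> c)).
Proof.
apply: measurable_bounded_integrable; first exact: measurable_TT.
- by have := ltry (2 * pi : R); rewrite -mu_TT.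
- exact: measurable_cst.
- exact: bounded_cst.
Qed.

Lemma integrable_bdd f C : measurable_fun (TT : set (measurableTypeR R)) f ->
  (forall t, TT t -> `|f t| <= C) -> mu.-integrable TT (EFin \o f).
Proof.
move=> mf fC.
have := integrable_Mbdd measurable_TT (integrable_cst_TT 1) mf fC.
by apply: eq_integrable => [|t _ /=]; [exact: measurable_TT|rewrite mulr1].
Qed.

Lemma Rintegral_cst_TT (c : R) : Rintegral mu TT (fun=> c) = c * (2 * pi).
Proof.
rewrite (Rintegral_cst mu measurable_TT c); congr (c * _).
exact: (congr1 fine mu_TT).
Qed.

(** Used for periodic [f], where it says that the derivative has mean zero over the circle. *)
Lemma Rintegral_derive f (df : R -> R) : (forall t : R, is_derive t 1 f (df t)) ->
  continuous df -> Rintegral mu TT df = f (2 * pi) - f 0.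
Proof.
move=> dF cdf.
have cf : continuous f by move=> t; exact: isd_cont (dF t).
rewrite /TT Rintegral_itv_bndo_bndc; last first.
  have : mu.-integrable `[0, 2 * pi] (EFin \o df).
    apply: continuous_compact_integrable; first exact: segment_compact.
    exact: continuous_subspaceT.
  apply: integrableS => //=.
  by apply: subset_itvl; rewrite bnd_simp.
rewrite /Rintegral (@continuous_FTC2 _ df f 0 (2 * pi))//.
- exact: pi2_gt0.
- exact: continuous_subspaceT.
- split.
  + by move=> t _; have [] := dF t.
  + apply: cvg_at_right_filter; exact: cf.
  + apply: cvg_at_left_filter; exact: cf.
- by move=> t _; rewrite derive1E; have [] := dF t.
Qed.

End circle_integral.

(* A and B play the role of the real and imaginary parts of a holomorphic
   function h at z = r e^{it}, and a, b those of e^{it} h'(z); the first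
   variable ranges over ]-1, 1[ so that r = 0 is an interior point *)
Record conj_pair {R : realType} (A B a b : R -> R -> R) : Prop := ConjPair {
  cp_Ar : forall r t : R, `|r| < 1 -> is_derive r 1 (A ^~ t) (a r t);
  cp_Br : forall r t : R, `|r| < 1 -> is_derive r 1 (B ^~ t) (b r t);
  cp_At : forall r t : R, `|r| < 1 -> is_derive t 1 (A r) (- r * b r t);
  cp_Bt : forall r t : R, `|r| < 1 -> is_derive t 1 (B r) (r * a r t);
  cp_ca : forall r, `|r| < 1 -> continuous (a r);
  cp_cb : forall r, `|r| < 1 -> continuous (b r);
  cp_bnd : forall rho, rho < 1 -> exists C : R, forall r t, `|r| <= rho ->
     [/\ `|A r t| <= C, `|B r t| <= C, `|a r t| <= C & `|b r t| <= C];
  cp_pA : forall r, `|r| < 1 -> A r (2 * pi) = A r 0;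
  cp_pB : forall r, `|r| < 1 -> B r (2 * pi) = B r 0 }.

(** * The mean value property for conjugate pairs *)

Section conj_pair_theory.
Context {R : realType}.
Notation mu := (@lebesgue_measure R).
Implicit Types A B a b : R -> R -> R.

Lemma cp_cA A B a b r : conj_pair A B a b -> `|r| < 1 -> continuous (A r).
Proof. by move=> cp r1 t; exact: isd_cont (cp_At cp t r1). Qed.

Lemma cp_cB A B a b r : conj_pair A B a b -> `|r| < 1 -> continuous (B r).
Proof. by move=> cp r1 t; exact: isd_cont (cp_Bt cp t r1). Qed.

Lemma cp_intA A B a b r : conj_pair A B a b -> `|r| < 1 ->
  mu.-integrable TT (EFin \o A r).
Proof.
move=> cp r1; have [C AC] := cp_bnd cp r1.
apply: (@integrable_bdd _ _ C).
  exact: continuous_measurable_TT (cp_cA cp r1).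
by move=> t _; have [] := AC r t (lexx _).
Qed.

Lemma cp_swap A B a b : conj_pair A B a b ->
  conj_pair B (fun r t => - A r t) b (fun r t => - a r t).
Proof.
move=> cp; split.
- exact: cp_Br cp.
- by move=> r t r1; exact: isdN (cp_Ar cp t r1).
- by move=> r t r1; apply: isd_eq (cp_Bt cp t r1) _; rewrite mulrNN.
- by move=> r t r1; apply: isd_eq (isdN (cp_At cp t r1)) _; ring.
- exact: cp_cb cp.
- by move=> r r1 t; have h := cp_ca cp r1 (x := t); apply: cvgN; exact: h.
- move=> rho rho1; have [C h] := cp_bnd cp rho1.
  by exists C => r t rr; rewrite !normrN; have [] := h r t rr.
- exact: cp_pB cp.
- by move=> r r1; rewrite (cp_pA cp r1).
Qed.

Lemma cp_intB A B a b r : conj_pair A B a b -> `|r| < 1 ->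
  mu.-integrable TT (EFin \o B r).
Proof. by move=> cp; exact: cp_intA (cp_swap cp). Qed.

(** The integral of [A r] over the circle has derivative the integral of [a r]. By Cauchy-Riemann, r
    times [a r] is the derivative in t of the periodic function [B r], so this integral vanishes for
    nonzero r, and the mean value theorem on [0, r] concludes. *)
Lemma conj_pair_mean A B a b r : conj_pair A B a b -> 0 <= r < 1 ->
  Rintegral mu TT (A r) = Rintegral mu TT (A 0).
Proof.
move=> cp /andP[]; rewrite le_eqVlt => /orP[/eqP <- //|r0 r1].
(* A radius strictly between r and 1, so that [0, r] lies in an open interval on which the bounds of
   the pair are uniform. *)
pose rho := (1 + r) / 2.
have rho1 : rho < 1 by rewrite /rho; lra.
have [C h] := cp_bnd cp rho1.
pose M x := Rintegral mu TT (A x).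
have lt1 (x : R) : - rho < x < rho -> `|x| < 1.
  by move=> hx; rewrite ltr_norml; move: hx => /andP[? ?]; apply/andP; split; lra.
have dM (x : R) : - rho < x < rho -> is_derive x 1 M (Rintegral mu TT (a x)).
  move=> hx.
  apply: (@is_derive_Rintegral _ _ _ mu TT measurable_TT A a (fun=> C) x (- rho) rho) => //.
  - by move=> y hy; apply: cp_intA cp (lt1 _ hy).
  - move=> y t hy _. by have h' := cp_Ar cp t (lt1 _ hy); exact: h'.
  - exact: integrable_cst_TT.
  - move=> y t /andP[y1 y2] _; have [] // := h y t.
    by rewrite ler_norml !ltW.
(* The factor x has to be cancelled; x = 0 may be left out because the mean value theorem evaluates
   the derivative at an interior point of [0, r]. *)
have a0 (x : R) : - rho < x < rho -> x != 0 -> Rintegral mu TT (a x) = 0.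
  move=> hx x0; have x1 := lt1 _ hx.
  have ia : mu.-integrable TT (EFin \o a x).
    apply: (@integrable_bdd _ _ C).
      exact: continuous_measurable_TT (cp_ca cp x1).
    move=> t _; have [] // := h x t.
    by move: hx => /andP[y1 y2]; rewrite ler_norml !ltW.
  apply: (mulfI x0); rewrite mulr0 -RintegralZl//; last exact: measurable_TT.
  have dB (t : R) : is_derive t 1 (B x) (x * a x t) by exact (cp_Bt cp t x1).
  have cB : continuous (fun t => x * a x t).
    move=> t; apply: cvgM; first exact: cvg_cst.
    by have h' := cp_ca cp x1 (x := t); exact: h'.
  by rewrite (Rintegral_derive dB cB) (cp_pB cp x1) subrr.
apply/eqP; rewrite -subr_eq0; apply/eqP; rewrite -/(M r) -/(M 0).
have [z z1||z z0 ->] := @MVT _ M (fun x => Rintegral mu TT (a x)) 0 r r0.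
- apply: dM; move: z1; rewrite in_itv/= => /andP[? ?].
  by rewrite /rho; apply/andP; split; lra.
- apply: continuous_in_subspaceT => x; rewrite inE/= in_itv/= => /andP[x0 xr].
  by apply: isd_cont; apply: dM; rewrite /rho; apply/andP; split; lra.
- move: z0; rewrite in_itv/= => /andP[z0 zr].
  rewrite a0 ?mul0r ?gt_eqF// /rho; apply/andP; split; lra.
Qed.

Lemma conj_pair_meanB A B a b r : conj_pair A B a b -> 0 <= r < 1 ->
  Rintegral mu TT (B r) = Rintegral mu TT (B 0).
Proof. by move=> cp; exact: conj_pair_mean (cp_swap cp). Qed.

End conj_pair_theory.

(** * Stability of conjugate pairs under the operations on holomorphic functions *)

Section conj_pair_closure.
Context {R : realType}.
Implicit Types A B a b : R -> R -> R.

Lemma cp_kernel : conj_pair (@kre R) kim kre1 kim1.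
Proof.
split.
- by move=> r t r1; exact (kre_is_derive_r t r1).
- by move=> r t r1; exact (kim_is_derive_r t r1).
- by move=> r t r1; exact (kre_is_derive_x t r1).
- by move=> r t r1; exact (kim_is_derive_x t r1).
- exact: continuous_kre1.
- exact: continuous_kim1.
- move=> rho rho1.
  exists (Num.max (2 / (1 - rho) ^+ 2) (8 / (1 - rho) ^+ 4)) => r t rr.
  by split; rewrite le_max ?kre_ub ?kim_ub ?kre1_ub ?kim1_ub ?orbT.
- by move=> r r1; rewrite -[2 * pi]add0r kre_periodic.
- by move=> r r1; rewrite -[2 * pi]add0r kim_periodic.
Qed.

Lemma cp_cst c : conj_pair (fun _ _ : R => c) (fun _ _ : R => 0)
  (fun _ _ : R => 0) (fun _ _ : R => 0).
Proof.
split => //.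
- by move=> r t _; exact: isd_cst.
- by move=> r t _; exact: isd_cst.
- by move=> r t _; rewrite mulr0; exact: isd_cst.
- by move=> r t _; rewrite mulr0; exact: isd_cst.
- by move=> r _ t; exact: cvg_cst.
- by move=> r _ t; exact: cvg_cst.
- by move=> rho _; exists `|c| => r t _; rewrite normr0 !normr_ge0 lexx.
Qed.

Lemma cp_D A B a b A' B' a' b' : conj_pair A B a b -> conj_pair A' B' a' b' ->
  conj_pair (fun r t => A r t + A' r t) (fun r t => B r t + B' r t)
    (fun r t => a r t + a' r t) (fun r t => b r t + b' r t).
Proof.
move=> cp cp'; split.
- by move=> r t r1; exact: isdD (cp_Ar cp t r1) (cp_Ar cp' t r1).
- by move=> r t r1; exact: isdD (cp_Br cp t r1) (cp_Br cp' t r1).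
- move=> r t r1.
  by apply: isd_eq (isdD (cp_At cp t r1) (cp_At cp' t r1)) _; rewrite mulrDr.
- move=> r t r1.
  by apply: isd_eq (isdD (cp_Bt cp t r1) (cp_Bt cp' t r1)) _; rewrite mulrDr.
- move=> r r1 t; have h := cp_ca cp r1 (x := t).
  by have h' := cp_ca cp' r1 (x := t); exact: (cvgD h h').
- move=> r r1 t; have h := cp_cb cp r1 (x := t).
  by have h' := cp_cb cp' r1 (x := t); exact: (cvgD h h').
- move=> rho rho1; have [C h] := cp_bnd cp rho1; have [C' h'] := cp_bnd cp' rho1.
  exists (C + C') => r t rr; have [h1 h2 h3 h4] := h r t rr.
  have [h1' h2' h3' h4'] := h' r t rr.
  by split; apply: le_trans (ler_normD _ _) _; exact: lerD.
- by move=> r r1; rewrite (cp_pA cp r1) (cp_pA cp' r1).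
- by move=> r r1; rewrite (cp_pB cp r1) (cp_pB cp' r1).
Qed.

Lemma cp_M A B a b A' B' a' b' : conj_pair A B a b -> conj_pair A' B' a' b' ->
  conj_pair (fun r t => A r t * A' r t - B r t * B' r t)
    (fun r t => A r t * B' r t + B r t * A' r t)
    (fun r t => a r t * A' r t + A r t * a' r t
              - (b r t * B' r t + B r t * b' r t))
    (fun r t => a r t * B' r t + A r t * b' r t
              + (b r t * A' r t + B r t * a' r t)).
Proof.
move=> cp cp'; split.
- move=> r t r1; apply: isdB.
    exact: isdM (cp_Ar cp t r1) (cp_Ar cp' t r1).
  exact: isdM (cp_Br cp t r1) (cp_Br cp' t r1).
- move=> r t r1; apply: isdD.
    exact: isdM (cp_Ar cp t r1) (cp_Br cp' t r1).
  exact: isdM (cp_Br cp t r1) (cp_Ar cp' t r1).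
- move=> r t r1; apply: isd_eq (isdB (isdM (cp_At cp t r1) (cp_At cp' t r1))
    (isdM (cp_Bt cp t r1) (cp_Bt cp' t r1))) _; ring.
- move=> r t r1; apply: isd_eq (isdD (isdM (cp_At cp t r1) (cp_Bt cp' t r1))
    (isdM (cp_Bt cp t r1) (cp_At cp' t r1))) _; ring.
- move=> r r1 t; have ca := cp_ca cp r1 (x := t).
  have ca' := cp_ca cp' r1 (x := t); have cb := cp_cb cp r1 (x := t).
  have cb' := cp_cb cp' r1 (x := t); have cA := cp_cA cp r1 (x := t).
  have cA' := cp_cA cp' r1 (x := t); have cB := cp_cB cp r1 (x := t).
  have cB' := cp_cB cp' r1 (x := t).
  exact: (cvgB (cvgD (cvgM ca cA') (cvgM cA ca'))
               (cvgD (cvgM cb cB') (cvgM cB cb'))).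
- move=> r r1 t; have ca := cp_ca cp r1 (x := t).
  have ca' := cp_ca cp' r1 (x := t); have cb := cp_cb cp r1 (x := t).
  have cb' := cp_cb cp' r1 (x := t); have cA := cp_cA cp r1 (x := t).
  have cA' := cp_cA cp' r1 (x := t); have cB := cp_cB cp r1 (x := t).
  have cB' := cp_cB cp' r1 (x := t).
  exact: (cvgD (cvgD (cvgM ca cB') (cvgM cA cb'))
               (cvgD (cvgM cb cA') (cvgM cB ca'))).
- move=> rho rho1; have [C h] := cp_bnd cp rho1; have [C' h'] := cp_bnd cp' rho1.
  (* Each component of the derivative of a product is a sum of four products, each at most |C|
     |C'|. *)
  exists (4 * (`|C| * `|C'|)) => r t rr; have [h1 h2 h3 h4] := h r t rr.
  have [h1' h2' h3' h4'] := h' r t rr.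
  have C0 := normr_ge0 C; have C0' := normr_ge0 C'.
  have cC := ler_norm C; have cC' := ler_norm C'.
  have CC : 0 <= `|C| * `|C'| by rewrite mulr_ge0.
  have M x y : `|x| <= C -> `|y| <= C' -> `|x * y| <= `|C| * `|C'|.
    by move=> ? ?; rewrite normrM ler_pM//; lra.
  split.
  + apply: le_trans (ler_normB _ _) _.
    have := M _ _ h1 h1'; have := M _ _ h2 h2'; lra.
  + apply: le_trans (ler_normD _ _) _.
    have := M _ _ h1 h2'; have := M _ _ h2 h1'; lra.
  + apply: le_trans (ler_normB _ _) _.
    have := ler_normD (a r t * A' r t) (A r t * a' r t).
    have := ler_normD (b r t * B' r t) (B r t * b' r t).
    have := M _ _ h1 h3'; have := M _ _ h3 h1'.
    have := M _ _ h2 h4'; have := M _ _ h4 h2'; lra.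
  + apply: le_trans (ler_normD _ _) _.
    have := ler_normD (a r t * B' r t) (A r t * b' r t).
    have := ler_normD (b r t * A' r t) (B r t * a' r t).
    have := M _ _ h1 h4'; have := M _ _ h3 h2'.
    have := M _ _ h2 h3'; have := M _ _ h4 h1'; lra.
- by move=> r r1; rewrite !(cp_pA cp r1, cp_pA cp' r1, cp_pB cp r1, cp_pB cp' r1).
- by move=> r r1; rewrite !(cp_pA cp r1, cp_pA cp' r1, cp_pB cp r1, cp_pB cp' r1).
Qed.

(** The dilation z -> h(c z). It brings functions taken at different radii onto one circle, where
    they can be added and multiplied. *)
Lemma cp_scale (c : R) A B a b : 0 <= c <= 1 -> conj_pair A B a b ->
  conj_pair (fun r t => A (c * r) t) (fun r t => B (c * r) t)
    (fun r t => c * a (c * r) t) (fun r t => c * b (c * r) t).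
Proof.
move=> /andP[c0 c1] cp.
have cr (r : R) : `|c * r| <= `|r| by rewrite normrM ger0_norm// ler_piMl.
have cr1 (r : R) : `|r| < 1 -> `|c * r| < 1 by exact: le_lt_trans (cr r).
have dc (r : R) : is_derive r 1 (fun y => c * y) c.
  by apply: isd_eq (isdM (isd_cst c r) (isd_id r)) _; ring.
split.
- move=> r t r1; apply: isd_eq (isdcomp (h := A ^~ t) (cp_Ar cp t (cr1 _ r1)) (dc r)) _.
  by rewrite mulrC.
- move=> r t r1; apply: isd_eq (isdcomp (h := B ^~ t) (cp_Br cp t (cr1 _ r1)) (dc r)) _.
  by rewrite mulrC.
- by move=> r t r1; apply: isd_eq (cp_At cp t (cr1 _ r1)) _; ring.
- by move=> r t r1; apply: isd_eq (cp_Bt cp t (cr1 _ r1)) _; ring.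
- move=> r r1 t; have ca := cp_ca cp (cr1 _ r1) (x := t).
  by apply: cvgM; [exact: cvg_cst|exact: ca].
- move=> r r1 t; have ca := cp_cb cp (cr1 _ r1) (x := t).
  by apply: cvgM; [exact: cvg_cst|exact: ca].
- move=> rho rho1; have [C h] := cp_bnd cp rho1.
  exists C => r t rr; have [h1 h2 h3 h4] := h _ t (le_trans (cr r) rr).
  split => //; rewrite normrM ger0_norm//.
    by apply: le_trans h3; rewrite ler_piMl.
  by apply: le_trans h4; rewrite ler_piMl.
- by move=> r r1; rewrite (cp_pA cp (cr1 _ r1)).
- by move=> r r1; rewrite (cp_pB cp (cr1 _ r1)).
Qed.

(** The logarithm of h = X + i Y, with log |h| as real part; since X > 0, atan (Y / X) is the
    argument. The derivative h'/h is written as h' times the conjugate of h over |h|^2. From X >= 1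
    follows N >= 1, which makes ln N nonnegative and keeps the quotients by N bounded. *)
Lemma cp_ln X Y a b : (forall r t, `|r| < 1 -> 1 <= X r t) ->
  conj_pair X Y a b ->
  let N r t := X r t ^+ 2 + Y r t ^+ 2 in
  conj_pair (fun r t => ln (N r t) / 2)
    (fun r t => atan (Y r t / X r t))
    (fun r t => (X r t * a r t + Y r t * b r t) / N r t)
    (fun r t => (X r t * b r t - Y r t * a r t) / N r t).
Proof.
move=> X1 cp N.
have N1 r t : `|r| < 1 -> 1 <= N r t.
  move=> r1; have := X1 r t r1; rewrite /N => h.
  have := sqr_ge0 (Y r t); nra.
have N0 r t : `|r| < 1 -> 0 < N r t.
  by move=> r1; apply: lt_le_trans (N1 r t r1).
have NN r t : `|r| < 1 -> N r t != 0 by move=> r1; rewrite gt_eqF ?N0.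
have XN r t : `|r| < 1 -> X r t != 0.
  by move=> r1; rewrite gt_eqF// (lt_le_trans _ (X1 r t r1)).
have cNV r : `|r| < 1 -> continuous (fun t => (N r t)^-1).
  move=> r1 t; have cA := cp_cA cp r1 (x := t); have cB := cp_cB cp r1 (x := t).
  apply: cvgV; first exact: NN.
  exact: (cvgD (cvgM cA cA) (cvgM cB cB)).
(* One chain rule computation along an arbitrary real curve, used both for the variable r and for
   the variable t. *)
have aux (f g : R -> R) (x df dg : R) : is_derive x 1 f df -> is_derive x 1 g dg ->
    f x != 0 -> 0 < f x ^+ 2 + g x ^+ 2 ->
    is_derive x 1 (fun y => ln (f y ^+ 2 + g y ^+ 2) / 2)
      ((f x * df + g x * dg) / (f x ^+ 2 + g x ^+ 2)) /\
    is_derive x 1 (fun y => atan (g y / f y))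
      ((f x * dg - g x * df) / (f x ^+ 2 + g x ^+ 2)).
  move=> ff gg f0 n0; have n0' : f x ^+ 2 + g x ^+ 2 != 0 by rewrite gt_eqF.
  have f2 := isdcomp (isd_sqr (f x)) ff; have g2 := isdcomp (isd_sqr (g x)) gg.
  split.
    have l := isdcomp (f := fun y => f y ^+ 2 + g y ^+ 2) (is_derive1_ln n0) (isdD f2 g2).
    apply: isd_eq (isdM l (isd_cst (2^-1) x)) _.
    by field.
  have d := isdM gg (isdV ff f0).
  apply: isd_eq (isdcomp (f := fun y => g y / f y) (is_derive1_atan (g x / f x)) d) _.
  field.
  by rewrite f0 n0'.
split.
- move=> r t r1.
  by have [] := aux _ _ _ _ _ (cp_Ar cp t r1) (cp_Br cp t r1) (XN _ _ r1) (N0 _ _ r1).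
- move=> r t r1.
  by have [] := aux _ _ _ _ _ (cp_Ar cp t r1) (cp_Br cp t r1) (XN _ _ r1) (N0 _ _ r1).
- move=> r t r1.
  have [h _] := aux _ _ _ _ _ (cp_At cp t r1) (cp_Bt cp t r1) (XN _ _ r1) (N0 _ _ r1).
  apply: isd_eq h _; rewrite [RHS]mulrA; congr (_ / _); ring.
- move=> r t r1.
  have [_ h] := aux _ _ _ _ _ (cp_At cp t r1) (cp_Bt cp t r1) (XN _ _ r1) (N0 _ _ r1).
  apply: isd_eq h _; rewrite [RHS]mulrA; congr (_ / _); ring.
- move=> r r1 t; have ca := cp_ca cp r1 (x := t); have cb := cp_cb cp r1 (x := t).
  have cA := cp_cA cp r1 (x := t); have cB := cp_cB cp r1 (x := t).
  have cN := cNV r r1 t.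
  exact: (cvgM (cvgD (cvgM cA ca) (cvgM cB cb)) cN).
- move=> r r1 t; have ca := cp_ca cp r1 (x := t); have cb := cp_cb cp r1 (x := t).
  have cA := cp_cA cp r1 (x := t); have cB := cp_cB cp r1 (x := t).
  have cN := cNV r r1 t.
  exact: (cvgM (cvgB (cvgM cA cb) (cvgM cB ca)) cN).
- move=> rho rho1; have [C h] := cp_bnd cp rho1.
  (* [pi] covers atan; 2 |C|^2 covers ln N <= N and the numerators of the derivative, whose
     denominator N is at least 1. *)
  exists (pi + 2 * `|C| ^+ 2) => r t rr; have [h1 h2 h3 h4] := h r t rr.
  have r1 := le_lt_trans rr rho1.
  have C0 := normr_ge0 C; have cC := ler_norm C.
  have M x y : `|x| <= C -> `|y| <= C -> `|x * y| <= `|C| ^+ 2.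
    by move=> ? ?; rewrite normrM expr2 ler_pM//; lra.
  have p0 := pi_gt0 R.
  have C2 : 0 <= `|C| ^+ 2 by rewrite exprn_ge0.
  have D x : `|x| <= 2 * `|C| ^+ 2 -> `|x / N r t| <= pi + 2 * `|C| ^+ 2.
    move=> hx; rewrite normrM; apply: (@le_trans _ _ `|x|); last lra.
    rewrite ler_piMr// ger0_norm ?invr_ge0 ?(ltW (N0 _ _ r1))//.
    by rewrite invf_le1 ?N0// N1.
  split.
  + have l0 : 0 <= ln (N r t) by rewrite ln_ge0// N1.
    rewrite ger0_norm ?divr_ge0//.
    have : ln (N r t) < N r t by rewrite ln_sublinear// N0.
    have : N r t <= 2 * `|C| ^+ 2.
      have := le_trans (ler_norm _) (M _ _ h1 h1).
      have := le_trans (ler_norm _) (M _ _ h2 h2); rewrite /N !expr2; lra.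
    lra.
  + have t1 := atan_ltpi2 (Y r t / X r t).
    have t2 := atan_gtNpi2 (Y r t / X r t).
    by rewrite ler_norml; apply/andP; split; lra.
  + apply: D; apply: le_trans (ler_normD _ _) _.
    have := M _ _ h1 h3; have := M _ _ h2 h4; lra.
  + apply: D; apply: le_trans (ler_normB _ _) _.
    have := M _ _ h1 h4; have := M _ _ h2 h3; lra.
- by move=> r r1; rewrite /N (cp_pA cp r1) (cp_pB cp r1).
- by move=> r r1; rewrite /N (cp_pA cp r1) (cp_pB cp r1).
Qed.

End conj_pair_closure.

(** * Poisson and conjugate Poisson integrals as conjugate pairs *)

Section schwarz_integral.
Context {R : realType} d (S : measurableType d) (nu : {measure set S -> \bar R}).
Context (D : set S) (mD : measurable D) (th : S -> R) (mth : measurable_fun D th).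
Implicit Types u : S -> R.

(* th is the identity, read on the Borel or on the Lebesgue sigma-algebra *)
Definition kint (k : R -> R -> R) u (r t : R) : R :=
  (2 * pi)^-1 * Rintegral nu D (fun s => k r (t - th s) * u s).

Lemma measurable_kshift (k : R -> R) t : continuous k ->
  measurable_fun D (fun s => k (t - th s)).
Proof.
move=> ck; apply: (measurableT_comp (f := k)).
  exact: continuous_measurable_fun.
by apply: measurable_funB => //; exact: measurable_cst.
Qed.

Lemma integrable_kint (k : R -> R) u C t :
  continuous k -> (forall x, `|k x| <= C) ->
  nu.-integrable D (EFin \o u) ->
  nu.-integrable D (EFin \o (fun s => k (t - th s) * u s)).
Proof.
move=> ck kC iu; apply: (integrable_Mbdd mD iu (measurable_kshift t ck) (C := C)).
by move=> s _; exact: kC.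
Qed.

(** Every condition on the kernel is uniform in the angle, so it survives integration against the
    integrable [u], with a constant times |u| as majorant. The abstract measure allows the lemma to
    serve both for Borel and for Lebesgue measurable data. *)
Lemma cp_kint u : nu.-integrable D (EFin \o u) ->
  conj_pair (kint kre u) (kint kim u) (kint kre1 u) (kint kim1 u).
Proof.
move=> iu.
have iaux (k : R -> R -> R) (rho C : R) : (forall r, `|r| < 1 -> continuous (k r)) ->
    (forall r x, `|r| <= rho -> `|k r x| <= C) -> rho < 1 ->
    forall r t, `|r| <= rho ->
    nu.-integrable D (EFin \o (fun s => k r (t - th s) * u s)).
  move=> ck kC rho1 r t rr; apply: (@integrable_kint _ _ C) => //.
    by apply: ck; exact: le_lt_trans rr rho1.
  by move=> x; exact: kC.
have dr (k dk : R -> R -> R) :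
    (forall r x : R, `|r| < 1 -> is_derive r 1 (k ^~ x) (dk r x)) ->
    (forall r, `|r| < 1 -> continuous (k r)) ->
    (forall rho, rho < 1 -> exists C : R, forall r x, `|r| <= rho -> `|k r x| <= C) ->
    (forall rho, rho < 1 -> exists C : R, forall r x, `|r| <= rho -> `|dk r x| <= C) ->
    forall r t : R, `|r| < 1 -> is_derive r 1 (kint k u ^~ t) (kint dk u r t).
  move=> kdk ck bk bdk r t r1.
  pose rho := (1 + `|r|) / 2; have rho1 : rho < 1 by rewrite /rho; lra.
  have [C kC] := bk _ rho1; have [C' dkC] := bdk _ rho1.
  have lerho (x : R) : - rho < x < rho -> `|x| <= rho.
    by move=> /andP[? ?]; rewrite ler_norml !ltW.
  have h : is_derive r 1 (fun x => Rintegral nu D (fun s => k x (t - th s) * u s))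
      (Rintegral nu D (fun s => dk r (t - th s) * u s)).
    apply: (@is_derive_Rintegral _ _ _ nu D mD (fun x s => k x (t - th s) * u s)
      (fun x s => dk x (t - th s) * u s) (fun s => C' * `|u s|) r (- rho) rho).
    - have := ler_norm r; have := ler_norm (- r); rewrite normrN /rho => ? ?.
      by apply/andP; split; lra.
    - move=> x hx; apply: iaux ck kC rho1 _ _ _; exact: lerho.
    - move=> x s /lerho hx _.
      have h' := kdk x (t - th s) (le_lt_trans hx rho1).
      by apply: isd_eq (isdM h' (isd_cst (u s) x)) _; rewrite mulr0 addr0.
    - have ing := integrable_norm iu.
      by have := integrableZl mD C' ing; apply: eq_integrable.
    - by move=> x s /lerho hx _; rewrite normrM ler_wpM2r// dkC.
  by apply: isd_eq (isdM (isd_cst (2 * pi)^-1 r) h) _; rewrite mul0r add0r.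
have dt (k dk : R -> R -> R) (c : R) (r : R) (C C' : R) :
    (forall x : R, is_derive x 1 (k r) (c * dk r x)) ->
    (forall x, `|k r x| <= C) -> (forall x, `|dk r x| <= C') -> 
    continuous (dk r) ->
    forall t : R, is_derive t 1 (kint k u r) (c * kint dk u r t).
  move=> kdk kC dkC cdk t.
  have h : is_derive t 1 (fun t => Rintegral nu D (fun s => k r (t - th s) * u s))
      (Rintegral nu D (fun s => c * dk r (t - th s) * u s)).
    apply: (@is_derive_Rintegral _ _ _ nu D mD (fun t s => k r (t - th s) * u s)
      (fun t s => c * dk r (t - th s) * u s) (fun s => `|c| * C' * `|u s|) t (t - 1) (t + 1)).
    - by apply/andP; split; lra.
    - move=> x _; apply: (@integrable_kint _ _ C) => //.
      by move=> y; exact: isd_cont (kdk y).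
    - move=> x s _ _.
      have sh : is_derive x 1 (fun y => y - th s) 1.
        by apply: isd_eq (isdB (isd_id x) (isd_cst (th s) x)) _; rewrite subr0.
      have h' := isdcomp (f := fun y => y - th s) (kdk (x - th s)) sh.
      by apply: isd_eq (isdM h' (isd_cst (u s) x)) _; rewrite mulr0 addr0 mulr1.
    - have ing := integrable_norm iu.
      by have := integrableZl mD (`|c| * C') ing; apply: eq_integrable.
    - by move=> x s _ _; rewrite !normrM ler_wpM2r// ler_wpM2l.
  apply: isd_eq (isdM (isd_cst (2 * pi)^-1 t) h) _; rewrite mul0r add0r.
  rewrite /kint mulrCA; congr (_ * _).
  rewrite -RintegralZl//; last exact: integrable_kint iu.
  by apply: eq_Rintegral => s _; rewrite mulrA.
(* Continuity in t of the derivative components, which are not themselves differentiated: continuity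
   under the integral sign replaces the derivative argument. *)
have ct (k : R -> R -> R) (r C : R) : continuous (k r) ->
   (forall x, `|k r x| <= C) -> continuous (kint k u r).
  move=> ck kC t; apply: cvgM; first exact: cvg_cst.
  have tI : t \in (`]t - 1, t + 1[%classic : set R).
    by rewrite inE/= in_itv/=; apply/andP; split; lra.
  apply: (@continuity_under_integral R _ S nu (fun x s => k r (x - th s) * u s) D mD
    (t - 1) (t + 1) _ _ (fun s => C * `|u s|) _ _ t tI).
  - by move=> x _; exact: integrable_kint iu.
  - apply: aeW => s _ x _; apply: cvgM; last exact: cvg_cst.
    apply: (@continuous_comp _ _ _ (fun y => y - th s) (k r)); last exact: ck.
    by apply: cvgB; [exact: cvg_id|exact: cvg_cst].
  - have ing := integrable_norm iu.
    by have := integrableZl mD C ing; apply: eq_integrable.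
  - by move=> x _; apply: aeW => s _; rewrite normrM ler_wpM2r.
have bk (k : R -> R -> R) (rho C : R) :
    (forall r, `|r| < 1 -> continuous (k r)) -> rho < 1 ->
    (forall r x, `|r| <= rho -> `|k r x| <= C) -> forall r t, `|r| <= rho ->
    `|kint k u r t| <= (2 * pi)^-1 * (C * Rintegral nu D (fun s => `|u s|)).
  move=> ck rho1 kC r t rr; rewrite /kint normrM ger0_norm; last first.
    by rewrite invr_ge0 ltW// pi2_gt0.
  rewrite ler_wpM2l ?invr_ge0 ?(ltW pi2_gt0)//.
  apply: (@le_norm_RintegralM _ _ _ nu D mD (fun s => k r (t - th s)) u C) => //.
    by apply: measurable_kshift; apply: ck; exact: le_lt_trans rr rho1.
  by move=> s _; exact: kC.
have Bk (rho : R) : rho < 1 -> exists C : R, forall r x, `|r| <= rho ->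
  [/\ `|kre r x| <= C, `|kim r x| <= C, `|kre1 r x| <= C & `|kim1 r x| <= C].
  by move=> rho1; have h := cp_bnd cp_kernel rho1; exact: h.
have Bk1 (rho : R) : rho < 1 -> exists C : R, forall r x, `|r| <= rho -> `|kre r x| <= C.
  by move=> /Bk[C h]; exists C => r x /(h r x)[].
have Bk2 (rho : R) : rho < 1 -> exists C : R, forall r x, `|r| <= rho -> `|kim r x| <= C.
  by move=> /Bk[C h]; exists C => r x /(h r x)[].
have Bk3 (rho : R) : rho < 1 -> exists C : R, forall r x, `|r| <= rho -> `|kre1 r x| <= C.
  by move=> /Bk[C h]; exists C => r x /(h r x)[].
have Bk4 (rho : R) : rho < 1 -> exists C : R, forall r x, `|r| <= rho -> `|kim1 r x| <= C.
  by move=> /Bk[C h]; exists C => r x /(h r x)[].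
split.
- apply: (dr kre kre1 _ continuous_kre Bk1 Bk3) => r t r1.
  by exact (kre_is_derive_r t r1).
- apply: (dr kim kim1 _ continuous_kim Bk2 Bk4) => r t r1.
  by exact (kim_is_derive_r t r1).
- move=> r t r1; have [C h] := Bk _ r1.
  apply: (dt kre kim1 _ _ C C); last exact: continuous_kim1.
  + by move=> x; exact (kre_is_derive_x x r1).
  + by move=> x; have [] := h r x (lexx _).
  + by move=> x; have [] := h r x (lexx _).
- move=> r t r1; have [C h] := Bk _ r1.
  apply: (dt kim kre1 _ _ C C); last exact: continuous_kre1.
  + by move=> x; exact (kim_is_derive_x x r1).
  + by move=> x; have [] := h r x (lexx _).
  + by move=> x; have [] := h r x (lexx _).
- move=> r r1; have [C h] := Bk _ r1.
  by apply: (ct kre1 _ C (continuous_kre1 r1)) => x; have [] := h r x (lexx _).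
- move=> r r1; have [C h] := Bk _ r1.
  by apply: (ct kim1 _ C (continuous_kim1 r1)) => x; have [] := h r x (lexx _).
- move=> rho rho1; have [C h] := Bk _ rho1.
  exists ((2 * pi)^-1 * (C * Rintegral nu D (fun s => `|u s|))) => r t rr.
  split.
  + by apply: (bk kre rho _ continuous_kre) => // y x /(h y x)[].
  + by apply: (bk kim rho _ continuous_kim) => // y x /(h y x)[].
  + by apply: (bk kre1 rho _ continuous_kre1) => // y x /(h y x)[].
  + by apply: (bk kim1 rho _ continuous_kim1) => // y x /(h y x)[].
- move=> r r1; congr (_ * _); apply: eq_Rintegral => s _; congr (_ * _).
  by rewrite add0r addrC kre_periodic.
- move=> r r1; congr (_ * _); apply: eq_Rintegral => s _; congr (_ * _).
  by rewrite add0r addrC kim_periodic.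
Qed.

End schwarz_integral.

(** * The function (1 + z) / (1 - z) in complex form and its addition formula *)

Section cayley.
Context {R : realType}.
Implicit Types r x : R.

Definition cpol (r x : R) : R[i] := Complex (r * cos x) (r * sin x).
Definition cayley (z : R[i]) : R[i] := (1 + z) / (1 - z).

Lemma complexM (a b c d : R) :
  Complex a b * Complex c d = Complex (a * c - b * d) (a * d + b * c).
Proof. by []. Qed.

Lemma complexD (a b c d : R) : Complex a b + Complex c d = Complex (a + c) (b + d).
Proof. by []. Qed.

Lemma complexB (a b c d : R) : Complex a b - Complex c d = Complex (a - c) (b - d).
Proof. by []. Qed.

Lemma complex1 : (1 : R[i]) = Complex 1 0. Proof. by []. Qed.

Lemma complex_eq (a b c d : R) : a = c -> b = d -> Complex a b = Complex c d.
Proof. by move=> -> ->. Qed.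

Lemma one_sub_cpol_neq0 r x : `|r| < 1 -> 1 - cpol r x != 0.
Proof.
move=> r1; apply/eqP => h; have := congr1 (@complex.Re R) h.
rewrite /= => h'.
have : r * cos x <= `|r * cos x| by exact: ler_norm.
rewrite normrM => h2; have : `|r| * `|cos x| <= `|r|.
  by rewrite ler_piMr// ler_norml cos_le1 cos_geN1.
lra.
Qed.

Lemma cayley_cpol r x : `|r| < 1 -> cayley (cpol r x) = Complex (kre r x) (kim r x).
Proof.
move=> r1; have d0 := kden_neq0 x r1; have z0 := one_sub_cpol_neq0 x r1.
apply: (mulIf z0); rewrite /cayley divfK// /cpol complex1 complexD complexB complexM.
have e : sin x ^+ 2 = 1 - cos x ^+ 2 by rewrite -(cos2Dsin2 x); ring.
rewrite /kre /kim; apply: complex_eq; apply: (mulIf d0).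
- transitivity ((1 - r ^+ 2) * (1 - r * cos x) + 2 * r ^+ 2 * sin x ^+ 2);
    last by field.
  by rewrite e /kden; ring.
- transitivity (2 * r * sin x * (1 - r * cos x) - (1 - r ^+ 2) * r * sin x);
    last by field.
  by rewrite /kden; ring.
Qed.

Lemma cpolM r s x y : cpol r x * cpol s y = cpol (r * s) (x + y).
Proof. by rewrite /cpol complexM cosD sinD; apply: complex_eq; ring. Qed.

(* imaginary part of K(a) K(b) = K(ab) (K(a) + K(b)) - 1, with K(z) = (1 + z) / (1 - z) *)
Lemma kim_addition r s x y : `|r| < 1 -> `|s| < 1 ->
  kre r x * kim s y + kim r x * kre s y =
  kre (r * s) (x + y) * (kim r x + kim s y)
  + kim (r * s) (x + y) * (kre r x + kre s y).
Proof.
move=> r1 s1; have rs1 : `|r * s| < 1.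
  rewrite normrM; apply: le_lt_trans s1; rewrite ler_piMl//; exact: ltW.
have a0 := one_sub_cpol_neq0 x r1; have b0 := one_sub_cpol_neq0 y s1.
have := one_sub_cpol_neq0 (x + y) rs1; rewrite -cpolM => ab0.
have e : cayley (cpol r x) * cayley (cpol s y) =
    cayley (cpol r x * cpol s y) * (cayley (cpol r x) + cayley (cpol s y)) - 1.
  by rewrite /cayley; field; rewrite ab0 a0 b0.
have := congr1 (@complex.Im R) e.
by rewrite cpolM !cayley_cpol//= subr0.
Qed.

End cayley.

(** * Means and convolution of the kernels on a circle *)

Section shifted_kernel.
Context {R : realType}.
Notation mu := (@lebesgue_measure R).
Implicit Types r t x rho : R.

Lemma cp_kernel_shift x : conj_pair (fun r t : R => kre r (t - x))
  (fun r t => kim r (t - x)) (fun r t => kre1 r (t - x)) (fun r t => kim1 r (t - x)).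
Proof.
have sh (t : R) : is_derive t 1 (fun y => y - x) 1.
  by apply: isd_eq (isdB (isd_id t) (isd_cst x t)) _; rewrite subr0.
have csh (k : R -> R) : continuous k -> continuous (fun t => k (t - x)).
  move=> ck t; apply: (@continuous_comp _ _ _ (fun y => y - x) k); last exact: ck.
  by apply: cvgB; [exact: cvg_id|exact: cvg_cst].
split.
- by move=> r t r1; exact (kre_is_derive_r (t - x) r1).
- by move=> r t r1; exact (kim_is_derive_r (t - x) r1).
- move=> r t r1; have h := kre_is_derive_x (t - x) r1.
  by apply: isd_eq (isdcomp (f := fun y => y - x) h (sh t)) _; rewrite mulr1.
- move=> r t r1; have h := kim_is_derive_x (t - x) r1.
  by apply: isd_eq (isdcomp (f := fun y => y - x) h (sh t)) _; rewrite mulr1.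
- by move=> r r1; exact: csh (continuous_kre1 r1).
- by move=> r r1; exact: csh (continuous_kim1 r1).
- move=> rho rho1; have [C h] := cp_bnd cp_kernel rho1.
  by exists C => r t rr; exact: h.
- by move=> r r1; rewrite add0r addrC kre_periodic.
- by move=> r r1; rewrite add0r addrC kim_periodic.
Qed.

Lemma mean_kre r x : 0 <= r < 1 -> Rintegral mu TT (fun t => kre r (t - x)) = 2 * pi.
Proof.
move=> r01; rewrite (conj_pair_mean (cp_kernel_shift x) r01).
by under eq_Rintegral do rewrite kre0; rewrite Rintegral_cst_TT mul1r.
Qed.

Lemma mean_kim r x : 0 <= r < 1 -> Rintegral mu TT (fun t => kim r (t - x)) = 0.
Proof.
move=> r01; rewrite (conj_pair_meanB (cp_kernel_shift x) r01).
by under eq_Rintegral do rewrite kim0; rewrite Rintegral_cst_TT mul0r.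
Qed.

Lemma norm_lt1 r : 0 <= r < 1 -> `|r| < 1.
Proof. by move=> /andP[r0 r1]; rewrite ger0_norm. Qed.

Lemma integrable_kre_shift r x : `|r| < 1 ->
  mu.-integrable TT (EFin \o (fun t => kre r (t - x))).
Proof. by move=> r1; have h := cp_intA (cp_kernel_shift x) r1; exact: h. Qed.

Lemma integrable_kim_shift r x : `|r| < 1 ->
  mu.-integrable TT (EFin \o (fun t => kim r (t - x))).
Proof. by move=> r1; have h := cp_intB (cp_kernel_shift x) r1; exact: h. Qed.

(** For holomorphic h and k, the function h(rho z / l) k(r z / l) is holomorphic, and its value on
    the circle of radius l is the product of h at radius rho and k at radius r. Its imaginary part
    has the mean of its value at the origin. *)
Lemma conj_pair_mean_prod A B a b A' B' a' b' (rho r : R) :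
  conj_pair A B a b -> conj_pair A' B' a' b' -> 0 <= rho < 1 -> 0 <= r < 1 ->
  Rintegral mu TT (fun t => A rho t * B' r t + B rho t * A' r t) =
  Rintegral mu TT (fun t => A 0 t * B' 0 t + B 0 t * A' 0 t).
Proof.
move=> cp cp' /andP[rho0 rho1] /andP[r0 r1].
(* A common radius below 1 and above both [rho] and [r]; it stays positive when both are 0, so that
   the division by l is legitimate. *)
pose l : R := 1 - (1 - rho) * (1 - r) / 2.
have l0 : 0 < l by rewrite /l; nra.
have l1 : l < 1 by rewrite /l; nra.
have lrho : rho <= l by rewrite /l; nra.
have lr : r <= l by rewrite /l; nra.
have c1 : 0 <= rho / l <= 1.
  by rewrite divr_ge0 ?(ltW l0)//= ler_pdivrMr// mul1r.
have c2 : 0 <= r / l <= 1.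
  by rewrite divr_ge0 ?(ltW l0)//= ler_pdivrMr// mul1r.
have l01 : 0 <= l < 1 by rewrite ltW.
have := conj_pair_meanB (cp_M (cp_scale c1 cp) (cp_scale c2 cp')) l01.
by rewrite /= !divfK ?gt_eqF// !mulr0.
Qed.

(** Let I be the integral sought, up to parity of the kernels, and J the same with the roles of real
    and imaginary parts exchanged. The mean value property gives I + J = 0, and the addition formula
    gives I - J. *)
Lemma kre_kim_semigroup rho r t x : 0 <= rho < 1 -> 0 <= r < 1 ->
  Rintegral mu TT (fun s => kre rho (t - s) * kim r (s - x)) =
  2 * pi * kim (rho * r) (t - x).
Proof.
move=> rho01 r01; have rho1 := norm_lt1 rho01; have r1 := norm_lt1 r01.
set g := rho * r.
(* I + J is the mean of the imaginary part of a product of two kernels, both equal to 1 at the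
   origin. *)
have e1 : Rintegral mu TT
   (fun s => kre rho (s - t) * kim r (s - x) + kim rho (s - t) * kre r (s - x)) = 0.
  rewrite (conj_pair_mean_prod (cp_kernel_shift t) (cp_kernel_shift x) rho01 r01).
  by under eq_Rintegral do rewrite !kim0 mulr0 mul0r addr0; rewrite Rintegral_cst_TT mul0r.
have kret s : kre rho (t - s) = kre rho (s - t) by rewrite -kreN opprB.
have kimt s : kim rho (t - s) = - kim rho (s - t) by rewrite -kimN opprB.
have i1 := integrable_kre_shift t rho1; have i2 := integrable_kim_shift t rho1.
have i3 := integrable_kre_shift x r1; have i4 := integrable_kim_shift x r1.
have mT := @measurable_TT R.
have iM (A B : R -> R -> R) a b (A' B' : R -> R -> R) a' b' :
    conj_pair A B a b -> conj_pair A' B' a' b' ->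
    mu.-integrable TT (EFin \o (fun s => A rho s * A' r s)).
  move=> cp cp'; have [C h] := cp_bnd cp rho1.
  apply: (integrable_Mbdd mT (cp_intA cp' r1)
    (continuous_measurable_TT (cp_cA cp rho1)) (C := C)).
  by move=> s _; have [] := h rho s (lexx _).
have cpt := cp_kernel_shift t; have cpx := cp_kernel_shift x.
have ipq := iM _ _ _ _ _ _ _ _ cpt (cp_swap cpx).
have iqp := iM _ _ _ _ _ _ _ _ (cp_swap cpt) cpx.
(* The angles t - s and s - x add up to t - x, which is free of s; on the right of the addition
   formula only the means 2 pi and 0 of single kernels remain to be integrated. *)
have e2 : Rintegral mu TT
   (fun s : R => kre rho (s - t) * kim r (s - x) - kim rho (s - t) * kre r (s - x)) =
   4 * pi * kim g (t - x).
  transitivity (Rintegral mu TT (fun s : R =>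
     kre g (t - x) * (kim r (s - x) - kim rho (s - t)) +
     kim g (t - x) * (kre rho (s - t) + kre r (s - x)))).
    apply: eq_Rintegral => s _.
    have := kim_addition (t - s) (s - x) rho1 r1.
    rewrite addrA subrK -/g kret kimt mulNr => ->.
    by rewrite [- _ + _]addrC.
  have ib : mu.-integrable TT (EFin \o (fun s => kim r (s - x) - kim rho (s - t))).
    by have := integrableB mT i4 i2; apply: eq_integrable.
  have id : mu.-integrable TT (EFin \o (fun s => kre rho (s - t) + kre r (s - x))).
    by have := integrableD mT i1 i3; apply: eq_integrable.
  have ib' : mu.-integrable TT
     (EFin \o (fun s => kre g (t - x) * (kim r (s - x) - kim rho (s - t)))).
    by have := integrableZl mT (kre g (t - x)) ib; apply: eq_integrable.
  have id' : mu.-integrable TT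
     (EFin \o (fun s => kim g (t - x) * (kre rho (s - t) + kre r (s - x)))).
    by have := integrableZl mT (kim g (t - x)) id; apply: eq_integrable.
  rewrite (RintegralD mT ib' id') (RintegralZl _ mT ib) (RintegralZl _ mT id).
  rewrite (RintegralB mT i4 i2) (RintegralD mT i1 i3).
  rewrite !mean_kre// !mean_kim//; ring.
under eq_Rintegral do rewrite kret.
rewrite (RintegralD mT ipq iqp) in e1; rewrite (RintegralB mT ipq iqp) in e2.
move: e1 e2; set I := Rintegral _ _ _; set J := Rintegral _ _ _.
move=> e1 e2; have -> : I = 2 * pi * kim g (t - x); last by [].
move: e1 e2; set z := kim _ _; nra.
Qed.

End shifted_kernel.

(** * Exchange of integrals in a double convolution *)

Section fubini_convolution.
Context {R : realType}.
Notation mu := (@lebesgue_measure R).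
Notation RT := (measurableTypeR R).

(** Stated on the whole line for Borel functions; functions on the circle enter it multiplied by the
    indicator of [TT]. *)
Lemma Fubini_convolution (h g w : R -> R) (C : R) :
  mu.-integrable setT (EFin \o h) -> mu.-integrable setT (EFin \o w) ->
  continuous g -> (forall x, `|g x| <= C) ->
  Rintegral mu setT (fun s => h s * Rintegral mu setT (fun x => g (s - x) * w x)) =
  Rintegral mu setT (fun x => Rintegral mu setT (fun s => h s * g (s - x)) * w x).
Proof.
move=> ih iw cg gC.
have mg : measurable_fun setT g by exact: continuous_measurable_fun.
have mh := measurable_L1 ih.
have mw := measurable_L1 iw.
pose F (z : RT * RT) : \bar R := (h z.1 * g (z.1 - z.2) * w z.2)%:E.
have mF : measurable_fun setT F.
  apply/measurable_EFinP; apply: measurable_funM; last first.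
    by apply: (measurableT_comp mw); exact: measurable_snd.
  apply: measurable_funM.
    by apply: (measurableT_comp mh); exact: measurable_fst.
  apply: (measurableT_comp mg); apply: measurable_funB.
    exact: measurable_fst.
  exact: measurable_snd.
have shiftg s : measurable_fun setT (fun x : RT => g (s - x)).
  by apply: (measurableT_comp mg); apply: measurable_funB.
have shiftg' x : measurable_fun setT (fun s : RT => g (s - x)).
  by apply: (measurableT_comp mg); apply: measurable_funB.
have igw s : mu.-integrable setT (EFin \o (fun x => g (s - x) * w x)).
  by apply: (integrable_Mbdd measurableT iw (shiftg s) (C := C)) => x _.
have ihg x : mu.-integrable setT (EFin \o (fun s => h s * g (s - x))).
  have := integrable_Mbdd measurableT ih (shiftg' x) (C := C).
  move=> /(_ (fun s _ => gC (s - x))); apply: eq_integrable => //= s _.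
  by rewrite mulrC.
(* By Tonelli: the inner integral of the modulus is at most |h(s)| times C times the L^1 norm of
   [w]. *)
have iF : (mu \x mu)%E.-integrable setT F.
  apply/(integrable12ltyP _ _ mF).
  have iw' := integrable_norm iw; have ih' := integrable_norm ih.
  apply: (@le_lt_trans _ _ (\int[mu]_s
     (`|h s| * (C * Rintegral mu setT (fun x => `|w x|)))%:E)%E).
    apply: ge0_le_integral => //.
    - by move=> s _; apply: integral_ge0.
    - apply: (@measurable_fun_fubini_tonelli_F _ _ _ _ _ mu (abse \o F)).
        by apply: measurableT_comp.
      by move=> z; exact: abse_ge0.
    - by apply/measurable_EFinP/measurable_funM => //; apply: measurableT_comp.
    - move=> s _; rewrite /F/=.
      apply: (@le_trans _ _ (\int[mu]_x (`|h s| * C * `|w x|)%:E)%E).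
        apply: ge0_le_integral => //.
        + apply/measurable_EFinP; apply: measurableT_comp => //.
          by apply: measurable_funM => //; apply: measurable_funM.
        + apply/measurable_EFinP/measurable_funM => //.
          by apply: measurableT_comp.
        + move=> x _; rewrite lee_fin !normrM ler_wpM2r// ler_wpM2l//.
      under eq_integral do rewrite EFinM.
      rewrite integralZl//.
      have fi : (\int[mu]_x (`|w x|)%:E)%E \is a fin_num.
        exact: (integrable_fin_num measurableT iw').
      by rewrite -[X in (_ * X)%E]fineK// -EFinM lee_fin mulrA.
  have : mu.-integrable setT
      (fun s => ((C * Rintegral mu setT (fun x => `|w x|))%:E * (`|h s|)%:E)%E).
    exact: integrableZl ih'.
  move=> /integrableP[_]; apply: le_lt_trans.
  apply: ge0_le_integral => //.
  - move=> s _; rewrite lee_fin mulr_ge0// mulr_ge0//.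
      by apply: le_trans (gC 0).
    exact: Rintegral_ge0.
  - by apply/measurable_EFinP/measurable_funM => //; apply: measurableT_comp.
  - apply: measurableT_comp => //; apply/measurable_EFinP/measurable_funM => //.
    by apply: measurableT_comp.
  - by move=> s _; rewrite -EFinM lee_fin mulrC ler_norm.
have := Fubini iF.
rewrite /F/= => e.
rewrite /Rintegral; congr fine.
transitivity (\int[mu]_s (\int[mu]_x (h s * g (s - x) * w x)%:E))%E.
  apply: eq_integral => s _.
  have fi : (\int[mu]_x (g (s - x) * w x)%:E)%E \is a fin_num.
    exact: (integrable_fin_num measurableT (igw s)).
  rewrite EFinM (fineK fi) -(integralZl measurableT (igw s)).
  by apply: eq_integral => x _; rewrite -EFinM mulrA.
apply: (etrans e); apply: eq_integral => x _.
have fi : (\int[mu]_s (h s * g (s - x))%:E)%E \is a fin_num.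
  exact: (integrable_fin_num measurableT (ihg x)).
by rewrite EFinM (fineK fi) -(integralZr measurableT (ihg x)).
Qed.

End fubini_convolution.

(** * Values at the origin, total mass, positivity and linearity *)

Section kint_at_zero.
Context {R : realType} d (S : measurableType d) (nu : {measure set S -> \bar R}).
Context (D : set S) (mD : measurable D) (th : S -> R) (mth : measurable_fun D th).
Notation mu := (@lebesgue_measure R).
Implicit Types u : S -> R.

Lemma kint_kre0 u t : kint nu D th kre u 0 t = (2 * pi)^-1 * Rintegral nu D u.
Proof. by congr (_ * _); apply: eq_Rintegral => s _; rewrite kre0 mul1r. Qed.

Lemma kint_kim0 u t : kint nu D th kim u 0 t = 0.
Proof.
rewrite /kint; under eq_Rintegral do rewrite kim0 mul0r.
by rewrite Rintegral_cst// mul0r mulr0.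
Qed.

(** The mean value property moves the integral to radius 0, where the kernel is identically 1. *)
Lemma Rintegral_kint_kre u r : nu.-integrable D (EFin \o u) -> 0 <= r < 1 ->
  Rintegral mu TT (kint nu D th kre u r) = Rintegral nu D u.
Proof.
move=> iu r01; rewrite (conj_pair_mean (cp_kint mD mth iu) r01).
have -> : Rintegral mu TT (kint nu D th kre u 0) =
    Rintegral mu TT (fun=> (2 * pi)^-1 * Rintegral nu D u).
  by apply: eq_Rintegral => t _; exact: kint_kre0.
by rewrite Rintegral_cst_TT mulrAC mulVf ?mul1r// gt_eqF// pi2_gt0.
Qed.

Lemma kint_kre_ge0 u r t : `|r| < 1 -> (forall s, D s -> 0 <= u s) ->
  0 <= kint nu D th kre u r t.
Proof.
move=> r1 u0; rewrite mulr_ge0 ?invr_ge0 ?(ltW pi2_gt0)//.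
by apply: Rintegral_ge0 => s Ds; rewrite mulr_ge0 ?kre_ge0 ?u0.
Qed.

Lemma integrable_kre u r t : `|r| < 1 -> nu.-integrable D (EFin \o u) ->
  nu.-integrable D (EFin \o (fun s => kre r (t - th s) * u s)).
Proof.
move=> r1 iu; have [C h] := cp_bnd cp_kernel r1.
apply: (integrable_kint mD mth t (continuous_kre r1) _ iu (C := C)) => x.
by have [] := h r x (lexx _).
Qed.

Lemma integrable_kim u r t : `|r| < 1 -> nu.-integrable D (EFin \o u) ->
  nu.-integrable D (EFin \o (fun s => kim r (t - th s) * u s)).
Proof.
move=> r1 iu; have [C h] := cp_bnd cp_kernel r1.
apply: (integrable_kint mD mth t (continuous_kim r1) _ iu (C := C)) => x.
by have [] := h r x (lexx _).
Qed.

Lemma kint_kreD u v r t : `|r| < 1 ->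
  nu.-integrable D (EFin \o u) -> nu.-integrable D (EFin \o v) ->
  kint nu D th kre (fun s => u s + v s) r t = kint nu D th kre u r t + kint nu D th kre v r t.
Proof.
move=> r1 iu iv; rewrite /kint -mulrDr; congr (_ * _).
rewrite -(RintegralD mD (integrable_kre t r1 iu) (integrable_kre t r1 iv)).
by apply: eq_Rintegral => s _; rewrite mulrDr.
Qed.

Lemma kint_kimD u v r t : `|r| < 1 ->
  nu.-integrable D (EFin \o u) -> nu.-integrable D (EFin \o v) ->
  kint nu D th kim (fun s => u s + v s) r t = kint nu D th kim u r t + kint nu D th kim v r t.
Proof.
move=> r1 iu iv; rewrite /kint -mulrDr; congr (_ * _).
rewrite -(RintegralD mD (integrable_kim t r1 iu) (integrable_kim t r1 iv)).
by apply: eq_Rintegral => s _; rewrite mulrDr.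
Qed.

Lemma kint_kreZ c u r t : `|r| < 1 -> nu.-integrable D (EFin \o u) ->
  kint nu D th kre (fun s => c * u s) r t = c * kint nu D th kre u r t.
Proof.
move=> r1 iu; rewrite /kint mulrCA; congr (_ * _).
rewrite -(RintegralZl c mD (integrable_kre t r1 iu)).
by apply: eq_Rintegral => s _; rewrite mulrCA.
Qed.

Lemma kint_kimZ c u r t : `|r| < 1 -> nu.-integrable D (EFin \o u) ->
  kint nu D th kim (fun s => c * u s) r t = c * kint nu D th kim u r t.
Proof.
move=> r1 iu; rewrite /kint mulrCA; congr (_ * _).
rewrite -(RintegralZl c mD (integrable_kim t r1 iu)).
by apply: eq_Rintegral => s _; rewrite mulrCA.
Qed.

Lemma le_kint_kre u v r t : `|r| < 1 ->
  nu.-integrable D (EFin \o u) -> nu.-integrable D (EFin \o v) ->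
  (forall s, D s -> u s <= v s) ->
  kint nu D th kre u r t <= kint nu D th kre v r t.
Proof.
move=> r1 iu iv uv; rewrite ler_wpM2l ?invr_ge0 ?(ltW pi2_gt0)//.
apply: le_Rintegral => //; [exact: integrable_kre|exact: integrable_kre|].
by move=> s Ds; rewrite ler_wpM2l ?kre_ge0 ?uv.
Qed.

End kint_at_zero.

Lemma pi2_neq0 {R : realType} : 2 * pi != 0 :> R.
Proof. by rewrite gt_eqF// pi2_gt0. Qed.

(** * Poisson integrals on the circle and the estimates from (1 + V) log (1 + V) *)

Section poisson.
Context {R : realType}.
Notation mu := (@lebesgue_measure R).
Implicit Types (u v : R -> R) (r t x y : R).

Definition PI u := kint mu TT (fun s : R => s) kre u.
Definition QI u := kint mu TT (fun s : R => s) kim u.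

Notation L1 u := (mu.-integrable TT (EFin \o u)).

Lemma measurable_idTT : measurable_fun (TT : set (measurableTypeR R)) (fun s : R => s).
Proof. exact: measurable_id. Qed.

Lemma cp_PI u : L1 u -> conj_pair (PI u) (QI u)
  (kint mu TT (fun s : R => s) kre1 u) (kint mu TT (fun s : R => s) kim1 u).
Proof. by move=> iu; exact (cp_kint measurable_TT measurable_idTT iu). Qed.

(** Fubini reduces this to the convolution of the two kernels, computed in [kre_kim_semigroup]. *)
Lemma PI_QI u rho r t : L1 u -> 0 <= rho < 1 -> 0 <= r < 1 ->
  PI (QI u r) rho t = QI u (rho * r) t.
Proof.
move=> iu rho01 r01; have rho1 := norm_lt1 rho01; have r1 := norm_lt1 r01.
have mT := @measurable_TT R.
(* The kernel and [u] are cut off outside one period in order to integrate over the line. *)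
pose h s := (fun s => kre rho (t - s)) s * \1_(TT : set R) s.
pose w s := u s * \1_(TT : set R) s.
have ind (f : R -> R) s : (f \_ TT) s = f s * \1_(TT : set R) s.
  by rewrite patchE indicE; case: ifP; rewrite ?mulr1 ?mulr0.
have ih : mu.-integrable setT (EFin \o h).
  have := integrable_kre_shift t rho1.
  move=> /(integrable_mkcond _ mT); apply: eq_integrable => //= s _.
  by rewrite restrict_EFin/= ind -kreN opprB.
have iw : mu.-integrable setT (EFin \o w).
  move: iu => /(integrable_mkcond _ mT); apply: eq_integrable => //= s _.
  by rewrite restrict_EFin/= ind.
have [C hC] := cp_bnd cp_kernel r1.
have kC x : `|kim r x| <= C by have [] := hC r x (lexx _).
have e := Fubini_convolution ih iw (continuous_kim r1) kC.
rewrite /PI {1}/kint.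
have -> : Rintegral mu TT (fun s => kre rho (t - s) * QI u r s) =
   (2 * pi)^-1 * Rintegral mu setT
      (fun s => h s * Rintegral mu setT (fun x => kim r (s - x) * w x)).
  have e2 s : QI u r s = (2 * pi)^-1 *
      Rintegral mu setT (fun x => kim r (s - x) * w x).
    congr (_ * _); rewrite Rintegral_mkcond; apply: eq_Rintegral => x _.
    by rewrite ind mulrA.
  rewrite Rintegral_mkcond.
  have iq : L1 (fun s => kre rho (t - s) * QI u r s).
    have iQ := cp_intB (cp_PI iu) r1.
    exact (integrable_kre mT measurable_idTT t rho1 iQ).
  rewrite -RintegralZl//; last first.
    move: (iq) => /(integrable_mkcond _ mT) iq'.
    have := integrableZl measurableT (2 * pi) iq'.
    apply: eq_integrable => //= s _.
    rewrite restrict_EFin/= ind -EFinM e2 /h; congr (_%:E).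
    have := @pi2_neq0 R; move: (2 * pi) => p p0; field; exact: p0.
  by apply: eq_Rintegral => s _; rewrite ind e2 /h; ring.
rewrite e /QI /kint; congr (_ * _); rewrite [RHS]Rintegral_mkcond.
have mw := measurable_L1 iw.
rewrite -RintegralZl//; last first.
  have ikw : mu.-integrable setT (EFin \o (fun x => kim (rho * r) (t - x) * w x)).
    have rr1 : `|rho * r| < 1.
      by rewrite normrM; apply: le_lt_trans r1; rewrite ler_piMl// ltW.
    have [C' hC'] := cp_bnd cp_kernel rr1.
    apply: (integrable_Mbdd measurableT iw _ (C := C')).
      apply: (measurable_kshift (D := setT) (th := fun s : R => s)) => //.
      exact: continuous_kim.
    by move=> s _; have [] := hC' _ (t - s) (lexx _).
  have := integrableZl measurableT (2 * pi) ikw.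
  apply: eq_integrable => //= s _.
  rewrite -EFinM; congr (_%:E); rewrite mulrA; congr (_ * _).
  rewrite -kre_kim_semigroup// Rintegral_mkcond; apply: eq_Rintegral => x _.
  by rewrite ind /h; ring.
apply: eq_Rintegral => s _; rewrite ind.
have -> : Rintegral mu setT (fun x => h x * kim r (x - s)) =
    2 * pi * kim (rho * r) (t - s).
  rewrite -kre_kim_semigroup// Rintegral_mkcond; apply: eq_Rintegral => x _.
  by rewrite ind /h; ring.
have := @pi2_neq0 R; rewrite /w; move: (2 * pi) => p p0; field; exact: p0.
Qed.

Lemma PI_cst c r t : 0 <= r < 1 -> PI (fun=> c) r t = c.
Proof.
move=> r01; rewrite /PI /kint.
have i1 := integrable_kre_shift t (norm_lt1 r01).
under eq_Rintegral do rewrite -kreN opprB.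
rewrite RintegralZr//; last exact: measurable_TT.
by rewrite mean_kre// mulrA mulVf ?mul1r// gt_eqF// pi2_gt0.
Qed.

(** The value of Re ((1 + V) log (1 + V)) at real V = x; for x >= 0 it is convex, nonnegative and
    comparable with x log^+ x up to affine terms. *)
Definition phi x : R := (1 + x) * ln (1 + x).

(** Convexity in the form of the tangent at x; it is ln q <= q - 1 at q = (1 + x) / (1 + y),
    multiplied by 1 + y. *)
Lemma phi_tangent x y : 0 <= x -> 0 <= y ->
  phi x + (1 + ln (1 + x)) * (y - x) <= phi y.
Proof.
move=> x0 y0; rewrite /phi.
have x1 : 0 < 1 + x by lra.
have y1 : 0 < 1 + y by lra.
have h : ln ((1 + x) / (1 + y)) <= (1 + x) / (1 + y) - 1.
  have := @le_ln1Dx R ((1 + x) / (1 + y) - 1); rewrite addrCA subrr addr0.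
  by apply; have := divr_gt0 x1 y1; lra.
rewrite ln_div ?posrE// in h.
have := ler_wpM2l (ltW y1) h.
have -> : (1 + y) * ((1 + x) / (1 + y) - 1) = x - y by field; rewrite gt_eqF.
by move: (ln (1 + x)) (ln (1 + y)) => a b; lra.
Qed.

Lemma phi_ge0 x : 0 <= x -> 0 <= phi x.
Proof. by move=> x0; rewrite mulr_ge0 ?ln_ge0//; lra. Qed.

Lemma phi_ge x : 0 <= x -> x <= phi x.
Proof.
move=> x0; have := @phi_tangent 0 x (lexx _) x0.
by rewrite /phi addr0 ln1 mulr0 add0r subr0 addr0 mul1r.
Qed.

(** Jensen's inequality: the tangent of [phi] at the point PI u r t is integrated against the
    nonnegative kernel of mean 1, which reproduces constants. *)
Lemma jensen_phi u r t : L1 u -> L1 (phi \o u) -> (forall s, TT s -> 0 <= u s) ->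
  0 <= r < 1 -> phi (PI u r t) <= PI (phi \o u) r t.
Proof.
move=> iu ip u0 r01; have r1 := norm_lt1 r01.
set x := PI u r t.
have mT := @measurable_TT R; have mI := measurable_idTT.
have x0 : 0 <= x by exact: kint_kre_ge0.
pose c := phi x - (1 + ln (1 + x)) * x.
have ic := integrable_cst_TT c.
have iZ : L1 (fun s => (1 + ln (1 + x)) * u s).
  by have := integrableZl mT (1 + ln (1 + x)) iu; apply: eq_integrable.
have iD : L1 (fun s => c + (1 + ln (1 + x)) * u s).
  by have := integrableD mT ic iZ; apply: eq_integrable.
have := le_kint_kre mT mI t r1 iD ip.
rewrite (kint_kreD mT mI t r1 ic iZ) (kint_kreZ mT mI _ t r1 iu).
rewrite -/(PI u r t) -/x -/(PI (cst c) r t) PI_cst//.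
rewrite (_ : c + _ = phi x); last by rewrite /c; ring.
apply=> s Ts; have := phi_tangent x0 (u0 s Ts); rewrite /c /=; lra.
Qed.

(** G(y) = y atan y - ln (1 + y^2) / 2 has derivative atan y. Hence G >= 0 for y >= 0, and beyond y
    = 1 its slope exceeds atan 1 = pi / 4 >= 1 / 2. Both sides are even. *)
Lemma le_y_atan y : `|y| <= 1 + 2 * (y * atan y - ln (1 + y ^+ 2) / 2).
Proof.
wlog y0 : y / 0 <= y.
  move=> h; have [/h//|/ltW y0] := lerP 0 y.
  have := h (- y); rewrite oppr_ge0 atanN normrN mulrNN sqrrN => h'.
  exact: h'.
pose G y : R := y * atan y - ln (1 + y ^+ 2) / 2.
have dG y' : is_derive (y' : R) 1 G (atan y').
  have p : 0 < 1 + y' ^+ 2 by rewrite ltr_pwDl// sqr_ge0.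
  have d1 := isdM (isd_id y') (is_derive1_atan y').
  have dl := isdcomp (f := fun y => 1 + y ^+ 2) (is_derive1_ln p)
    (isdD (isd_cst 1 y') (isd_sqr y')).
  apply: isd_eq (isdB d1 (isdM dl (isd_cst 2^-1 y'))) _.
  by field; rewrite gt_eqF.
have cG : continuous G by move=> z; exact: isd_cont (dG z).
have G0 : G 0 = 0 by rewrite /G mul0r expr0n/= addr0 ln1 mul0r subr0.
have mvt (a b : R) : a < b -> exists2 c, a < c < b & G b - G a = atan c * (b - a).
  move=> ab; have [|c] := @MVT _ G atan a b ab (fun z _ => dG z).
  - exact: continuous_subspaceT.
  - by rewrite in_itv/= => abc ->; exists c.
have atan_ge0 c : 0 <= c -> 0 <= atan c :> R.
  rewrite le_eqVlt => /orP[/eqP <-|c0]; first by rewrite atan0.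
  by rewrite -atan0 ltW// lt_atan.
have Gge0 z : 0 <= z -> 0 <= G z.
  rewrite le_eqVlt => /orP[/eqP <-|z0]; first by rewrite G0.
  have [c /andP[c0 cz] e] := mvt 0 z z0; rewrite G0 !subr0 in e.
  by rewrite e mulr_ge0 ?atan_ge0// ltW.
rewrite ger0_norm// -/(G y).
have [y1|y1] := lerP y 1; first by have := Gge0 y y0; lra.
have [c /andP[c1 cy] e] := mvt 1 y y1.
have a1 : 2^-1 <= atan c :> R.
  have : atan 1 < atan c :> R by exact: lt_atan.
  rewrite atan1; have := pi_ge2 R; lra.
have := Gge0 1 ler01; have : (y - 1) * 2^-1 <= (y - 1) * atan c.
  by rewrite ler_wpM2l// subr_ge0 ltW.
rewrite [_ * atan c]mulrC -e; lra.
Qed.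

(* real part of (1 + V) log (1 + V) for 1 + V = X + iY, X > 0 *)
Definition reVlogV (X Y : R) : R := X * (ln (X ^+ 2 + Y ^+ 2) / 2) - Y * atan (Y / X).

(** With q = Y / X, the difference X ln X - [reVlogV X Y] is X (q atan q - ln (1 + q^2) / 2); the
    claim is [le_y_atan] at q, multiplied by X. *)
Lemma reVlogV_le (X Y : R) : 0 < X -> `|Y| <= X + 2 * (X * ln X - reVlogV X Y).
Proof.
move=> X0; have := le_y_atan (Y / X).
have -> : `|Y / X| = `|Y| / X by rewrite normrM normfV (gtr0_norm X0).
have -> : ln (1 + (Y / X) ^+ 2) = ln (X ^+ 2 + Y ^+ 2) - 2 * ln X.
  rewrite (_ : 1 + _ = (X ^+ 2 + Y ^+ 2) / X ^+ 2); last by field; rewrite gt_eqF.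
  rewrite ln_div ?posrE ?exprn_gt0// ?lnXn// ?mulr_natl//.
  by rewrite ltr_pwDl ?exprn_gt0// sqr_ge0.
rewrite ler_pdivrMr// => h; apply: le_trans h _.
rewrite /reVlogV.
by rewrite le_eqVlt; apply/orP; left; apply/eqP; field; rewrite gt_eqF.
Qed.

(** The modulus of X + i Y is at least X, and |atan| is at most pi / 2. *)
Lemma reVlogV_ge (X Y : R) : 0 < X -> X * ln X <= reVlogV X Y + pi / 2 * `|Y|.
Proof.
move=> X0; rewrite /reVlogV.
have l : ln X <= ln (X ^+ 2 + Y ^+ 2) / 2.
  rewrite ler_pdivlMr// mulr_natr -lnXn// ler_ln ?posrE ?exprn_gt0//.
    by rewrite lerDl sqr_ge0.
  by rewrite ltr_pwDl ?exprn_gt0// sqr_ge0.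
have := ler_wpM2l (ltW X0) l.
have : Y * atan (Y / X) <= `|Y| * (pi / 2).
  apply: le_trans (ler_norm _) _; rewrite normrM ler_wpM2l//.
  by rewrite ler_norml !ltW// ?atan_gtNpi2 ?atan_ltpi2.
lra.
Qed.

Lemma reVlogV0 (X : R) : 0 < X -> reVlogV X 0 = X * ln X.
Proof.
move=> X0; rewrite /reVlogV mul0r subr0 expr0n/= addr0.
by rewrite lnXn// -[_ *+ 2]mulr_natr mulfK// pnatr_eq0.
Qed.

Lemma integrable_phi_PI u r : L1 u -> (forall s, TT s -> 0 <= u s) -> 0 <= r < 1 ->
  L1 (fun t => phi (PI u r t)).
Proof.
move=> iu u0 r01; have r1 := norm_lt1 r01.
have [C h] := cp_bnd (cp_PI iu) r1.
have P0 t : 0 <= PI u r t by exact: kint_kre_ge0.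
apply: (@integrable_bdd _ _ (phi `|C|)).
  apply: continuous_measurable_TT => t.
  have cP := cp_cA (cp_PI iu) r1 (x := t).
  have c1 : {for t, continuous (fun t => 1 + PI u r t)}.
    by apply: cvgD; [exact: cvg_cst|exact: cP].
  have cl : {for 1 + PI u r t, continuous (@ln R)}.
    by apply: continuous_ln; have := P0 t; lra.
  have c2 := continuous_comp c1 cl.
  exact: (cvgM c1 c2).
move=> t _; rewrite ger0_norm ?phi_ge0//.
have PC : PI u r t <= `|C|.
  have [h1 _ _ _] := h r t (lexx _).
  by apply: le_trans (ler_norm _) (le_trans h1 (ler_norm _)).
have p0 := P0 t; rewrite /phi ler_pM//; [lra|by rewrite ln_ge0//; lra|lra|].
by rewrite ler_ln ?posrE; lra.
Qed.

(** (1 + V) log (1 + V) is a conjugate pair by [cp_M] and [cp_ln]. At the origin Q u vanishes and P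
    u is the mean of u, which gives the right-hand side. *)
Lemma integral_reVlogV u r : L1 u -> (forall s, TT s -> 0 <= u s) -> 0 <= r < 1 ->
  L1 (fun t => reVlogV (1 + PI u r t) (QI u r t)) /\
  Rintegral mu TT (fun t => reVlogV (1 + PI u r t) (QI u r t)) =
    2 * pi * phi ((2 * pi)^-1 * Rintegral mu TT u).
Proof.
move=> iu u0 r01; have r1 := norm_lt1 r01.
have cp := cp_D (cp_cst 1) (cp_PI iu).
have X1 r' t : `|r'| < 1 -> 1 <= 1 + PI u r' t.
  by move=> r'1; rewrite lerDl; exact: kint_kre_ge0.
have cpl := cp_M cp (cp_ln X1 cp).
have e t r' : 0 + QI u r' t = QI u r' t by rewrite add0r.
split.
  have := cp_intA cpl r1; apply: eq_integrable; first exact: measurable_TT.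
  by move=> t _ /=; rewrite !add0r.
transitivity (Rintegral mu TT (fun t => reVlogV (1 + PI u 0 t) (QI u 0 t))).
  apply: etrans; last apply: etrans (conj_pair_mean cpl r01) _.
    by apply: eq_Rintegral => t _ /=; rewrite !add0r.
  by apply: eq_Rintegral => t _ /=; rewrite !add0r.
rewrite mulrC.
rewrite -Rintegral_cst_TT; apply: eq_Rintegral => t _.
rewrite /PI /QI kint_kim0 ?kint_kre0; last exact: measurable_TT.
rewrite reVlogV0// ltr_pwDl// mulr_ge0 ?invr_ge0 ?(ltW pi2_gt0)//.
exact: Rintegral_ge0.
Qed.

(** [reVlogV_le] is integrated over the circle. Total mass gives the first two terms, Jensen bounds
    the mean of [phi] of P u, and the integral of [reVlogV], which is nonnegative by its value at
    the origin, is dropped. *)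
Lemma integral_QI_le u r : L1 u -> L1 (phi \o u) -> (forall s, TT s -> 0 <= u s) ->
  0 <= r < 1 ->
  Rintegral mu TT (fun t => `|QI u r t|) <=
    2 * pi + Rintegral mu TT u + 2 * Rintegral mu TT (phi \o u).
Proof.
move=> iu ip u0 r01; have r1 := norm_lt1 r01.
have mT := @measurable_TT R; have mI := measurable_idTT.
have [iv ev] := integral_reVlogV iu u0 r01.
have iphi := integrable_phi_PI iu u0 r01.
have P0 t : 0 <= PI u r t by exact: kint_kre_ge0.
have iP := cp_intA (cp_PI iu) r1.
have iX : L1 (fun t => 1 + PI u r t).
  by have := integrableD mT (integrable_cst_TT 1) iP; apply: eq_integrable.
have iB : L1 (fun t => phi (PI u r t) - reVlogV (1 + PI u r t) (QI u r t)).
  by have := integrableB mT iphi iv; apply: eq_integrable.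
have iB2 : L1 (fun t => 2 * (phi (PI u r t) - reVlogV (1 + PI u r t) (QI u r t))).
  by have := integrableZl mT 2 iB; apply: eq_integrable.
have iS : L1 (fun t => 1 + PI u r t
   + 2 * (phi (PI u r t) - reVlogV (1 + PI u r t) (QI u r t))).
  by have := integrableD mT iX iB2; apply: eq_integrable.
apply: (@le_trans _ _ (Rintegral mu TT (fun t => 1 + PI u r t
   + 2 * (phi (PI u r t) - reVlogV (1 + PI u r t) (QI u r t))))).
  apply: le_Rintegral => //.
    exact: (integrable_norm (cp_intB (cp_PI iu) r1)).
  by move=> t _; apply: reVlogV_le; rewrite ltr_pwDl.
rewrite (RintegralD mT iX iB2) (RintegralZl _ mT iB) (RintegralB mT iphi iv).
rewrite (RintegralD mT (integrable_cst_TT 1) iP) ev Rintegral_cst_TT mul1r.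
rewrite (Rintegral_kint_kre mT mI iu r01).
have j : Rintegral mu TT (fun t => phi (PI u r t)) <= Rintegral mu TT (phi \o u).
  rewrite -(Rintegral_kint_kre mT mI ip r01).
  apply: le_Rintegral => //; first exact: cp_intA (cp_PI ip) r1.
  by move=> t _; exact: jensen_phi.
have m0 : 0 <= (2 * pi)^-1 * Rintegral mu TT u.
  by rewrite mulr_ge0 ?invr_ge0 ?(ltW pi2_gt0)//; exact: Rintegral_ge0.
have e0 := mulr_ge0 (ltW pi2_gt0) (phi_ge0 m0).
by rewrite lerD2l ler_pM2l// (le_trans _ j)// gerBl.
Qed.

(** The integrated form of [reVlogV_ge]: the converse estimate, with the value at the origin
    kept. *)
Lemma integral_phi_PI_le u r : L1 u -> (forall s, TT s -> 0 <= u s) -> 0 <= r < 1 ->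
  Rintegral mu TT (fun t => phi (PI u r t)) <=
  2 * pi * phi ((2 * pi)^-1 * Rintegral mu TT u)
  + pi / 2 * Rintegral mu TT (fun t => `|QI u r t|).
Proof.
move=> iu u0 r01; have r1 := norm_lt1 r01.
have mT := @measurable_TT R.
have [iv <-] := integral_reVlogV iu u0 r01.
have P0 t : 0 <= PI u r t by exact: kint_kre_ge0.
have iq := integrable_norm (cp_intB (cp_PI iu) r1).
have iq2 : L1 (fun t => pi / 2 * `|QI u r t|).
  by have := integrableZl mT (pi / 2) iq; apply: eq_integrable.
rewrite -(RintegralZl _ mT iq) -(RintegralD mT iv iq2).
apply: le_Rintegral => //.
- exact: integrable_phi_PI.
- by have := integrableD mT iv iq2; apply: eq_integrable.
- by move=> t _; apply: reVlogV_ge; rewrite ltr_pwDl.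
Qed.

End poisson.

(** * Decay of the Poisson kernel and its dyadic majorant *)

Section poisson_kernel_decay.
Context {R : realType}.
Implicit Types (r t x y : R).

Lemma sin_ge_lin y : 0 <= y <= 1 -> y * cos 1 <= sin y.
Proof.
move=> /andP[]; rewrite le_eqVlt => /orP[/eqP <- _|y0 y1].
  by rewrite mul0r sin0.
have [|c] := @MVT _ sin cos 0 y y0 (fun z _ => is_derive_sin z).
  by apply: continuous_subspaceT => z; exact: continuous_sin.
rewrite in_itv/= => /andP[c0 cy]; rewrite sin0 !subr0 mulrC => ->.
have p2 := pi_ge2 R.
rewrite ler_wpM2l ?(ltW y0)//; apply: ltW; rewrite ltr_cos ?in_itv/=; last 2 first.
- by apply/andP; split; lra.
- by apply/andP; split; lra.
lra.
Qed.

(** 1 - cos vanishes to second order at 0 and next at 2 pi and - 2 pi, so |x| has to stay below some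
    y0 < 2 pi. For |x| <= 1 the half-angle formula applies; beyond, cos x is at most the larger of
    cos 1 and cos (2 pi - y0), and x^2 is at most (2 pi)^2. *)
Lemma one_sub_cos_ge y0 : pi <= y0 < 2 * pi ->
  exists2 c : R, 0 < c & forall x, `|x| <= y0 -> c * x ^+ 2 <= 1 - cos x.
Proof.
move=> /andP[py y2]; have p2 := pi_ge2 R.
have c1 : cos 1 < 1 :> R.
  rewrite -[X in _ < X]cos0 ltr_cos ?in_itv/= ?lexx ?ltr01//; apply/andP; split; lra.
have cy : cos (2 * pi - y0) < 1.
  by rewrite -[X in _ < X]cos0 ltr_cos ?in_itv/= ?lexx//; [lra|apply/andP; split; lra|lra].
have c10 := @cos1_gt0 R.
pose c0 := 1 - Num.max (cos 1) (cos (2 * pi - y0)).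
have c00 : 0 < c0 by rewrite /c0 subr_gt0 gt_max c1 cy.
pose c := Num.min (cos 1 ^+ 2 / 2) (c0 / (2 * pi) ^+ 2).
have pp : 0 < (2 * pi) ^+ 2 :> R by rewrite exprn_gt0// pi2_gt0.
exists c; first by rewrite lt_min !divr_gt0// exprn_gt0.
move=> x; wlog x0 : x / 0 <= x.
  move=> h; have [/h//|/ltW x0 xy] := lerP 0 x.
  by have := h (- x); rewrite oppr_ge0 normrN sqrrN cosN; exact.
rewrite ger0_norm// => xy.
have [x1|x1] := lerP x 1.
  apply: (@le_trans _ _ (cos 1 ^+ 2 / 2 * x ^+ 2)).
    by rewrite ler_wpM2r ?sqr_ge0// ge_min lexx.
  have -> : 1 - cos x = 2 * sin (x / 2) ^+ 2.
    have h2 (y : R) : 1 - cos (y *+ 2) = 2 * sin y ^+ 2.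
      by rewrite cos_mulr2n sin2cos2 mulr2n; ring.
    by rewrite -h2 -[_ *+ 2]mulr_natr divfK// pnatr_eq0.
  have h := @sin_ge_lin (x / 2).
  have : x / 2 * cos 1 <= sin (x / 2) by apply: h; apply/andP; split; lra.
  have : 0 <= x / 2 * cos 1 by rewrite mulr_ge0 ?(ltW c10)//; lra.
  move: (sin _) => s s0 s1.
  have : (x / 2 * cos 1) ^+ 2 <= s ^+ 2 by rewrite ler_pXn2r ?nnegrE// (le_trans s0).
  by move: (cos 1) => k; rewrite !exprMn; lra.
apply: (@le_trans _ _ c0).
  apply: (@le_trans _ _ (c0 / (2 * pi) ^+ 2 * x ^+ 2)).
    by rewrite ler_wpM2r ?sqr_ge0// ge_min lexx orbT.
  rewrite mulrAC ler_pdivrMr// ler_wpM2l ?(ltW c00)//.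
  by rewrite ler_pXn2r ?nnegrE ?(ltW pi2_gt0)//; lra.
rewrite /c0 lerD2l lerN2 le_max.
have [xp|xp] := lerP x pi.
  apply/orP; left; rewrite ltW// ltr_cos ?in_itv/=//; apply/andP; split; lra.
apply/orP; right.
have -> : cos x = cos (2 * pi - x).
  by rewrite -[RHS]cosN opprB -[RHS]cosD2pi -[pi *+ 2]mulr_natl subrK.
have [-> //|xy'] := eqVneq x y0.
have xy2 : x < y0 by rewrite lt_neqAle xy'.
rewrite ltW// ltr_cos ?in_itv/=; [lra|apply/andP; split; lra|apply/andP; split; lra].
Qed.

(** The denominator is (1 - r)^2 + 2 r (1 - cos x), with 2 r >= 1. As the circle is cut open at 0,
    differences of angles range up to 2 pi, whence the restriction by y0. *)
Lemma kre_decay y0 : pi <= y0 < 2 * pi ->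
  exists2 C : R, 0 < C & forall r x, 2^-1 <= r < 1 -> `|x| <= y0 ->
    kre r x <= C * ((1 - r) / ((1 - r) ^+ 2 + x ^+ 2)).
Proof.
move=> /one_sub_cos_ge[c c0 hc].
pose c' := Num.min c 1.
have c'0 : 0 < c' by rewrite lt_min c0 ltr01.
have c'1 : c' <= 1 by rewrite ge_min lexx orbT.
exists (2 / c') => [|r x /andP[r2 r1] xy]; first by rewrite divr_gt0.
have := hc x xy; have x2 := sqr_ge0 x; move=> h.
have d0 : 0 < (1 - r) ^+ 2 by rewrite exprn_gt0//; lra.
have r1' : `|r| < 1 by rewrite ger0_norm//; lra.
have k0 := kden_gt0 x r1'.
rewrite /kre ler_pdivrMr// mulrAC -mulrA [_ / c']mulrC -!mulrA.
have den : c' * ((1 - r) ^+ 2 + x ^+ 2) <= kden r x.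
  have e : kden r x = (1 - r) ^+ 2 + 2 * r * (1 - cos x) by rewrite /kden; ring.
  have cx : c' * x ^+ 2 <= 1 - cos x.
    by apply: le_trans h; rewrite ler_wpM2r// ge_min lexx.
  have cx0 : 0 <= 1 - cos x by rewrite subr_ge0 cos_le1.
  rewrite e mulrDr lerD//; first by rewrite ler_piMl// ltW.
  by apply: le_trans cx _; rewrite ler_peMl//; lra.
have s0 : 0 < (1 - r) ^+ 2 + x ^+ 2 by lra.
have : 1 <= c'^-1 * (((1 - r) ^+ 2 + x ^+ 2)^-1 * kden r x).
  by rewrite mulrA -invfM mulrC ler_pdivlMr ?mul1r ?mulr_gt0.
set q := c'^-1 * _ => q1.
rewrite (_ : c'^-1 * _ = 2 * (1 - r) * q); last by rewrite /q; ring.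
have h1 : 1 + r <= 2 * q by lra.
have : (1 - r) * (1 + r) <= (1 - r) * (2 * q) by rewrite ler_wpM2l//; lra.
lra.
Qed.

(** For |x| of order 2^k d the left side is of order 1 / (4^k d). Only intervals centred at 0 appear
    on the right, the sets over which a Lebesgue point controls averages; the last term covers what
    lies beyond the scale 2^N d. *)
Lemma dyadic_decay (d x : R) (N : nat) : 0 < d ->
  d / (d ^+ 2 + x ^+ 2) <=
    \sum_(k < N.+1) (4 / (4 ^+ k * d) * \1_[set y : R | `|y| < 2 ^+ k * d] x)
    + (4 ^+ N * d)^-1.
Proof.
move=> d0; have x2 := sqr_ge0 x.
have p4 (k : nat) : 0 < 4 ^+ k :> R by rewrite exprn_gt0.
have p2 (k : nat) : 0 < 2 ^+ k :> R by rewrite exprn_gt0.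
have e42 (k : nat) : 4 ^+ k = (2 ^+ k) ^+ 2 :> R.
  by rewrite -exprM mulnC exprM; congr (_ ^+ _); ring.
have sum0 N' : 0 <= \sum_(k < N'.+1)
    (4 / (4 ^+ k * d) * \1_[set y : R | `|y| < 2 ^+ k * d] x).
  apply: sumr_ge0 => k _; rewrite mulr_ge0 ?divr_ge0//.
  by rewrite mulr_ge0 ?(ltW d0)// ltW.
have far (N' : nat) : 2 ^+ N' * d <= `|x| -> d / (d ^+ 2 + x ^+ 2) <= (4 ^+ N' * d)^-1.
  move=> h; have h2 : (2 ^+ N' * d) ^+ 2 <= x ^+ 2.
    by rewrite -[x ^+ 2]real_normK ?num_real// ler_pXn2r ?nnegrE// mulr_ge0 ?(ltW d0)// ltW.
  rewrite ler_pdivrMr; last by have := exprn_gt0 2 d0; lra.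
  rewrite mulrC ler_pdivlMr ?mulr_gt0//.
  have -> : d * (4 ^+ N' * d) = (2 ^+ N' * d) ^+ 2 by rewrite e42; ring.
  by have := sqr_ge0 d; lra.
elim: N => [|N IH].
  rewrite big_ord1 !expr0 !mul1r indicE.
  have [xd|xd] := ltrP `|x| d.
    rewrite mem_set//= mulr1 ler_pdivrMr; last by have := exprn_gt0 2 d0; lra.
    have : (4 / d + d^-1) * d ^+ 2 = 5 * d by field; rewrite gt_eqF.
    have : 0 <= (4 / d + d^-1) * x ^+ 2.
      by rewrite mulr_ge0// addr_ge0 ?divr_ge0 ?invr_ge0 ?(ltW d0).
    by move=> h1 h2; rewrite mulrDr h2; lra.
  rewrite memNset/=; last by apply/negP; rewrite -leNgt.
  rewrite mulr0 add0r; have := far 0; rewrite expr0 !mul1r; exact.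
have [xd|xd] := ltrP `|x| (2 ^+ N.+1 * d); last first.
  by apply: le_trans (far _ xd) _; rewrite lerDr.
rewrite big_ord_recr/=; apply: le_trans IH _.
rewrite -addrA lerD2l.
rewrite indicE mem_set//= mulr1.
(* The coefficient of the new interval is exactly the remainder of the previous stage. *)
have -> : 4 / (4 ^+ N.+1 * d) = (4 ^+ N * d)^-1.
  by rewrite exprS; field; rewrite !gt_eqF.
by rewrite lerDl invr_ge0 mulr_ge0 ?(ltW d0)// ltW.
Qed.

End poisson_kernel_decay.

(** * Fatou's theorem on radial limits of Poisson integrals *)

Section fatou.
Context {R : realType}.
Notation mu := (@lebesgue_measure R).
Notation L1 u := (mu.-integrable TT (EFin \o u)).
Implicit Types (f : R -> R) (r t x : R).

Definition radial_limit (G : R -> R -> R) (t l : R) := forall eps : R, 0 < eps ->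
  exists2 del : R, 0 < del & forall r : R, 0 <= r -> 1 - del < r < 1 -> `|G r t - l| < eps.

(** Rewrites the vanishing of mean deviations at a Lebesgue point as a bound on integrals over
    intervals, with the length 2 rho cleared from the denominator. *)
Lemma lebesgue_pt_ball f t : lebesgue_pt f t -> forall eps : R, 0 < eps ->
  exists2 eta : R, 0 < eta & forall rho : R, 0 < rho < eta ->
   (\int[mu]_(s in ball t rho) `|f s - f t|%:E <= (eps * (2 * rho))%:E)%E.
Proof.
move=> lf eps e0.
have /fine_cvgP[fin /cvgrPdist_lt/(_ _ e0) h] := lf.
have := h; have := fin.
move=> [e1 /= e10 h1] [e2 /= e20 h2].
exists (Num.min e1 e2) => [|rho /andP[r0 re]]; first by rewrite lt_min e10.
move: re; rewrite lt_min => /andP[re1 re2].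
have n1 (e : R) : rho < e -> `|0 - rho| < e by rewrite sub0r normrN gtr0_norm.
have {}h1 := h1 rho (n1 _ re1) r0; have {}h2 := h2 rho (n1 _ re2) r0.
move: h1 h2; rewrite /= /davg /iavg /= lebesgue_measure_ball ?(ltW r0)//.
have p2 : 0 < rho *+ 2 by rewrite pmulrn_lgt0.
rewrite inver gt_eqF//; set J := (\int[mu]_(y in _) _)%E => fJ hJ.
have J0 : (0 <= J)%E by exact: integral_ge0.
have fJ' : J \is a fin_num.
  move: fJ; move: J0; case: J {hJ} => [//||//] _.
  by rewrite mulry gtr0_sg ?invr_gt0// mul1e.
rewrite -[X in (X <= _)%E]/J -[J]fineK// lee_fin.
move: hJ; rewrite -[J]fineK//= sub0r normrN ger0_norm; last first.
  by rewrite mulr_ge0 ?invr_ge0 ?(ltW p2)// fine_ge0.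
rewrite mulrC ltr_pdivrMr// => /ltW; by rewrite -[_ *+ 2]mulr_natl.
Qed.

(** The difference P f - f(t) is at most the kernel average of |f - f(t)|. The dyadic majorant turns
    it into a geometric sum of averages over intervals shorter than eta, which are small at a
    Lebesgue point, and a remainder controlled by the total integral of |f - f(t)|. *)
Lemma fatou_lebesgue_pt f t : L1 f -> 0 < t < 2 * pi ->
  lebesgue_pt (f \_ (TT : set R)) t -> radial_limit (PI f) t (f t).
Proof.
move=> iF /andP[t0 t2] lpt eps eps0.
have mT := @measurable_TT R; have p0 := pi_gt0 R.
have Tt : TT t by rewrite /TT/= in_itv/= ltW.
set f' := f \_ (TT : set R).
have f't : f' t = f t by rewrite /f' patchE mem_set.
(* Bounds |t - s| for all s in the period; it is below 2 pi because t is interior. *)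
pose y0 := Num.max pi (Num.max t (2 * pi - t)).
have y0b : pi <= y0 < 2 * pi.
  by rewrite /y0 le_max lexx/= !gt_max; apply/and3P; split; lra.
have [C C0 hC] := kre_decay y0b.
have mf := measurable_L1 iF.
have mf' : measurable_fun setT f' by apply/(measurable_restrictT _ mT).
pose g s := `|f' s - f t|.
have mg : measurable_fun setT g.
  by apply: measurableT_comp => //; apply: measurable_funB => //; exact: measurable_cst.
have ig : L1 g.
  have := integrableB mT iF (integrable_cst_TT (f t)).
  move=> h; have h2 : L1 (fun s => f s - f t) by move: h; apply: eq_integrable.
  have := integrable_norm h2; apply: eq_integrable => // s Ts.
  by rewrite /g /f' /= patchE Ts.
pose G := Rintegral mu TT g.
have G0 : 0 <= G by apply: Rintegral_ge0 => s _.
(* The final bound is 17 C e1, which is below eps. *)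
pose e1 := eps / (32 * C + 1).
have e10 : 0 < e1 by rewrite divr_gt0//; lra.
have [eta eta0 heta] := lebesgue_pt_ball lpt e10.
(* The three bounds serve, in turn, the kernel decay, the existence of a dyadic scale below eta, and
   the remainder term. *)
pose del := Num.min (Num.min 2^-1 eta) (e1 * eta ^+ 2 / (4 * G + 1)).
have g1 : 0 < 4 * G + 1 by rewrite ltr_wpDl// mulr_ge0.
have del0 : 0 < del.
  by rewrite !lt_min invr_gt0 ltr0n eta0/= divr_gt0// mulr_gt0// exprn_gt0.
exists del => // r r0 /andP[rdel r1].
have : 1 - r < del by lra.
rewrite !lt_min -andbA => /and3P[d2 deta dG].
have rn1 : `|r| < 1 by rewrite ger0_norm.
set d := 1 - r in d2 deta dG; have d0 : 0 < d by rewrite subr_gt0.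
have r01 : 0 <= r < 1 by rewrite r0.
(* The last dyadic scale below eta: the upper bound puts all intervals of the sum within reach of
   the Lebesgue point estimate, the lower bound makes the remainder at most 4 d / eta^2 times G. *)
have [N /andP[N1 N2]] : exists N : nat, eta / 2 <= 2 ^+ N * d < eta.
  have ex : exists n : nat, eta / 2 <= 2 ^+ n * d.
    have [n hn] : exists n : nat, eta / 2 / d <= n%:R.
      by exists (Num.bound (eta / 2 / d)); apply: ltW; apply: archi_boundP; rewrite !divr_ge0 ?ltW.
    exists n; rewrite -ler_pdivrMr//; apply: le_trans hn _.
    by rewrite -natrX ler_nat ltnW// ltn_expl.
  have := ex_minnP ex.
  case=> n hn hmin.
  exists n; rewrite hn/=; case: n hn hmin => [|n] hn hmin.
    by rewrite expr0 mul1r.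
  rewrite ltNge; apply/negP => h.
  have hn' : eta / 2 <= 2 ^+ n * d.
    by move: h; rewrite exprS; move: (2 ^+ n) => z; lra.
  by have := hmin n hn'; rewrite ltnn.
pose K (s : R) := d / (d ^+ 2 + (t - s) ^+ 2).
have KK0 s : 0 <= K s by rewrite /K divr_ge0 ?(ltW d0)// addr_ge0 ?sqr_ge0.
have g0 s : 0 <= g s by exact: normr_ge0.
have K0 s : 0 <= K s * g s by exact: mulr_ge0.
have mK : measurable_fun (TT : set (measurableTypeR R)) (fun s => (K s * g s)%:E).
  apply/measurable_EFinP/measurable_funTS/measurable_funM => //.
  apply: continuous_measurable_fun => s.
  have h1 : {for s, continuous (fun s => d ^+ 2 + (t - s) ^+ 2)}.
    have h3 := isdB (isd_cst t s) (isd_id s).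
    have h4 := isdcomp (f := fun y => t - y) (isd_sqr (t - s)) h3.
    exact: (isd_cont (isdD (isd_cst (d ^+ 2) s) h4)).
  have dn : d ^+ 2 + (t - s) ^+ 2 != 0.
    by rewrite gt_eqF// ltr_pwDl ?exprn_gt0// sqr_ge0.
  exact: (cvgM (cvg_cst d) (cvgV dn h1)).
(* The k-th interval contributes at most c_k e1 times its length 2 (2^k d), that is 8 e1 / 2^k, with
   sum below 16 e1; the remainder adds at most e1. *)
have bnd : (\int[mu]_(s in TT) (K s * g s)%:E <= (16 * e1 + e1)%:E)%E.
  pose c (k : nat) : R := 4 / (4 ^+ k * d).
  have c0 k : 0 <= c k by rewrite divr_ge0 ?mulr_ge0 ?exprn_ge0 ?(ltW d0).
  pose B (k : nat) := [set s : R | `|t - s| < 2 ^+ k * d].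
  have BE k : B k = ball t (2 ^+ k * d) by apply/seteqP; split => s.
  have mB k : measurable (B k : set (measurableTypeR R)) by rewrite BE; exact: measurable_ball.
  have mBg k : measurable_fun setT (fun s => \1_(B k) s * g s).
    by apply: measurable_funM => //; apply: measurable_indic; exact: mB.
  have mcBg k : measurable_fun setT (fun s => (c k * (\1_(B k) s * g s))%:E).
    apply/measurable_EFinP; apply: measurable_funM; last exact: mBg.
    exact: measurable_cst.
  have mcg : measurable_fun setT (fun s => ((4 ^+ N * d)^-1 * g s)%:E).
    by apply/measurable_EFinP; apply: measurable_funM => //; exact: measurable_cst.
  apply: (@le_trans _ _ (\int[mu]_(s in TT)
    (\sum_(k < N.+1) (c k * (\1_(B k) s * g s))%:E + ((4 ^+ N * d)^-1 * g s)%:E))%E).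
    apply: ge0_le_integral => //.
    - by move=> s _; rewrite lee_fin.
    - apply/measurable_funTS/emeasurable_funD; last exact: mcg.
      by apply: emeasurable_sum => k; exact: mcBg.
    - move=> s _; rewrite sumEFin -EFinD lee_fin.
      apply: le_trans (ler_wpM2r (g0 s) (dyadic_decay (t - s) N d0)) _.
      rewrite mulrDl mulr_suml; rewrite le_eqVlt; apply/orP; left; apply/eqP; congr (_ + _).
      by apply: eq_bigr => k _; rewrite mulrA.
  rewrite ge0_integralD//; last 4 first.
  - move=> s _; apply: sume_ge0 => k _; rewrite lee_fin.
    by apply: mulr_ge0; [exact: c0|exact: mulr_ge0].
  - by apply: measurable_funTS; apply: emeasurable_sum => k; exact: mcBg.
  - by move=> s _; rewrite lee_fin mulr_ge0 ?g0// invr_ge0 mulr_ge0 ?exprn_ge0 ?(ltW d0).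
  - by apply: measurable_funTS; exact: mcg.
  rewrite EFinD; apply: leeD.
    rewrite ge0_integral_sum//; last 2 first.
    - by move=> k; apply: measurable_funTS; exact: mcBg.
    - by move=> k s _; rewrite lee_fin; apply: mulr_ge0; [exact: c0|exact: mulr_ge0].
    apply: (@le_trans _ _ (\sum_(k < N.+1) (8 * e1 / 2 ^+ k)%:E)%E).
      apply: lee_sum => k _.
      have kN : (k <= N)%N by rewrite -ltnS.
      have pk : 0 < 2 ^+ k * d by rewrite mulr_gt0 ?exprn_gt0.
      have ke : 0 < 2 ^+ k * d < eta.
        rewrite pk/=; apply: le_lt_trans N2.
        by rewrite ler_wpM2r ?(ltW d0)// ler_weXn2l// ler1n.
      have := heta _ ke; rewrite -/f' f't -BE => hk.
      under eq_integral do rewrite EFinM.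
      rewrite ge0_integralZl//; last 3 first.
      - by apply/measurable_EFinP; apply: measurable_funTS; exact: mBg.
      - by move=> s _; rewrite lee_fin; exact: mulr_ge0.
      - by rewrite lee_fin.
      apply: (@le_trans _ _ ((c k)%:E * (e1 * (2 * (2 ^+ k * d)))%:E)%E).
        rewrite lee_wpmul2l ?lee_fin//; apply: le_trans hk.
        rewrite [leRHS]integral_mkcond [leLHS]integral_mkcond.
        apply: ge0_le_integral => //.
        + move=> s _; rewrite patchE; case: ifP => // _.
          by rewrite lee_fin; exact: mulr_ge0.
        + apply/(measurable_restrictT _ mT)/measurable_EFinP.
          by apply: measurable_funTS; exact: mBg.
        + have mBk := mB k; apply/(measurable_restrictT _ mBk)/measurable_EFinP.
          by apply: measurable_funTS; exact: mg.
        + move=> s _; rewrite !patchE indicE.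
          have [sT|sT] := boolP (s \in TT); have [sB|sB] := boolP (s \in B k) => //.
          * by rewrite mul1r.
          * by rewrite mul0r.
          * by rewrite lee_fin; exact: g0.
      rewrite -EFinM lee_fin /c le_eqVlt; apply/orP; left; apply/eqP.
      have e4 : 4 ^+ k = 2 ^+ k * 2 ^+ k :> R by rewrite -exprMn -natrM.
      rewrite e4; have : 2 ^+ k != 0 :> R by rewrite expf_neq0// pnatr_eq0.
      move: (2 ^+ k) => z z0; field.
      by rewrite z0 gt_eqF.
    rewrite sumEFin lee_fin.
    have : forall n : nat, \sum_(k < n) (8 * e1 / 2 ^+ k) = 16 * e1 - 16 * e1 / 2 ^+ n :> R.
      elim=> [|n IH]; first by rewrite big_ord0 expr0 divr1 subrr.
      rewrite big_ord_recr/= IH exprS.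
      have : 2 ^+ n != 0 :> R by rewrite expf_neq0// pnatr_eq0.
      by move: (2 ^+ n) => z z0; field.
    by move=> ->; rewrite gerBl// divr_ge0 ?exprn_ge0//; lra.
  under eq_integral do rewrite EFinM.
  have mg' : measurable_fun (TT : set (measurableTypeR R)) (fun s => (g s)%:E).
    by apply/measurable_EFinP; apply: measurable_funTS; exact: mg.
  rewrite (ge0_integralZl mu mT mg'); last 2 first.
  - by move=> s _; rewrite lee_fin; exact: g0.
  - by rewrite lee_fin invr_ge0 mulr_ge0 ?exprn_ge0 ?(ltW d0).
  have fG : (\int[mu]_(s in TT) (g s)%:E)%E = G%:E.
    by rewrite /G /Rintegral fineK//; exact: (integrable_fin_num mT ig).
  rewrite fG -EFinM lee_fin.
  have q : (eta / 2) ^+ 2 <= 4 ^+ N * d * d.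
    have -> : 4 ^+ N * d * d = (2 ^+ N * d) ^+ 2.
      rewrite exprMn -exprM mulnC exprM [2 ^+ 2](_ : _ = 4 :> R); ring.
    by rewrite ler_pXn2r ?nnegrE// ?divr_ge0 ?mulr_ge0 ?exprn_ge0 ?(ltW d0) ?(ltW eta0).
  move: dG; rewrite ltr_pdivlMr//.
  move=> dG; rewrite mulrC ler_pdivrMr ?mulr_gt0 ?exprn_gt0//.
  have := ler_wpM2l (ltW e10) q; rewrite exprMn.
  move: (4 ^+ N) => z hz.
  rewrite -(ler_pM2r d0).
  have : 0 < eta ^+ 2 by rewrite exprn_gt0.
  nra.
have iK : L1 (fun s => kre r (t - s) * g s).
  exact (integrable_kre mT measurable_idTT t rn1 ig).
have mem_le s : TT s -> `|t - s| <= y0.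
  rewrite /TT/= in_itv/= => /andP[s0 s2]; rewrite /y0 !le_max.
  have [st|st] := lerP s t.
    by apply/orP; right; apply/orP; left; lra.
  by apply/orP; right; apply/orP; right; lra.
have main : Rintegral mu TT (fun s => kre r (t - s) * g s) <= C * (16 * e1 + e1).
  rewrite -lee_fin.
  have -> : (Rintegral mu TT (fun s => kre r (t - s) * g s))%:E =
     (\int[mu]_(s in TT) (kre r (t - s) * g s)%:E)%E.
    by rewrite /Rintegral fineK//; exact: (integrable_fin_num mT iK).
  apply: (@le_trans _ _ (C%:E * \int[mu]_(s in TT) (K s * g s)%:E)%E); last first.
    by rewrite EFinM lee_wpmul2l// lee_fin ltW.
  rewrite -(ge0_integralZl mu mT mK); last 2 first.
  - by move=> s _; rewrite lee_fin; exact: K0.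
  - by rewrite lee_fin ltW.
  apply: ge0_le_integral => //.
  - by move=> s _; rewrite lee_fin mulr_ge0 ?g0// kre_ge0.
  - by have /integrableP[] := iK.
  - by apply: measurable_funeM.
  - move=> s Ts; rewrite -EFinM lee_fin mulrA ler_wpM2r//.
    by apply: hC; [rewrite r1 andbT; move: d2; rewrite /d; lra|exact: mem_le].
(* Poisson integrals reproduce constants, so f(t) can be moved under the integral. *)
have -> : PI f r t - f t = PI (fun s => f s - f t) r t.
  have := kint_kreD mT measurable_idTT t rn1 iF (integrable_cst_TT (- f t)).
  move=> h; transitivity (PI f r t + PI (fun=> - f t) r t); first by rewrite PI_cst.
  exact: esym h.
have -> : PI (fun s => f s - f t) r t = (2 * pi)^-1 *
    Rintegral mu TT (fun s => kre r (t - s) * (f s - f t)) by [].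
have iD : L1 (fun s => f s - f t).
  by have := integrableB mT iF (integrable_cst_TT (f t)); apply: eq_integrable.
have iKD : L1 (fun s => kre r (t - s) * (f s - f t)).
  exact (integrable_kre mT measurable_idTT t rn1 iD).
have le1 : `|Rintegral mu TT (fun s => kre r (t - s) * (f s - f t))| <= C * (16 * e1 + e1).
  apply: le_trans (le_normr_Rintegral mT iKD) _.
  apply: le_trans main; rewrite le_eqVlt; apply/orP; left; apply/eqP; apply: eq_Rintegral => s Ts.
  by rewrite normrM ger0_norm ?kre_ge0// /g /f' patchE Ts.
rewrite normrM ger0_norm ?invr_ge0 ?(ltW pi2_gt0)//.
apply: (@le_lt_trans _ _ (`|Rintegral mu TT (fun s => kre r (t - s) * (f s - f t))|)).
  rewrite ler_piMl// invf_le1 ?pi2_gt0//; have := pi_ge2 R; lra.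
apply: le_lt_trans le1 _.
have ee : e1 * (32 * C + 1) = eps by rewrite /e1 divfK// gt_eqF//; lra.
nra.
Qed.

Lemma fatou_ae f : L1 f ->
  {ae mu, forall t, TT t -> radial_limit (PI f) t (f t)}.
Proof.
move=> iF; have mT := @measurable_TT R.
have lf := integrable_locally_restrict mT iF.
have ae1 := lebesgue_differentiation lf.
(* The endpoint 0 of the cut circle is discarded: there the restricted function sees only one
   side. *)
have ae2 : {ae mu, forall t : R, t != 0}.
  exists [set 0]; split => //; first exact: lebesgue_measure_set1.
  by move=> t /= /negP; rewrite negbK => /eqP.
apply: (@filterS2 _ _ (ae_filter_ringOfSetsType mu) _ _ _ _ ae1 ae2) => t h1 h2 Tt.
apply: fatou_lebesgue_pt => //.
by move: Tt; rewrite /TT/= in_itv/= le_eqVlt eq_sym (negPf h2).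
Qed.

End fatou.

(** * Dominated convergence for real integrals *)

Section dominated.
Context {R : realType} d (S : measurableType d) (nu : {measure set S -> \bar R}).
Context (D : set S) (mD : measurable D).

Lemma Rintegral_dominated (f_ : nat -> S -> R) (f g : S -> R) :
  (forall n, measurable_fun D (f_ n)) -> measurable_fun D f ->
  {ae nu, forall x, D x -> f_ ^~ x @ \oo --> f x} ->
  nu.-integrable D (EFin \o g) ->
  {ae nu, forall x n, D x -> `|f_ n x| <= g x} ->
  nu.-integrable D (EFin \o f) /\
  Rintegral nu D (f_ n) @[n --> \oo] --> Rintegral nu D f.
Proof.
move=> mf_ mf ff ig fg.
have [||||| i _ c] := @dominated_convergence _ S R nu D mD (fun n x => (f_ n x)%:E)
  (EFin \o f) (EFin \o g).
- by move=> n; exact/measurable_EFinP.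
- exact/measurable_EFinP.
- apply: (@filterS _ _ (ae_filter_ringOfSetsType nu) _ _ _ ff) => x + Dx.
  move=> /(_ Dx) h; apply: cvg_EFin; first exact: nearW.
  exact: h.
- exact: ig.
- apply: (@filterS _ _ (ae_filter_ringOfSetsType nu) _ _ _ fg) => x + n Dx.
  by move=> /(_ n Dx) h; rewrite /= lee_fin.
split => //.
apply: fine_cvg; rewrite fineK; last exact: integrable_fin_num.
exact: c.
Qed.

End dominated.

(** * Convergence in L^1 of the conjugate function along radii tending to 1 *)

Section boundary_function.
Context {R : realType}.
Notation mu := (@lebesgue_measure R).
Notation L1 u := (mu.-integrable TT (EFin \o u)).
Implicit Types (u v : R -> R) (r t : R).

Definition rn (n : nat) : R := 1 - n.+2%:R^-1.

Lemma rn01 n : 0 <= rn n < 1.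
Proof.
rewrite /rn subr_ge0 invf_le1 ?ltr0n// ler1n/=.
by rewrite ltrBlDr ltrDl invr_gt0 ltr0n.
Qed.

Lemma rn_cvg : rn n @[n --> \oo] --> (1 : R).
Proof.
rewrite -[X in _ --> X]subr0; apply: cvgB; first exact: cvg_cst.
have h := @cvg_harmonic R; rewrite -(@cvg_shiftS _ (@harmonic R)) in h.
exact: h.
Qed.

Lemma radial_limit_seq (G : R -> R -> R) t l : radial_limit G t l ->
  G (rn n) t @[n --> \oo] --> l.
Proof.
move=> h; apply/cvgrPdist_lt => eps e0; have [del d0 hd] := h _ e0.
have := rn_cvg => /cvgrPdist_lt/(_ _ d0); apply: filterS => n /=.
have /andP[r0 r1] := rn01 n.
rewrite ger0_norm ?subr_ge0 ?(ltW r1)// => rd.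
by rewrite distrC; apply: hd => //; rewrite r1 andbT; lra.
Qed.

Lemma cp_N A B a b : conj_pair A B a b -> conj_pair (fun r t : R => - A r t)
  (fun r t : R => - B r t) (fun r t : R => - a r t) (fun r t : R => - b r t).
Proof. by move=> cp; have := cp_swap (cp_swap cp). Qed.

(** Conjugation is isometric in L^2. Apply the mean value property to the real part of W^2, where W
    is the difference of two dilates of A + i B; W vanishes at the origin. *)
Lemma integral_sqr_conj_pair A B a b (r s : R) : conj_pair A B a b ->
  (forall t, B 0 t = 0) -> 0 <= r < 1 -> 0 <= s < 1 ->
  L1 (fun t => (B r t - B s t) ^+ 2) /\
  L1 (fun t => (A r t - A s t) ^+ 2) /\
  Rintegral mu TT (fun t => (B r t - B s t) ^+ 2) =
  Rintegral mu TT (fun t => (A r t - A s t) ^+ 2).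
Proof.
move=> cp B0 /andP[r0 r1] /andP[s0 s1]; have mT := @measurable_TT R.
(* A common positive radius below 1 and above both r and s, on which the two dilates are
   compared. *)
pose l : R := 1 - (1 - r) * (1 - s) / 2.
have l0 : 0 < l by rewrite /l; nra.
have l1 : l < 1 by rewrite /l; nra.
have lr : r <= l by rewrite /l; nra.
have ls : s <= l by rewrite /l; nra.
have c1 : 0 <= r / l <= 1 by rewrite divr_ge0 ?(ltW l0)//= ler_pdivrMr// mul1r.
have c2 : 0 <= s / l <= 1 by rewrite divr_ge0 ?(ltW l0)//= ler_pdivrMr// mul1r.
have l01 : 0 <= l < 1 by rewrite ltW.
have nl1 := norm_lt1 l01.
have rl : r / l * l = r by rewrite divfK// gt_eqF.
have sl : s / l * l = s by rewrite divfK// gt_eqF.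
have cpW := cp_D (cp_scale c1 cp) (cp_N (cp_scale c2 cp)).
have e := conj_pair_mean (cp_M cpW cpW) l01.
have sq (A' B' a' b' : R -> R -> R) : conj_pair A' B' a' b' ->
    L1 (fun t => A' l t * A' l t).
  move=> cpA; have [C h] := cp_bnd cpA nl1.
  apply: (integrable_Mbdd mT (cp_intA cpA nl1)
     (continuous_measurable_TT (cp_cA cpA nl1)) (C := C)).
  by move=> t _; have [] := h l t (lexx _).
have iP : L1 (fun t => (A r t - A s t) ^+ 2).
  have := sq _ _ _ _ cpW; apply: eq_integrable => // t _ /=.
  by rewrite rl sl expr2.
have iQ : L1 (fun t => (B r t - B s t) ^+ 2).
  have := sq _ _ _ _ (cp_swap cpW); apply: eq_integrable => // t _ /=.
  by rewrite rl sl expr2.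
split => //; split => //.
apply/eqP; rewrite eq_sym -subr_eq0 -RintegralB//; apply/eqP.
have e0 : Rintegral mu TT (fun t =>
    (A (r / l * 0) t - A (s / l * 0) t) * (A (r / l * 0) t - A (s / l * 0) t) -
    (B (r / l * 0) t - B (s / l * 0) t) * (B (r / l * 0) t - B (s / l * 0) t)) = 0.
  rewrite !mulr0 -[RHS](mul0r (2 * pi)) -Rintegral_cst_TT.
  by apply: eq_Rintegral => t _; rewrite !B0 !subrr.
apply: etrans; last exact: etrans e e0.
by apply: eq_Rintegral => t _ /=; rewrite rl sl !expr2.
Qed.

Lemma integral_sqr_QI u (r s : R) : L1 u -> 0 <= r < 1 -> 0 <= s < 1 ->
  L1 (fun t => (QI u r t - QI u s t) ^+ 2) /\
  L1 (fun t => (PI u r t - PI u s t) ^+ 2) /\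
  Rintegral mu TT (fun t => (QI u r t - QI u s t) ^+ 2) =
  Rintegral mu TT (fun t => (PI u r t - PI u s t) ^+ 2).
Proof.
move=> iu; apply: (integral_sqr_conj_pair (cp_PI iu)) => t.
by rewrite /QI kint_kim0//; exact: measurable_TT.
Qed.

Lemma PI_bdd u M r t : L1 u -> (forall s, TT s -> `|u s| <= M) -> 0 <= r < 1 ->
  `|PI u r t| <= M.
Proof.
move=> iu uM r01; have mT := @measurable_TT R.
rewrite ler_norml; apply/andP; split.
  rewrite -[X in X <= _](PI_cst (- M) t r01).
  apply: (le_kint_kre mT measurable_idTT t (norm_lt1 r01) (integrable_cst_TT _) iu).
  by move=> s Ts; have := uM s Ts; rewrite ler_norml => /andP[].
rewrite -[X in _ <= X](PI_cst M t r01).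
apply: (le_kint_kre mT measurable_idTT t (norm_lt1 r01) iu (integrable_cst_TT _)).
by move=> s Ts; have := uM s Ts; rewrite ler_norml => /andP[].
Qed.

Lemma sqrrB_le (a b c : R) :
  (a - b) ^+ 2 <= 2 * (a - c) ^+ 2 + 2 * (b - c) ^+ 2.
Proof. by have := sqr_ge0 (a + b - 2 * c); nra. Qed.

(** Passes from L^2 to L^1 in place of the Cauchy-Schwarz inequality, with a free parameter k; the
    difference of the two sides is a multiple of (|x| - k)^2. *)
Lemma norm_le_sqr (k x : R) : 0 < k -> `|x| <= k / 2 + (2 * k)^-1 * x ^+ 2.
Proof.
move=> k0; rewrite -[x ^+ 2]real_normK ?num_real// -subr_ge0.
have -> : k / 2 + (2 * k)^-1 * `|x| ^+ 2 - `|x| = (2 * k)^-1 * (`|x| - k) ^+ 2.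
  by field; rewrite gt_eqF.
by rewrite mulr_ge0 ?sqr_ge0// invr_ge0 mulr_ge0// ltW.
Qed.

(** For bounded u, P u converges to u almost everywhere by Fatou's theorem and stays bounded by M,
    hence converges in L^2. The isometry carries the Cauchy property over to Q u, and [norm_le_sqr]
    brings it down to L^1. *)
Lemma QI_cauchy_bdd u M : L1 u -> (forall s, TT s -> `|u s| <= M) ->
  forall eps : R, 0 < eps -> exists N, forall n m, (N <= n)%N -> (N <= m)%N ->
  Rintegral mu TT (fun t => `|QI u (rn n) t - QI u (rn m) t|) <= eps.
Proof.
move=> iu uM eps e0; have mT := @measurable_TT R.
have M0 : 0 <= M.
  have h : TT (0 : R) by rewrite /TT/= in_itv/= lexx pi2_gt0.
  by apply: le_trans (uM 0 h).
have mu' := measurable_L1 iu.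
have mP n : measurable_fun (TT : set (measurableTypeR R)) (PI u (rn n)).
  exact: continuous_measurable_TT (cp_cA (cp_PI iu) (norm_lt1 (rn01 n))).
have md n : measurable_fun (TT : set (measurableTypeR R)) (fun t => (PI u (rn n) t - u t) ^+ 2).
  by apply: measurable_funX; apply: measurable_funB.
have bd n t : TT t -> `|(PI u (rn n) t - u t) ^+ 2| <= (2 * M) ^+ 2.
  move=> Tt; rewrite normrX ler_pXn2r ?nnegrE// ?mulr_ge0//.
  apply: le_trans (ler_normB _ _) _.
  have h1 : `|PI u (rn n) t| <= M := PI_bdd t iu uM (rn01 n).
  have h2 := uM t Tt.
  by rewrite mulr_natl mulr2n lerD.
have [||_] := @Rintegral_dominated R _ _ mu TT mT
   (fun n t => (PI u (rn n) t - u t) ^+ 2) (fun=> 0) (fun=> (2 * M) ^+ 2)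
   md (measurable_cst _) _ (integrable_cst_TT _) _.
- apply: (@filterS _ _ (ae_filter_ringOfSetsType mu) _ _ _ (fatou_ae iu)) => t + Tt.
  move=> /(_ Tt)/radial_limit_seq h.
  have h2 : PI u (rn n) t - u t @[n --> \oo] --> 0.
    by rewrite -[X in _ --> X](subrr (u t)); apply: cvgB => //; exact: cvg_cst.
  have := cvgM h2 h2; rewrite mulr0; exact.
- by apply: aeW => t n Tt; exact: bd.
rewrite Rintegral_cst_TT mul0r => /cvgrPdist_lt.
(* The constant term of [norm_le_sqr] then costs eps / 8; the quadratic term costs eps / 4 once both
   squared deviations from u are at most k eps / 8. *)
have [k k0 kE] : exists2 k : R, 0 < k & k / 2 * (2 * pi) = eps / 8.
  have p0 := pi_gt0 R; exists (eps / (8 * pi)); first by rewrite divr_gt0// mulr_gt0.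
  by move: p0; move: pi => p p0; field; rewrite gt_eqF.
have k2 : 0 <= (2 * k)^-1 by rewrite invr_ge0 ltW// mulr_gt0.
have k1 : 0 < k * eps / 8 by rewrite divr_gt0// mulr_gt0.
move=> /(_ _ k1)[N _ hN]; exists N => n m Nn Nm.
have hn : Rintegral mu TT (fun t => (PI u (rn n) t - u t) ^+ 2) <= k * eps / 8.
  have := hN n Nn; rewrite /= sub0r normrN => /ltW; apply: le_trans; exact: ler_norm.
have hm : Rintegral mu TT (fun t => (PI u (rn m) t - u t) ^+ 2) <= k * eps / 8.
  have := hN m Nm; rewrite /= sub0r normrN => /ltW; apply: le_trans; exact: ler_norm.
have id n' : L1 (fun t => (PI u (rn n') t - u t) ^+ 2) by exact: integrable_bdd (md n') (bd n').
have [iQ [iP e]] := integral_sqr_QI iu (rn01 n) (rn01 m).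
have id2 n' : L1 (fun t => 2 * (PI u (rn n') t - u t) ^+ 2).
  by have := integrableZl mT 2 (id n'); apply: eq_integrable.
have sum : Rintegral mu TT (fun t => (PI u (rn n) t - PI u (rn m) t) ^+ 2) <= k * eps / 2.
  apply: (@le_trans _ _ (Rintegral mu TT (fun t => 2 * (PI u (rn n) t - u t) ^+ 2
     + 2 * (PI u (rn m) t - u t) ^+ 2))).
    apply: (le_Rintegral mT iP) => [|t _]; last exact: sqrrB_le.
    by have := integrableD mT (id2 n) (id2 m); apply: eq_integrable.
  rewrite (RintegralD mT (id2 n) (id2 m)) (RintegralZl _ mT (id n)) (RintegralZl _ mT (id m)).
  rewrite (_ : k * eps / 2 = 2 * (k * eps / 8) + 2 * (k * eps / 8)); last by field.
  exact: lerD (ler_wpM2l (ler0n R 2) hn) (ler_wpM2l (ler0n R 2) hm).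
have iQc n' := cp_intB (cp_PI iu) (norm_lt1 (rn01 n')).
have iQd : L1 (fun t => QI u (rn n) t - QI u (rn m) t).
  by have := integrableB mT (iQc n) (iQc m); apply: eq_integrable.
have iQk : L1 (fun t => (2 * k)^-1 * (QI u (rn n) t - QI u (rn m) t) ^+ 2).
  by have := integrableZl mT (2 * k)^-1 iQ; apply: eq_integrable.
apply: (@le_trans _ _ (Rintegral mu TT (fun t => k / 2 +
   (2 * k)^-1 * (QI u (rn n) t - QI u (rn m) t) ^+ 2))).
  apply: (le_Rintegral mT (integrable_norm iQd)) => [|t _]; last exact: norm_le_sqr.
  by have := integrableD mT (integrable_cst_TT (k / 2)) iQk; apply: eq_integrable.
rewrite (RintegralD mT (integrable_cst_TT _) iQk) Rintegral_cst_TT (RintegralZl _ mT iQ) e.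
rewrite kE.
have : (2 * k)^-1 * Rintegral mu TT (fun t => (PI u (rn n) t - PI u (rn m) t) ^+ 2)
    <= (2 * k)^-1 * (k * eps / 2).
  exact: ler_wpM2l k2 _ _ sum.
have -> : (2 * k)^-1 * (k * eps / 2) = eps / 4 by field; rewrite gt_eqF.
move=> h; apply: (@le_trans _ _ (eps / 8 + eps / 4)); first by rewrite lerD2l.
by move: e0; clear; lra.
Qed.

(** [integral_QI_le] is applied to la u, where la is large and u is v cut to its values above M. By
    dominated convergence the integral of phi (la u) is at most 1 for some M, and division by la
    makes the remaining constants small. *)
Lemma QI_tail v : L1 v -> (forall s, TT s -> 0 <= v s) ->
  (forall lam : R, 0 < lam -> L1 (fun s => phi (lam * v s))) ->
  forall eps : R, 0 < eps -> exists M : nat,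
  let u s := v s * \1_[set s | M%:R < v s] s in
  L1 u /\ forall r, 0 <= r < 1 -> Rintegral mu TT (fun t => `|QI u r t|) <= eps.
Proof.
move=> iv v0 iphi eps e0; have mT := @measurable_TT R; have p0 := pi_gt0 R.
(* The bound for la u is 2 pi + 1 + 2: the integral of la u is at most that of phi (la u), which is
   at most 1 and counts twice more. *)
pose la : R := (2 * pi + 3) / eps.
have la0 : 0 < la by rewrite divr_gt0// addr_gt0// pi2_gt0.
have mv := measurable_L1 iv.
have mphi := measurable_L1 (iphi _ la0).
have mI (M : nat) : measurable_fun (TT : set (measurableTypeR R))
    (\1_[set s | M%:R < v s] : R -> R).
  rewrite (_ : \1_ _ = (fun s => (M%:R < v s)%R%:R)); last first.
    apply/funext => s; rewrite indicE.
    by have -> : (s \in [set s | M%:R < v s]) = (M%:R < v s) by apply/idP/idP; rewrite inE.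
  have mb : measurable_fun (TT : set (measurableTypeR R)) (fun s => M%:R < v s).
    by apply: measurable_fun_ltr => //; exact: measurable_cst.
  exact: (measurableT_comp (f := fun b : bool => b%:R : R)).
have ind1 (M : nat) s : `|\1_[set s | M%:R < v s] s : R| <= 1.
  by rewrite indicE; case: (_ \in _); rewrite ?normr1 ?normr0.
have phi0 s : TT s -> 0 <= phi (la * v s).
  by move=> Ts; rewrite phi_ge0// mulr_ge0 ?v0// ltW.
have [|||_] := @Rintegral_dominated R _ _ mu TT mT
   (fun (M : nat) s => phi (la * v s) * \1_[set s | M%:R < v s] s)
   (fun=> 0) (fun s => phi (la * v s)) _ (measurable_cst _) _ (iphi _ la0) _.
- by move=> M; apply: measurable_funM.
- apply: aeW => s Ts; apply: (cvg_near_cst 0).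
  have [k vk] : exists k : nat, v s <= k%:R.
    by exists (Num.bound (v s)); apply/ltW/archi_boundP/v0.
  exists k => // n /= kn; rewrite indicE memNset ?mulr0//=.
  by apply/negP; rewrite -leNgt (le_trans vk)// ler_nat.
- apply: aeW => s n Ts; rewrite normrM (ger0_norm (phi0 s Ts)).
  by rewrite ler_piMr ?phi0.
rewrite Rintegral_cst_TT mul0r => /cvgrPdist_lt/(_ 1 ltr01)[M _ /(_ M (leqnn _))].
rewrite /= sub0r normrN => /(le_lt_trans (ler_norm _))/ltW hM.
exists M; pose u (s : R) := v s * \1_[set s | M%:R < v s] s.
change (L1 u /\ forall r, 0 <= r < 1 ->
  Rintegral mu TT (fun t => `|QI u r t|) <= eps).
have iu : L1 u.
  have := integrable_Mbdd mT iv (mI M) (fun s _ => ind1 M s).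
  by apply: eq_integrable => // s _; rewrite /u /= mulrC.
have u0 s : TT s -> 0 <= u s.
  by move=> Ts; rewrite mulr_ge0 ?v0.
split => // r r01.
have ilu : L1 (fun s => la * u s).
  by have := integrableZl mT la iu; apply: eq_integrable.
(* As phi vanishes at 0, it commutes with truncation. *)
have pu s : phi (la * u s) = phi (la * v s) * \1_[set s | M%:R < v s] s.
  rewrite /u indicE; case: (_ \in _); first by rewrite !mulr1.
  by rewrite !mulr0 /phi addr0 ln1 mulr0.
have ipu : L1 (phi \o (fun s => la * u s)).
  have := integrable_Mbdd mT (iphi _ la0) (mI M) (fun s _ => ind1 M s).
  by apply: eq_integrable => // s _; rewrite /= pu mulrC.
have lu0 s : TT s -> 0 <= la * u s by move=> Ts; rewrite mulr_ge0 ?u0// ltW.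
have := integral_QI_le ilu ipu lu0 r01.
have -> : Rintegral mu TT (fun t => `|QI (fun s => la * u s) r t|) =
    la * Rintegral mu TT (fun t => `|QI u r t|).
  rewrite -RintegralZl//; last first.
    exact: (integrable_norm (cp_intB (cp_PI iu) (norm_lt1 r01))).
  apply: eq_Rintegral => t _.
  have := kint_kimZ mT measurable_idTT la t (norm_lt1 r01) iu.
  by rewrite /QI => ->; rewrite normrM gtr0_norm.
have h1 : Rintegral mu TT (phi \o (fun s => la * u s)) <= 1.
  apply: le_trans hM; rewrite le_eqVlt; apply/orP; left; apply/eqP.
  by apply: eq_Rintegral => s _; rewrite /= pu.
have h2 : Rintegral mu TT (fun s => la * u s) <= Rintegral mu TT (phi \o (fun s => la * u s)).
  by apply: le_Rintegral => // s Ts; rewrite /= phi_ge ?lu0.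
move=> h; rewrite -(ler_pM2l la0); apply: le_trans h _.
have -> : la * eps = 2 * pi + 3 by rewrite /la divfK// gt_eqF.
by move: h1 h2; clear; set a := Rintegral _ _ _; set b := Rintegral _ _ _; lra.
Qed.

Lemma QI_cauchy v : L1 v -> (forall s, TT s -> 0 <= v s) ->
  (forall lam : R, 0 < lam -> L1 (fun s => phi (lam * v s))) ->
  forall eps : R, 0 < eps -> exists N, forall n m, (N <= n)%N -> (N <= m)%N ->
  Rintegral mu TT (fun t => `|QI v (rn n) t - QI v (rn m) t|) <= eps.
Proof.
move=> iv v0 iphi eps e0; have mT := @measurable_TT R.
have e4 : 0 < eps / 4 by rewrite divr_gt0.
have [M [iu hu]] := QI_tail iv v0 iphi e4.
set u := (fun s : R => _) in iu hu.
pose w s := v s - u s.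
have iw : L1 w by have := integrableB mT iv iu; apply: eq_integrable.
have wM s : TT s -> `|w s| <= M%:R.
  move=> Ts; rewrite /w /u indicE; have [|] := boolP (_ \in _).
    by rewrite mulr1 subrr normr0.
  rewrite mulr0 subr0 => /negP h; rewrite ger0_norm ?v0// leNgt.
  by apply/negP => h'; apply: h; rewrite inE.
have [N hN] := QI_cauchy_bdd iw wM e4.
exists N => n m Nn Nm.
have vE r t : 0 <= r < 1 -> QI v r t = QI w r t + QI u r t.
  move=> r01; have := kint_kimD mT measurable_idTT t (norm_lt1 r01) iw iu.
  rewrite /QI => <-; congr (_ * _); apply: eq_Rintegral => s _.
  by rewrite /w subrK.
have iQ f n' : L1 f -> L1 (QI f (rn n')).
  by move=> jf; exact: cp_intB (cp_PI jf) (norm_lt1 (rn01 n')).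
have iQn f n' : L1 f -> L1 (fun t => `|QI f (rn n') t|).
  by move=> jf; exact: (integrable_norm (iQ f n' jf)).
have iD f : L1 f -> L1 (fun t => `|QI f (rn n) t - QI f (rn m) t|).
  move=> jf; have h : L1 (fun t => QI f (rn n) t - QI f (rn m) t).
    by have := integrableB mT (iQ _ n jf) (iQ _ m jf); apply: eq_integrable.
  exact: (integrable_norm h).
have iS : L1 (fun t => `|QI u (rn n) t| + `|QI u (rn m) t|).
  by have := integrableD mT (iQn _ n iu) (iQn _ m iu); apply: eq_integrable.
apply: (@le_trans _ _ (Rintegral mu TT (fun t => `|QI w (rn n) t - QI w (rn m) t| +
   (`|QI u (rn n) t| + `|QI u (rn m) t|)))).
  apply: le_Rintegral => //; first exact: iD.
    by have := integrableD mT (iD _ iw) iS; apply: eq_integrable.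
  move=> t _; rewrite !vE ?rn01// opprD addrACA.
  by apply: le_trans (ler_normD _ _) _; rewrite lerD2l ler_normB.
rewrite (RintegralD mT (iD _ iw) iS) (RintegralD mT (iQn _ n iu) (iQn _ m iu)).
apply: (@le_trans _ _ (eps / 4 + (eps / 4 + eps / 4))).
  by apply: lerD; [exact: hN|apply: lerD; apply: hu; exact: rn01].
by move: e0; clear; lra.
Qed.

End boundary_function.

(** * Boundary values of the conjugate function, and the converse by Fatou's lemma *)

Section conjugate_boundary_function.
Context {R : realType}.
Notation mu := (@lebesgue_measure R).
Notation L1 u := (mu.-integrable TT (EFin \o u)).
Implicit Types (u v : R -> R) (r t : R).

Lemma fast_subsequence (c : nat -> nat -> R) :
  (forall eps : R, 0 < eps -> exists N, forall n m, (N <= n)%N -> (N <= m)%N ->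
     c n m <= eps) ->
  exists q : nat -> nat, (forall k, c (q k) (q k.+1) <= 2^-1 ^+ k) /\
    forall k, (k <= q k)%N.
Proof.
move=> hc.
have /choice[N hN] (k : nat) : exists N, forall n m, (N <= n)%N -> (N <= m)%N ->
    c n m <= 2^-1 ^+ k.
  by apply: hc; rewrite exprn_gt0// invr_gt0.
(* The sum makes both q k and q (k + 1) exceed the threshold N k; the summand k makes q tend to
   infinity. *)
pose q (k : nat) := (k + \sum_(j < k.+1) N j)%N.
have qN k k' : (k <= k')%N -> (N k <= q k')%N.
  move=> kk; apply: leq_trans (leq_addl _ _).
  have kk' : (k < k'.+1)%N by rewrite ltnS.
  by rewrite (bigD1 (Ordinal kk'))//= leq_addr.
exists q; split=> k; last exact: leq_addr.
by apply: hN; apply: qN.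
Qed.

(** The argument of Riesz and Fischer: the sum W of the moduli of successive differences is
    integrable, hence finite almost everywhere. Where it is finite the telescoping series converges,
    and |G 0| + W dominates the whole sequence. *)
Lemma L1_cauchy_limit (G : nat -> R -> R) :
  (forall n, L1 (G n)) ->
  (forall k, Rintegral mu TT (fun t => `|G k t - G k.+1 t|) <= 2^-1 ^+ k) ->
  exists h w : R -> R, [/\ L1 h, L1 w,
    {ae mu, forall t, TT t -> G n t @[n --> \oo] --> h t} &
    {ae mu, forall t n, TT t -> `|G n t| <= w t}].
Proof.
move=> iG hG; have mT := @measurable_TT R.
pose d k t := `|G k t - G k.+1 t|.
have iGD k : L1 (fun t => G k t - G k.+1 t).
  by have := integrableB mT (iG k) (iG k.+1); apply: eq_integrable.
have id k : L1 (d k) by exact: (integrable_norm (iGD k)).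
have md k := measurable_L1 (id k).
have mG k := measurable_L1 (iG k).
have d0 k t : 0 <= d k t by exact: normr_ge0.
pose W t := (\sum_(k <oo) (d k t)%:E)%E.
have W0 t : (0 <= W t)%E by apply: nneseries_ge0 => k _ _; rewrite lee_fin.
have mW : measurable_fun (TT : set (measurableTypeR R)) W.
  apply: ge0_emeasurable_sum => [k t _ _|k _]; first by rewrite lee_fin.
  exact/measurable_EFinP.
have iW : mu.-integrable TT W.
  apply/integrableP; split => //.
  under eq_integral do rewrite gee0_abs//.
  rewrite integral_nneseries//; last 2 first.
  - by move=> k; exact/measurable_EFinP.
  - by move=> k t _; rewrite lee_fin.
  apply: (@le_lt_trans _ _ (\sum_(k <oo) (2^-1 ^+ k)%:E)%E).
    apply: lee_nneseries => [k _ _|k _].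
      by apply: integral_ge0 => t _; rewrite lee_fin.
    have fi : (\int[mu]_(t in TT) (d k t)%:E)%E \is a fin_num.
      exact: (integrable_fin_num mT (id k)).
    by rewrite -(fineK fi) lee_fin; exact: hG.
  apply: (@le_lt_trans _ _ (2 : R)%:E); last exact: ltry.
  apply: lime_le.
    by apply: is_cvg_nneseries => k _ _; rewrite lee_fin exprn_ge0// invr_ge0.
  apply: nearW => n; rewrite sumEFin lee_fin.
  have -> : \sum_(0 <= i < n) 2^-1 ^+ i = 2 - 2 * 2^-1 ^+ n :> R.
    elim: n => [|n IH]; first by rewrite big_geq// expr0; ring.
    by rewrite big_nat_recr//= IH exprS; field.
  by rewrite gerBl// mulr_ge0// exprn_ge0// invr_ge0.
pose A := [set t : R | TT t /\ (W t < +oo)%E].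
have mA : measurable (A : set (measurableTypeR R)).
  have := mW mT _ (measurableC (emeasurable_set1 +oo%E)).
  rewrite (_ : _ `&` _ = A)//; apply/seteqP; split => t /=.
    by move=> [Tt /eqP Wt]; split; rewrite // ltey.
  by move=> [Tt Wt]; split => //; apply/eqP; rewrite -ltey.
have aeA : {ae mu, forall t, TT t -> A t}.
  have := integrable_ae mT iW.
  apply: (@filterS _ _ (ae_filter_ringOfSetsType mu)) => t h Tt.
  by split => //; have := h Tt; rewrite ge0_fin_numE.
have dsum t : A t -> forall n, \sum_(0 <= k < n) d k t <= fine (W t).
  move=> [_ Wt] n; rewrite -lee_fin -sumEFin fineK ?ge0_fin_numE//.
  by apply: nneseries_lim_ge => k _; rewrite lee_fin.
have Gtel n t : G n t = G 0%N t - \sum_(0 <= k < n) (G k t - G k.+1 t).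
  elim: n => [|n IH]; first by rewrite big_geq// subr0.
  by rewrite big_nat_recr//= opprD addrA -IH opprB addrC subrK.
have Gbd t n : A t -> `|G n t| <= `|G 0%N t| + fine (W t).
  move=> At; rewrite Gtel; apply: le_trans (ler_normB _ _) _; rewrite lerD2l.
  apply: le_trans (ler_norm_sum _ _ _) _; exact: dsum.
have Gcv t : A t -> cvg (G n t @[n --> \oo]).
  move=> At.
  have cs : cvgn (series (fun k => G k t - G k.+1 t)).
    apply: normed_cvg.
    apply: nondecreasing_is_cvgn.
      by apply: nondecreasing_series => k _ _; exact: normr_ge0.
    exists (fine (W t)) => _ [n _ <-]; exact: dsum.
  have -> : (fun n => G n t) = (fun n => G 0%N t - series (fun k => G k t - G k.+1 t) n).
    by apply/funext => n; rewrite Gtel.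
  by apply: is_cvgB => //; exact: is_cvg_cst.
(* Outside the set of convergence the value is 0, which makes h an everywhere limit of the
   measurable functions G n times the indicator of A. *)
pose h t := if t \in A then lim (G n t @[n --> \oo]) else 0.
pose w t := `|G 0%N t| + fine (W t).
have hcv t : A t -> G n t @[n --> \oo] --> h t.
  by move=> At; rewrite /h mem_set//; exact: Gcv.
have mh : measurable_fun (TT : set (measurableTypeR R)) h.
  have mF n : measurable_fun (TT : set (measurableTypeR R)) (fun t => G n t * \1_A t).
    by apply: measurable_funM => //; apply: measurable_indic.
  apply: (measurable_fun_cvg mF) => t _.
  have [At|nAt] := pselect (A t).
    by rewrite indicE mem_set//=; under eq_fun do rewrite mulr1; exact: hcv.
  rewrite indicE memNset//= /h memNset//; under eq_fun do rewrite mulr0.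
  exact: cvg_cst.
have iw : L1 w.
  have ifW : L1 (fine \o W).
    apply: le_integrable iW => //.
      by apply/measurable_EFinP; apply: measurableT_comp => //; exact: measurable_fine.
    move=> t _ /=; rewrite [X in (_ <= X)%E]gee0_abs// ger0_norm ?fine_ge0//.
    by case: (W t) (W0 t) => //= r; rewrite leey.
  by have := integrableD mT (integrable_norm (iG 0%N)) ifW; apply: eq_integrable.
have ae1 : {ae mu, forall t, TT t -> G n t @[n --> \oo] --> h t}.
  apply: (@filterS _ _ (ae_filter_ringOfSetsType mu) _ _ _ aeA) => t tA Tt.
  exact: hcv (tA Tt).
have ae2 : {ae mu, forall t n, TT t -> `|G n t| <= w t}.
  apply: (@filterS _ _ (ae_filter_ringOfSetsType mu) _ _ _ aeA) => t tA n Tt.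
  exact: Gbd (tA Tt).
exists h, w; split => //.
by have [] := Rintegral_dominated mT mG mh ae1 iw ae2.
Qed.

(** h is the limit of Q v along a sequence of radii r_n. The Poisson integral at radius r of Q v at
    radius r_n is Q v at radius r r_n: the left side tends to P h by domination, the right side to Q
    v at radius r by continuity. *)
Lemma QI_boundary v : L1 v -> (forall s, TT s -> 0 <= v s) ->
  (forall lam : R, 0 < lam -> L1 (fun s => phi (lam * v s))) ->
  exists h, L1 h /\ forall r t, 0 <= r < 1 -> QI v r t = PI h r t.
Proof.
move=> iv v0 iphi; have mT := @measurable_TT R.
have [q [qc qk]] := fast_subsequence (QI_cauchy iv v0 iphi).
pose G k t := QI v (rn (q k)) t.
have iG n : L1 (G n) by exact: cp_intB (cp_PI iv) (norm_lt1 (rn01 _)).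
have [h [w [ih iw Gh Gw]]] := L1_cauchy_limit iG qc.
exists h; split => // r t r01; have r1 := norm_lt1 r01.
have [C hC] := cp_bnd cp_kernel r1.
have kC x : `|kre r x| <= C by have [] := hC r x (lexx _).
have mh := measurable_L1 ih.
have mk : measurable_fun (TT : set (measurableTypeR R)) (fun s => kre r (t - s)).
  exact: (measurable_kshift measurable_idTT t (continuous_kre r1)).
have mkG n : measurable_fun (TT : set (measurableTypeR R)) (fun s => kre r (t - s) * G n s).
  apply: measurable_funM => //.
  exact: measurable_L1.
have [||||| _ lim1] := @Rintegral_dominated R _ _ mu TT mT
   (fun n s => kre r (t - s) * G n s) (fun s => kre r (t - s) * h s)
   (fun s => C * w s).
- exact: mkG.
- exact: measurable_funM.
- apply: (@filterS _ _ (ae_filter_ringOfSetsType mu) _ _ _ Gh) => s + Ts.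
  by move=> /(_ Ts) c; apply: cvgM => //; exact: cvg_cst.
- by have := integrableZl mT C iw; apply: eq_integrable.
- apply: (@filterS _ _ (ae_filter_ringOfSetsType mu) _ _ _ Gw) => s + n Ts.
  by move=> /(_ n Ts) c; rewrite normrM ler_pM.
have lim2 : (2 * pi)^-1 * Rintegral mu TT (fun s => kre r (t - s) * G n s)
    @[n --> \oo] --> PI h r t.
  by apply: cvgM => //; exact: cvg_cst.
have e : (fun n => (2 * pi)^-1 * Rintegral mu TT (fun s => kre r (t - s) * G n s)) =
    (fun n => QI v (r * rn (q n)) t).
  by apply/funext => n; exact: (PI_QI t iv r01 (rn01 (q n))).
rewrite e in lim2.
have cQ : {for r, continuous (fun x => QI v x t)} by exact: isd_cont (cp_Br (cp_PI iv) t r1).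
have qinf : r * rn (q n) @[n --> \oo] --> r.
  rewrite -[X in _ --> X]mulr1; apply: cvgM; first exact: cvg_cst.
  apply: (cvg_comp _ _ _ (@rn_cvg R)).
  apply/cvgnyPge => m; exists m => // n /= mn; exact: leq_trans mn (qk n).
have lim3 : QI v (r * rn (q n)) t @[n --> \oo] --> QI v r t.
  exact: (cvg_comp _ _ qinf cQ).
exact: (cvg_unique _ lim3 lim2).
Qed.

(** The integrals of [phi] of P v are bounded by [integral_phi_PI_le], and P v tends to v almost
    everywhere along the radii [rn], so Fatou's lemma applies. *)
Lemma L1_phi_of_QI v K : L1 v -> (forall s, TT s -> 0 <= v s) ->
  (forall r, 0 <= r < 1 -> Rintegral mu TT (fun t => `|QI v r t|) <= K) ->
  (\int[mu]_(t in TT) (phi (v t))%:E < +oo)%E.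
Proof.
move=> iv v0 hK; have mT := @measurable_TT R.
pose C := 2 * pi * phi ((2 * pi)^-1 * Rintegral mu TT v) + pi / 2 * K.
have hC n : Rintegral mu TT (fun t => phi (PI v (rn n) t)) <= C.
  apply: le_trans (integral_phi_PI_le iv v0 (rn01 n)) _.
  by rewrite lerD2l ler_wpM2l ?hK ?rn01// divr_ge0// pi_ge0.
have P0 n t : 0 <= PI v (rn n) t.
  by apply: kint_kre_ge0 => //; exact: norm_lt1 (rn01 n).
have ip n : L1 (fun t => phi (PI v (rn n) t)) by exact: integrable_phi_PI (rn01 n).
have mv := measurable_L1 iv.
have mf n : measurable_fun (TT : set (measurableTypeR R)) (fun t => (phi (PI v (rn n) t))%:E).
  by have /integrableP[] := ip n.
have f0 n t : TT t -> (0 <= (phi (PI v (rn n) t))%:E)%E by move=> _; rewrite lee_fin phi_ge0.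
have := fatou mu mT mf f0.
have le1 : (limn_einf (fun n => \int[mu]_(t in TT) (phi (PI v (rn n) t))%:E) <= C%:E)%E.
  apply: (@le_trans _ _ (limn_esup (fun n => \int[mu]_(t in TT) (phi (PI v (rn n) t))%:E))%E).
    exact: limn_einf_sup.
  rewrite limn_esup_lim; apply: lime_le; first exact: is_cvg_esups.
  apply: nearW => n; apply: ge_ereal_sup => _ [m _ <-].
  have fi : (\int[mu]_(t in TT) (phi (PI v (rn m) t))%:E)%E \is a fin_num.
    exact: (integrable_fin_num mT (ip m)).
  by rewrite -(fineK fi) lee_fin; exact: hC.
move=> /le_trans/(_ le1) le2; apply: le_lt_trans (ltry C); apply: le_trans le2.
have mphi : measurable_fun (TT : set (measurableTypeR R)) (fun t => (phi (v t))%:E).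
  apply/measurable_EFinP; apply: measurable_funM.
    by apply: measurable_funD => //; exact: measurable_cst.
  apply: (measurableT_comp (@measurable_ln R)).
  by apply: measurable_funD => //; exact: measurable_cst.
apply: ae_ge0_le_integral => //.
- by move=> t Tt; rewrite lee_fin phi_ge0// v0.
- move=> t Tt; rewrite limn_einf_lim; apply: lime_ge; first exact: is_cvg_einfs.
  by apply: nearW => n; apply: le_ereal_inf_tmp => _ [m _ <-]; exact: f0.
(* A lower limit is the opposite of the upper limit of the opposites, whose measurability is
   available. *)
- rewrite (_ : (fun t => _) = (fun t => - limn_esup (fun n =>
     - (phi (PI v (rn n) t))%:E))%E); last first.
    by apply/funext => t; rewrite -limn_einfN; congr limn_einf; apply/funext => n; rewrite /= opprK.
  apply: measurableT_comp => //; apply: measurable_fun_limn_esup => n.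
  by apply: measurableT_comp => //; exact: mf.
- apply: (@filterS _ _ (ae_filter_ringOfSetsType mu) _ _ _ (fatou_ae iv)) => t + Tt.
  move=> /(_ Tt)/radial_limit_seq c.
  have c1 : (1 + PI v (rn n) t) @[n --> \oo] --> 1 + v t.
    by apply: cvgD => //; exact: cvg_cst.
  have c2 : phi (PI v (rn n) t) @[n --> \oo] --> phi (v t).
    apply: cvgM => //; apply: (@cvg_comp _ _ _ _ (@ln R) _ _ _ c1).
    by apply: continuous_ln; have := v0 t Tt; lra.
  have c3 : (phi (PI v (rn n) t))%:E @[n --> \oo] --> (phi (v t))%:E.
    by apply: cvg_EFin; [exact: nearW|exact: c2].
  by rewrite is_cvg_limn_einfE; [rewrite (cvg_lim _ c3)|apply/cvg_ex; eexists; exact: c3].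
Qed.

End conjugate_boundary_function.

(** * Modulus, polar form and exponential of complex numbers *)

Section complex_modulus.
Context {R : realType}.
Implicit Types (z w : R[i]) (r t : R).

Lemma cabsE z : cabs z = ComplexField.Normc.normc z.
Proof. by case: z. Qed.

Lemma cabsM z w : cabs (z * w) = cabs z * cabs w.
Proof. by rewrite !cabsE ComplexField.Normc.normcM. Qed.

Lemma cabsV z : cabs z^-1 = (cabs z)^-1.
Proof. by rewrite !cabsE ComplexField.Normc.normcV. Qed.

Lemma ler_cabsD z w : cabs (z + w) <= cabs z + cabs w.
Proof. by rewrite !cabsE; exact: le_normcD. Qed.

Lemma cabsN z : cabs (- z) = cabs z.
Proof. by rewrite !cabsE; exact: normcN. Qed.

Lemma cabs_ge0 z : 0 <= cabs z. Proof. exact: sqrtr_ge0. Qed.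

Lemma cabs0 : cabs (0 : R[i]) = 0.
Proof. by rewrite cabsE ComplexField.Normc.normc0. Qed.

Lemma cabs1 : cabs (1 : R[i]) = 1.
Proof. by rewrite cabsE ComplexField.Normc.normc1. Qed.

Lemma cabs_eq0 z : (cabs z == 0) = (z == 0).
Proof.
apply/eqP/eqP => [|->]; last exact: cabs0.
by rewrite cabsE => /ComplexField.Normc.eq0_normc.
Qed.

Lemma cabs_gt0 z : (0 < cabs z) = (z != 0).
Proof. by rewrite lt_neqAle cabs_ge0 andbT eq_sym cabs_eq0. Qed.

Lemma ler_cabsB z w : cabs (z - w) <= cabs z + cabs w.
Proof. by rewrite -[cabs w]cabsN ler_cabsD. Qed.

Lemma lerB_cabs z w : cabs z - cabs w <= cabs (z - w).
Proof. by rewrite lerBlDr; have := ler_cabsD (z - w) w; rewrite subrK. Qed.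

Lemma sqr_cabs z : cabs z ^+ 2 = complex.Re z ^+ 2 + complex.Im z ^+ 2.
Proof. by rewrite sqr_sqrtr// addr_ge0// sqr_ge0. Qed.

Lemma ler_Re_cabs z : `|complex.Re z| <= cabs z.
Proof.
by rewrite -sqrtr_sqr ler_wsqrtr// lerDl sqr_ge0.
Qed.

Lemma ler_Im_cabs z : `|complex.Im z| <= cabs z.
Proof. by rewrite -sqrtr_sqr ler_wsqrtr// lerDr sqr_ge0. Qed.

Lemma ler_cabs_ReIm z : cabs z <= `|complex.Re z| + `|complex.Im z|.
Proof.
rewrite -(ler_pXn2r (n := 2)) ?nnegrE ?cabs_ge0// ?addr_ge0// sqr_cabs.
rewrite sqrrD !real_normK ?num_real// -addrA lerD2l lerDr.
by rewrite mulrn_wge0// mulr_ge0.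
Qed.

Lemma cabs_real (r : R) : cabs (Complex r 0) = `|r|.
Proof. by rewrite /cabs/= expr0n/= addr0 sqrtr_sqr. Qed.

Lemma cexpD z w : cexp (z + w) = cexp z * cexp w.
Proof.
case: z w => [a b] [c d]; rewrite /cexp/= expRD cosD sinD complexM.
by apply: complex_eq; ring.
Qed.

Lemma cexp0 : cexp (0 : R[i]) = 1.
Proof. by rewrite /cexp/= expR0 cos0 sin0 mulr1 mulr0. Qed.

Lemma cabs_cexp z : cabs (cexp z) = expR (complex.Re z).
Proof.
by rewrite /cabs/= !exprMn -mulrDr cos2Dsin2 mulr1 sqrtr_sqr ger0_norm// expR_ge0.
Qed.

Lemma cexp_neq0 z : cexp z != 0.
Proof. by rewrite -cabs_gt0 cabs_cexp expR_gt0. Qed.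

Lemma cabs_expi t : cabs (expi t) = 1.
Proof. by rewrite /cabs/= cos2Dsin2 sqrtr1. Qed.

Lemma expi_neq0 t : expi t != 0.
Proof. by rewrite -cabs_gt0 cabs_expi. Qed.

Lemma cpolE r t : cpol r t = Complex r 0 * expi t.
Proof. by rewrite /cpol /expi complexM !mul0r subr0 addr0. Qed.

Lemma cabs_cpol r t : 0 <= r -> cabs (cpol r t) = r.
Proof. by move=> r0; rewrite cpolE cabsM cabs_expi mulr1 cabs_real ger0_norm. Qed.

Lemma polar z : exists t, z = cpol (cabs z) t.
Proof.
have [z0|z0] := eqVneq z 0.
  by exists 0; rewrite z0 cabs0 /cpol !mul0r.
have c0 : 0 < cabs z by rewrite cabs_gt0.
case: z z0 c0 => x y z0 c0; set c := cabs _ in c0 *.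
have c2 : c ^+ 2 = x ^+ 2 + y ^+ 2 by rewrite sqr_cabs.
have xc : -1 <= x / c <= 1.
  have := ler_Re_cabs (Complex x y); rewrite /= -/c ler_norml => /andP[h1 h2].
  by rewrite ler_pdivlMr// ler_pdivrMr// mulN1r mul1r h1.
have [a0 ca] := acos_def xc.
have sa : (c * sin (acos (x / c))) ^+ 2 = y ^+ 2.
  rewrite exprMn sin2cos2 ca mulrBr mulr1 c2 expr_div_n mulrCA c2 -c2 divff ?mulr1; last first.
    by rewrite expf_neq0// gt_eqF.
  by rewrite c2; ring.
(* acos fixes the cosine only; the sign of the imaginary part decides between the angle and its
   opposite. *)
have /eqP := sa; rewrite eqf_sqr => /orP[] /eqP e.
  exists (acos (x / c)); rewrite /cpol ca e; apply: complex_eq => //.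
  by rewrite mulrC divfK// gt_eqF.
exists (- acos (x / c)); rewrite /cpol cosN sinN ca mulrN e opprK.
by apply: complex_eq => //; rewrite mulrC divfK// gt_eqF.
Qed.

Lemma norm_sin_le (x : R) : `|sin x| <= `|x|.
Proof.
wlog x0 : x / 0 <= x.
  move=> h; have [/h//|/ltW x0] := lerP 0 x.
  by have := h (- x); rewrite oppr_ge0 sinN !normrN; exact.
move: x0; rewrite le_eqVlt => /orP[/eqP <-|x0]; first by rewrite sin0.
have [|c _] := @MVT _ sin cos 0 x x0 (fun y _ => is_derive_sin y).
  by apply: continuous_subspaceT => y; exact: continuous_sin.
by rewrite sin0 !subr0 => ->; rewrite normrM ler_piMl// cos_max.
Qed.

Lemma one_sub_cos_le (x : R) : 1 - cos x <= x ^+ 2 / 2.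
Proof.
have -> : cos x = 1 - 2 * sin (x / 2) ^+ 2.
  have h2 (y : R) : cos (y *+ 2) = 1 - 2 * sin y ^+ 2.
    by rewrite cos_mulr2n sin2cos2 mulr2n; ring.
  by rewrite -h2 -[_ *+ 2]mulr_natr divfK// pnatr_eq0.
have : sin (x / 2) ^+ 2 <= (x / 2) ^+ 2.
  rewrite -[sin _ ^+ 2]real_normK ?num_real// -[(x / 2) ^+ 2]real_normK ?num_real//.
  by rewrite ler_pXn2r ?nnegrE// norm_sin_le.
by rewrite expr_div_n; move: (sin _ ^+ 2) => s; lra.
Qed.

(** The upper bound comes from e^{-a} >= 1 - a, hence e^a <= 1 / (1 - a), and (1 + a + 2 a^2)(1 - a)
    = 1 + a^2 (1 - 2 a) >= 1. *)
Lemma expR_quad (a : R) : `|a| <= 2^-1 -> 0 <= expR a - 1 - a <= 2 * a ^+ 2.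
Proof.
rewrite ler_norml => /andP[a1 a2].
have h1 := expR_ge1Dx a; have h2 := expR_ge1Dx (- a).
apply/andP; split; first lra.
have e : expR a * expR (- a) = 1 by rewrite -expRD subrr expR0.
have e0 := expR_gt0 a.
have h3 : expR a * (1 - a) <= 1 by rewrite -[leRHS]e ler_wpM2l// ltW.
have h4 : 1 <= (1 + a + 2 * a ^+ 2) * (1 - a).
  have : 0 <= a ^+ 2 * (1 - 2 * a) by rewrite mulr_ge0 ?sqr_ge0//; lra.
  lra.
have h5 : 0 < 1 - a by lra.
have : expR a * (1 - a) <= (1 + a + 2 * a ^+ 2) * (1 - a) by lra.
by rewrite ler_pM2r//; lra.
Qed.

(** Second-order Taylor estimate, obtained from separate bounds on the real and imaginary parts; the
    constant 10 is generous. *)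
Lemma cexp_quad z : cabs z <= 2^-1 -> cabs (cexp z - 1 - z) <= 10 * cabs z ^+ 2.
Proof.
move=> z2; apply: le_trans (ler_cabs_ReIm _) _.
have := ler_Re_cabs z; have := ler_Im_cabs z; have := sqr_cabs z.
case: z z2 => a b /= z2; set c := cabs _ in z2 * => c2 bc ac.
have a2 : `|a| <= 2^-1 by lra.
have b2 : `|b| <= 2^-1 by lra.
have /andP[e1 e2] := expR_quad a2.
set e := expR a in e1 e2 *.
have := one_sub_cos_le b; have := cos_le1 b; set k := cos b => k1 k2.
have aa : a ^+ 2 = `|a| ^+ 2 by rewrite real_normK ?num_real.
have bb : b ^+ 2 = `|b| ^+ 2 by rewrite real_normK ?num_real.
have en : `|e - 1| <= 2 * `|a|.
  have -> : e - 1 = (e - 1 - a) + a by ring.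
  apply: le_trans (ler_normD _ _) _; rewrite (ger0_norm e1).
  have := normr_ge0 a; nra.
have e3 : 0 <= e <= 2.
  by rewrite expR_ge0/=; move: en; rewrite ler_norml => /andP[_]; lra.
have h1 : `|e * k - 1 - a| <= 2 * a ^+ 2 + b ^+ 2.
  have -> : e * k - 1 - a = (e - 1 - a) - e * (1 - k) by ring.
  apply: le_trans (ler_normB _ _) _; rewrite (ger0_norm e1).
  apply: lerD => //; rewrite ger0_norm; last by rewrite mulr_ge0//; lra.
  move: e3 => /andP[e30 e32]; nra.
have sb : `|sin b - b| <= b ^+ 2.
  have [->|b0] := eqVneq b 0; first by rewrite sin0 subrr normr0 sqr_ge0.
  have aux (x : R) : 0 < x -> x <= 2^-1 -> `|sin x - x| <= x ^+ 2.
    move=> x0 x2.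
    have [|d] := @MVT _ sin cos 0 x x0 (fun y _ => is_derive_sin y).
      by apply: continuous_subspaceT => y; exact: continuous_sin.
    rewrite in_itv/= => /andP[d0 dx]; rewrite sin0 !subr0 => ->.
    rewrite -[X in _ - X]mul1r -mulrBl normrM (gtr0_norm x0) expr2 ler_pM2r//.
    have := one_sub_cos_le d; have := cos_le1 d => d1 d2.
    rewrite distrC ger0_norm ?subr_ge0//; nra.
  move: b0; rewrite neq_lt => /orP[b0|b0]; last first.
    by apply: aux => //; move: b2; rewrite gtr0_norm.
  have := aux (- b); rewrite oppr_gt0 sinN opprK addrC -normrN opprB sqrrN; apply => //.
  by move: b2; rewrite ltr0_norm.
have h2 : `|e * sin b - 0 - b| <= 2 * `|a| * `|b| + b ^+ 2.
  have -> : e * sin b - 0 - b = (e - 1) * sin b + (sin b - b) by ring.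
  apply: le_trans (ler_normD _ _) _; apply: lerD => //.
  by rewrite normrM ler_pM// norm_sin_le.
apply: le_trans (lerD h1 h2) _; rewrite c2 aa bb.
have := sqr_ge0 (`|a| - `|b|); have := sqr_ge0 `|a|; have := sqr_ge0 `|b|; nra.
Qed.

End complex_modulus.

(** * Complex differentiability with quadratic remainder *)

Section quadratic_differentiability.
Context {R : realType}.
Implicit Types (z w h : R[i]) (f g : R[i] -> R[i]).

(* a differentiability notion with a quadratic remainder, which is easier to
   propagate through sums and exponentials than the o(h) of [holo] *)
Definition qdiff f z := exists d : R[i], exists C del : R,
  0 < del /\ forall h, cabs h < del -> cabs (f (z + h) - f z - d * h) <= C * cabs h ^+ 2.

Lemma qdiffD f g z : qdiff f z -> qdiff g z -> qdiff (fun x => f x + g x) z.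
Proof.
move=> [d [C [del [d0 hf]]]] [d' [C' [del' [d0' hg]]]].
exists (d + d'), (C + C'), (Num.min del del'); split; first by rewrite lt_min d0.
move=> h; rewrite lt_min => /andP[h1 h2].
have -> : f (z + h) + g (z + h) - (f z + g z) - (d + d') * h =
  (f (z + h) - f z - d * h) + (g (z + h) - g z - d' * h) by ring.
by rewrite mulrDl (le_trans (ler_cabsD _ _))// lerD// ?hf ?hg.
Qed.

Lemma qdiffZ (c : R[i]) f z : qdiff f z -> qdiff (fun x => c * f x) z.
Proof.
move=> [d [C [del [d0 hf]]]].
exists (c * d), (cabs c * C), del; split => // h hd.
have -> : c * f (z + h) - c * f z - c * d * h = c * (f (z + h) - f z - d * h) by ring.
by rewrite cabsM -mulrA ler_wpM2l ?cabs_ge0 ?hf.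
Qed.

Lemma qdiff_cexp f z : qdiff f z -> qdiff (fun x => cexp (f x)) z.
Proof.
move=> [d [C [del [d0 hf]]]].
(* A Lipschitz constant of f at z for |h| < 1. The radius below then keeps the increment of f within
   1 / 2, as [cexp_quad] requires. *)
pose K := cabs d + `|C| + 1.
have K0 : 0 < K by rewrite ltr_wpDl// addr_ge0// cabs_ge0.
pose del' := Num.min (Num.min del 1) (2 * K)^-1.
exists (cexp (f z) * d), (cabs (cexp (f z)) * (10 * K ^+ 2 + `|C|)), del'.
split; first by rewrite !lt_min d0 ltr01/= invr_gt0 mulr_gt0.
move=> h; rewrite !lt_min -andbA => /and3P[h1 h2 h3].
have hh := cabs_ge0 h; have hd := cabs_ge0 d; have C0 := normr_ge0 C.
pose k := f (z + h) - f z.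
have -> : cexp (f (z + h)) - cexp (f z) - cexp (f z) * d * h =
   cexp (f z) * ((cexp k - 1 - k) + (k - d * h)).
  rewrite (_ : f (z + h) = f z + k); last by rewrite /k [RHS]addrC subrK.
  by rewrite cexpD; ring.
have hk : cabs (k - d * h) <= `|C| * cabs h ^+ 2.
  by apply: le_trans (hf h h1) _; rewrite ler_wpM2r ?sqr_ge0// ler_norm.
have kK : cabs k <= K * cabs h.
  have -> : k = (k - d * h) + d * h by rewrite subrK.
  apply: le_trans (ler_cabsD _ _) _; rewrite cabsM.
  apply: le_trans (lerD hk (lexx _)) _.
  have : `|C| * cabs h ^+ 2 <= `|C| * cabs h.
    by rewrite ler_wpM2l// expr2 ler_piMl// ltW.
  by rewrite /K !mulrDl mul1r; lra.
have k2 : cabs k <= 2^-1.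
  apply: le_trans kK _; move: h3; rewrite invfM -(ltr_pM2l K0) => /ltW h3.
  by apply: le_trans h3 _; rewrite mulrCA divff ?mulr1// gt_eqF.
rewrite cabsM -mulrA ler_wpM2l ?cabs_ge0//.
apply: le_trans (ler_cabsD _ _) _; rewrite mulrDl; apply: lerD => //.
apply: le_trans (cexp_quad k2) _; rewrite -mulrA ler_wpM2l// -exprMn.
by rewrite ler_pXn2r ?nnegrE ?cabs_ge0// mulr_ge0// ltW.
Qed.

Lemma holo_qdiff f g : (forall z, Dsk z -> qdiff g z) ->
  (forall z, Dsk z -> f z = g z) -> holo f.
Proof.
move=> qg fg z Dz; have [d [C [del [d0 hg]]]] := qg z Dz.
exists d => eps e0.
exists (Num.min del (eps / (`|C| + 1))); split.
  by rewrite lt_min d0 divr_gt0// ltr_wpDl.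
move=> h /andP[h0]; rewrite lt_min => /andP[h1 h2] Dzh.
have hn : h != 0 by rewrite -cabs_gt0.
rewrite !fg//.
have -> : (g (z + h) - g z) / h - d = (g (z + h) - g z - d * h) / h by field.
rewrite cabsM cabsV ltr_pdivrMr//.
apply: le_lt_trans (hg h h1) _; rewrite expr2 mulrA ltr_pM2r//.
apply: (@le_lt_trans _ _ ((`|C|) * cabs h)); first by rewrite ler_wpM2r ?(ltW h0)// ler_norm.
move: h2; rewrite ltr_pdivlMr ?ltr_wpDl// => h2; have := normr_ge0 C; nra.
Qed.

End quadratic_differentiability.

(** * Continuity of complex-valued functions of a real variable *)

Section complex_continuity.
Context {R : realType}.
Implicit Types K L : R -> R[i].

(** Componentwise, because [schwarz] integrates real and imaginary parts separately. *)
Definition ccont K := continuous (fun s => complex.Re (K s)) /\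
  continuous (fun s => complex.Im (K s)).

Lemma ccont_cst (z : R[i]) : ccont (fun=> z).
Proof. by split => s; exact: cvg_cst. Qed.

Lemma ccont_expi : ccont expi.
Proof. by split; [exact: continuous_cos|exact: continuous_sin]. Qed.

Lemma ccont_eq K (f g : R -> R) : (forall s, K s = Complex (f s) (g s)) ->
  continuous f -> continuous g -> ccont K.
Proof.
move=> e cf cg; split.
  by rewrite (_ : (fun s => _) = f)//; apply/funext => s; rewrite e.
by rewrite (_ : (fun s => _) = g)//; apply/funext => s; rewrite e.
Qed.

Lemma ccontD K L : ccont K -> ccont L -> ccont (fun s => K s + L s).
Proof.
move=> [rK iK] [rL iL].
apply: (@ccont_eq _ (fun s => complex.Re (K s) + complex.Re (L s))
  (fun s => complex.Im (K s) + complex.Im (L s))) => s.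
- by case: (K s) (L s) => [a b] [c d].
- exact: (cvgD (rK s) (rL s)).
- exact: (cvgD (iK s) (iL s)).
Qed.

Lemma ccontM K L : ccont K -> ccont L -> ccont (fun s => K s * L s).
Proof.
move=> [rK iK] [rL iL].
apply: (@ccont_eq _
  (fun s => complex.Re (K s) * complex.Re (L s) - complex.Im (K s) * complex.Im (L s))
  (fun s => complex.Re (K s) * complex.Im (L s) + complex.Im (K s) * complex.Re (L s))) => s.
- by case: (K s) (L s) => [a b] [c d].
- exact: (cvgB (cvgM (rK s) (rL s)) (cvgM (iK s) (iL s))).
- exact: (cvgD (cvgM (rK s) (iL s)) (cvgM (iK s) (rL s))).
Qed.

Lemma ccontV K : ccont K -> (forall s, K s != 0) -> ccont (fun s => (K s)^-1).
Proof.
move=> [rK iK] K0.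
pose n s := complex.Re (K s) ^+ 2 + complex.Im (K s) ^+ 2.
have n0 s : n s != 0.
  by rewrite /n -sqr_cabs expf_neq0// gt_eqF// cabs_gt0.
have cn : continuous n.
  by move=> s; exact: (cvgD (cvgM (rK s) (rK s)) (cvgM (iK s) (iK s))).
have cnV : continuous (fun s => (n s)^-1) by move=> s; apply: cvgV; [exact: n0|exact: cn].
apply: (@ccont_eq _ (fun s => complex.Re (K s) * (n s)^-1)
  (fun s => - complex.Im (K s) * (n s)^-1)) => s.
- rewrite /n; case: (K s) => a b /=.
  by apply/eqP; rewrite eq_complex/= mulNr !eqxx.
- exact: (cvgM (rK s) (cnV s)).
- exact: (cvgM (cvgN (iK s)) (cnV s)).
Qed.

End complex_continuity.

(** * Comparison of the Lebesgue and Borel sigma-algebras *)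

Section lebesgue_sets.
Context {R : realType}.
Notation mu := (@lebesgue_measure R).

Lemma measurable_LT (A : set R) :
  measurable (A : set (measurableTypeR R)) -> measurable (A : set (LT R)).
Proof. exact: sub_caratheodory. Qed.

Lemma measurable_TT_LT : measurable (TT : set (LT R)).
Proof. exact: measurable_LT measurable_TT. Qed.

Definition idLT (s : LT R) : measurableTypeR R := s.

Lemma measurable_idLT : measurable_fun setT idLT.
Proof. by move=> _ Y mY; rewrite setTI; exact: measurable_LT. Qed.

Lemma lamE (A : set R) : measurable (A : set (measurableTypeR R)) ->
  lam (A : set (LT R)) = mu A.
Proof. by []. Qed.

(** Lebesgue measure on Borel sets is the image of its completion under the identity, so this is a
    change of variables along [idLT]. *)
Lemma ge0_integral_lam (D : set R) (f : R -> \bar R) :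
  measurable (D : set (measurableTypeR R)) ->
  measurable_fun (D : set (measurableTypeR R)) f -> (forall x, D x -> (0 <= f x)%E) ->
  (\int[lam]_(x in (D : set (LT R))) f x = \int[mu]_(x in D) f x)%E.
Proof.
move=> mD mf f0.
have := @ge0_integral_pushforward _ _ (LT R) (measurableTypeR R) R idLT
   measurable_idLT (@completed_lebesgue_measure R) D f mD mf.
move=> /(_ _)/esym e; apply: etrans; first apply: e.
  by move=> y /set_mem Dy; exact: f0.
apply: eq_measure_integral; first exact: measurable_idLT.
by move=> ? A mA AD; exact (lamE mA).
Qed.

Lemma measurable_fun_LT (D : set R) d (T : measurableType d) (f : R -> T) :
  measurable (D : set (measurableTypeR R)) ->
  measurable_fun (D : set (measurableTypeR R)) f ->
  measurable_fun (D : set (LT R)) (f : LT R -> T).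
Proof.
move=> mD mf _ Y mY; by apply: measurable_LT; apply: mf.
Qed.

Lemma integrable_lam (D : set R) (f : R -> R) :
  measurable (D : set (measurableTypeR R)) -> mu.-integrable D (EFin \o f) ->
  lam.-integrable (D : set (LT R)) (EFin \o f) /\
  Rintegral lam (D : set (LT R)) f = Rintegral mu D f.
Proof.
move=> mD /integrableP[mf foo].
have il : lam.-integrable (D : set (LT R)) (EFin \o f).
  apply/integrableP; split; first exact: measurable_fun_LT.
  rewrite (ge0_integral_lam (f := fun x => `|(EFin \o f) x|%E))//.
  exact: measurableT_comp.
split => //; rewrite /Rintegral; congr fine.
rewrite [LHS]integralE [RHS]integralE; congr (_ - _)%E.
  by apply: ge0_integral_lam => //; exact: measurable_funepos.
by apply: ge0_integral_lam => //; exact: measurable_funeneg.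
Qed.

(** Sets measurable for the completion are unions of a Borel set and a part of a Borel null set. *)
Lemma borel_version (E : set R) : measurable (E : set (LT R)) ->
  exists B N : set R, [/\ measurable (B : set (measurableTypeR R)),
    measurable (N : set (measurableTypeR R)), mu N = 0%E, B `<=` E & E `<=` B `|` N].
Proof.
move=> mE.
have : (completed_algebra_gen (@lebesgue_measure R)) E.
  by rewrite -g_sigma_completed_algebra_genE completed_caratheodory_measurable.
move=> [B mB [N [Z [mZ Z0 NZ]]] <-].
exists B, Z; split.
- exact: mB.
- exact: mZ.
- exact: Z0.
- by move=> x Bx; left.
- by move=> x [Bx|/NZ Zx]; [left|right].
Qed.

Lemma ae_lam (P : R -> Prop) :
  {ae mu, forall t, P t} -> {ae lam, forall t : LT R, P t}.
Proof.
move=> [N [mN N0 h]]; exists N; split => //; exact: measurable_LT.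
Qed.

End lebesgue_sets.

(** * The Schwarz integral: polar form and holomorphy *)

Section schwarz_theory.
Context {R : realType}.
Implicit Types (u : R -> R) (z h : R[i]).

Definition thLT (s : LT R) : R := s.

Lemma measurable_thLT : measurable_fun (TT : set (LT R)) thLT.
Proof.
exact: (@measurable_fun_LT R TT _ _ (fun s : R => s) measurable_TT measurable_idTT).
Qed.

Notation Pl u := (kint lam (TT : set (LT R)) thLT kre u).
Notation Ql u := (kint lam (TT : set (LT R)) thLT kim u).
Notation L1l u := (lam.-integrable (TT : set (LT R)) (fun t : LT R => (u t)%:E)).

(** Factoring e^{is} out of numerator and denominator leaves the kernel (1 + w) / (1 - w) at w = r
    e^{i (t - s)}. *)
Lemma schwarz_cpol u (r t : R) : 0 <= r < 1 ->
  schwarz u (cpol r t) = Complex (Pl u r t) (Ql u r t).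
Proof.
move=> r01; have r1 := norm_lt1 r01.
have e s : (expi s + cpol r t) / (expi s - cpol r t) =
   Complex (kre r (t - s)) (kim r (t - s)).
  rewrite -cayley_cpol// /cayley.
  have -> : cpol r t = expi s * cpol r (t - s).
    have e1 : expi s = cpol 1 s by rewrite /cpol !mul1r.
    by rewrite e1 cpolM mul1r addrC subrK.
  have n0 := one_sub_cpol_neq0 (t - s) r1.
  have -> : expi s + expi s * cpol r (t - s) = expi s * (1 + cpol r (t - s)) by ring.
  have -> : expi s - expi s * cpol r (t - s) = expi s * (1 - cpol r (t - s)) by ring.
  by rewrite invfM mulrACA divff ?mul1r// expi_neq0.
rewrite /schwarz /kint; apply: complex_eq; rewrite mulrC; congr (_ * _);
  by apply: eq_Rintegral => s _; rewrite e.
Qed.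

Lemma integrable_ccont (K : R -> R[i]) u (C : R) : ccont K ->
  (forall s, cabs (K s) <= C) -> L1l u ->
  [/\ L1l (fun s => complex.Re (K s) * u s), L1l (fun s => complex.Im (K s) * u s),
    `|Rintegral lam (TT : set (LT R)) (fun s => complex.Re (K s) * u s)| <=
      C * Rintegral lam (TT : set (LT R)) (fun s => `|u s|) &
    `|Rintegral lam (TT : set (LT R)) (fun s => complex.Im (K s) * u s)| <=
      C * Rintegral lam (TT : set (LT R)) (fun s => `|u s|)].
Proof.
move=> [rK iK] KC iu; have mT := @measurable_TT_LT R.
have mr : measurable_fun (TT : set (LT R)) (fun s => complex.Re (K s)).
  exact: (measurable_fun_LT measurable_TT (continuous_measurable_TT rK)).
have mi : measurable_fun (TT : set (LT R)) (fun s => complex.Im (K s)).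
  exact: (measurable_fun_LT measurable_TT (continuous_measurable_TT iK)).
have rC s : (TT : set (LT R)) s -> `|complex.Re (K s)| <= C.
  by move=> _; apply: le_trans (KC s); exact: ler_Re_cabs.
have iC s : (TT : set (LT R)) s -> `|complex.Im (K s)| <= C.
  by move=> _; apply: le_trans (KC s); exact: ler_Im_cabs.
split.
- exact: (integrable_Mbdd mT iu mr rC).
- exact: (integrable_Mbdd mT iu mi iC).
- exact: (le_norm_RintegralM mT iu mr rC).
- exact: (le_norm_RintegralM mT iu mi iC).
Qed.

Lemma cabs_expi_sub z s : 1 - cabs z <= cabs (expi s - z).
Proof. by have := lerB_cabs (expi s) z; rewrite cabs_expi. Qed.

(** The kernel k is rational in z, so its first-order remainder is explicit: 2 e^{is} h^2 / ((e^{is}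
    - z)^2 (e^{is} - z - h)). It is bounded uniformly in s and then integrated against u. *)
Lemma qdiff_schwarz u z : L1l u -> Dsk z -> qdiff (schwarz u) z.
Proof.
move=> iu; rewrite /Dsk/= => z1; have mT := @measurable_TT_LT R.
pose eta := 1 - cabs z; have eta0 : 0 < eta by rewrite subr_gt0.
pose k (w : R[i]) s := (expi s + w) / (expi s - w).
pose k' s := 2 * expi s / (expi s - z) ^+ 2.
have nz (w : R[i]) (e : R) : 0 < e -> e <= 1 - cabs w ->
    forall s, e <= cabs (expi s - w) /\ expi s - w != 0.
  move=> e0 ew s; have h := le_trans ew (cabs_expi_sub w s).
  by split => //; rewrite -cabs_gt0; exact: lt_le_trans h.
have cB (w : R[i]) : ccont (fun s => expi s - w).
  by apply: ccontD; [exact: ccont_expi|exact: ccont_cst].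
have nzz s : expi s - z != 0 by have [] := nz z eta eta0 (lexx _) s.
have ck (w : R[i]) : (forall s, expi s - w != 0) -> ccont (k w).
  move=> w0; apply: ccontM; last exact: ccontV (cB w) w0.
  by apply: ccontD; [exact: ccont_expi|exact: ccont_cst].
have ck' : ccont k'.
  apply: ccontM.
    by apply: ccontM; [exact: ccont_cst|exact: ccont_expi].
  apply: ccontV; last by move=> s; rewrite expf_neq0.
  exact: ccontM (cB z) (cB z).
have bV (w : R[i]) (e : R) : 0 < e -> e <= 1 - cabs w -> forall s,
    cabs (expi s - w)^-1 <= e^-1.
  move=> e0 ew s; have [h1 h2] := nz w e e0 ew s.
  by rewrite cabsV lef_pV2 ?posrE// cabs_gt0.
have c2 : cabs (2 : R[i]) = 2.
  have -> : (2 : R[i]) = Complex 2 0 by rewrite -[2]/(1 + 1) complex1 complexD addr0.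
  by rewrite cabs_real ger0_norm.
have bk (w : R[i]) (e : R) : 0 < e -> e <= 1 - cabs w -> forall s, cabs (k w s) <= 2 / e.
  move=> e0 ew s; rewrite /k cabsM ler_pM ?cabs_ge0 ?bV//.
  by apply: le_trans (ler_cabsD _ _) _; rewrite cabs_expi; lra.
have bk' s : cabs (k' s) <= 2 / eta ^+ 2.
  rewrite /k' cabsM cabsM cabs_expi mulr1 c2 ler_wpM2l// -exprVn expr2 cabsM.
  by rewrite -exprVn expr2 ler_pM ?cabs_ge0 ?bV.
have [irk' iik' _ _] := integrable_ccont ck' bk' iu.
set U := Rintegral lam (TT : set (LT R)) (fun s => `|u s|).
have U0 : 0 <= U by apply: Rintegral_ge0 => s _.
have p2 := @pi2_gt0 R.
exists (Complex (Rintegral lam (TT : set (LT R)) (fun s => complex.Re (k' s) * u s) / (2 * pi))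
  (Rintegral lam (TT : set (LT R)) (fun s => complex.Im (k' s) * u s) / (2 * pi))).
(* For |h| < eta / 2 the three denominators are at least eta, eta and eta / 2, whence 4 / eta^3; the
   leading 2 adds real and imaginary parts. *)
exists (2 * (4 / eta ^+ 3 * U) / (2 * pi)), (eta / 2); split; first by rewrite divr_gt0.
move=> h hh.
have zh : eta / 2 <= 1 - cabs (z + h).
  by have := ler_cabsD z h; rewrite /eta in hh *; lra.
have e20 : 0 < eta / 2 by rewrite divr_gt0.
have nzh s : expi s - (z + h) != 0 by have [] := nz _ _ e20 zh s.
have [irz iiz _ _] := integrable_ccont (ck z nzz) (bk z eta eta0 (lexx _)) iu.
have [irh iih _ _] := integrable_ccont (ck _ nzh) (bk _ _ e20 zh) iu.
pose Rm s := k (z + h) s - k z s - k' s * h.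
have RmE s : Rm s = 2 * expi s * (h * h) *
    ((expi s - z)^-1 * (expi s - z)^-1 * (expi s - (z + h))^-1).
  rewrite /Rm /k /k'; move: (nzz s) (nzh s) => a0 b0.
  by field; rewrite a0 b0.
have cRm : ccont Rm.
  apply: ccontD.
    apply: ccontD; first exact: ck.
    have c1 := ccontM (ccont_cst (-1)) (ck z nzz).
    by move: c1; congr ccont; apply/funext => s; rewrite mulN1r.
  have c1 := ccontM (ccont_cst (- h)) ck'.
  by move: c1; congr ccont; apply/funext => s; rewrite mulNr mulrC.
have bRm s : cabs (Rm s) <= 4 / eta ^+ 3 * cabs h ^+ 2.
  rewrite RmE !cabsM c2 cabs_expi mulr1.
  rewrite (_ : 4 / eta ^+ 3 * cabs h ^+ 2 =
    2 * (cabs h * cabs h) * (eta^-1 * eta^-1 * (eta / 2)^-1)); last first.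
    by field; rewrite gt_eqF.
  rewrite ler_wpM2l ?mulr_ge0 ?cabs_ge0//.
  apply: ler_pM; rewrite ?mulr_ge0 ?cabs_ge0//; last exact: bV.
  by apply: ler_pM; rewrite ?cabs_ge0 ?bV.
have [irR iiR brR biR] := integrable_ccont cRm bRm iu.
have iZ c f : L1l f -> L1l (fun s => c * f s).
  by move=> jf; have := integrableZl mT c jf; apply: eq_integrable.
have iB f g : L1l f -> L1l g -> L1l (fun s => f s - g s).
  by move=> jf jg; have := integrableB mT jf jg; apply: eq_integrable.
have iD f g : L1l f -> L1l g -> L1l (fun s => f s + g s).
  by move=> jf jg; have := integrableD mT jf jg; apply: eq_integrable.
have e1 : schwarz u (z + h) - schwarz u z -
   Complex (Rintegral lam (TT : set (LT R)) (fun s => complex.Re (k' s) * u s) / (2 * pi))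
  (Rintegral lam (TT : set (LT R)) (fun s => complex.Im (k' s) * u s) / (2 * pi)) * h =
   Complex (Rintegral lam (TT : set (LT R)) (fun s => complex.Re (Rm s) * u s) / (2 * pi))
     (Rintegral lam (TT : set (LT R)) (fun s => complex.Im (Rm s) * u s) / (2 * pi)).
  rewrite /schwarz -/(k z) -/(k (z + h)).
  case: h @Rm {hh zh RmE cRm bRm irR iiR brR biR nzh} irh iih => h1 h2 Rm irh iih.
  rewrite complexM !complexB.
  have RmRe s : complex.Re (Rm s) = complex.Re (k (z + Complex h1 h2) s)
     - complex.Re (k z s) - (h1 * complex.Re (k' s) - h2 * complex.Im (k' s)).
    rewrite /Rm; case: (k (z + _) s) (k z s) (k' s) => [? ?] [? ?] [? ?].
    by rewrite complexM !complexB /=; ring.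
  have RmIm s : complex.Im (Rm s) = complex.Im (k (z + Complex h1 h2) s)
     - complex.Im (k z s) - (h2 * complex.Re (k' s) + h1 * complex.Im (k' s)).
    rewrite /Rm; case: (k (z + _) s) (k z s) (k' s) => [? ?] [? ?] [? ?].
    by rewrite complexM !complexB /=; ring.
  apply: complex_eq.
  - have -> : Rintegral lam (TT : set (LT R)) (fun s => complex.Re (Rm s) * u s) =
      Rintegral lam (TT : set (LT R)) (fun s =>
        (complex.Re (k (z + Complex h1 h2) s) * u s - complex.Re (k z s) * u s) -
        (h1 * (complex.Re (k' s) * u s) - h2 * (complex.Im (k' s) * u s))).
      by apply: eq_Rintegral => s _; rewrite RmRe; ring.
    rewrite (RintegralB mT (iB _ _ irh irz) (iB _ _ (iZ h1 _ irk') (iZ h2 _ iik'))).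
    rewrite (RintegralB mT irh irz) (RintegralB mT (iZ h1 _ irk') (iZ h2 _ iik')).
    rewrite (RintegralZl _ mT irk') (RintegralZl _ mT iik').
    do ?[move: (Rintegral _ _ _) => ?]; move: p2; clear; move: (2 * pi) => p p0.
    by field; rewrite gt_eqF.
  - have -> : Rintegral lam (TT : set (LT R)) (fun s => complex.Im (Rm s) * u s) =
      Rintegral lam (TT : set (LT R)) (fun s =>
        (complex.Im (k (z + Complex h1 h2) s) * u s - complex.Im (k z s) * u s) -
        (h2 * (complex.Re (k' s) * u s) + h1 * (complex.Im (k' s) * u s))).
      by apply: eq_Rintegral => s _; rewrite RmIm; ring.
    rewrite (RintegralB mT (iB _ _ iih iiz) (iD _ _ (iZ h2 _ irk') (iZ h1 _ iik'))).
    rewrite (RintegralB mT iih iiz) (RintegralD mT (iZ h2 _ irk') (iZ h1 _ iik')).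
    rewrite (RintegralZl _ mT irk') (RintegralZl _ mT iik').
    do ?[move: (Rintegral _ _ _) => ?]; move: p2; clear; move: (2 * pi) => p p0.
    by field; rewrite gt_eqF.
rewrite e1; apply: le_trans (ler_cabs_ReIm _) _ => /=.
have pn : `|(2 * pi)^-1| = (2 * pi)^-1 :> R by rewrite ger0_norm// invr_ge0 ltW.
rewrite !normrM pn -mulrDl [leRHS]mulrAC ler_pM2r ?invr_gt0//.
apply: le_trans (lerD brR biR) _; rewrite -/U.
by rewrite le_eqVlt; apply/orP; left; apply/eqP; ring.
Qed.

End schwarz_theory.

(** * Bounds for the exponential, and compact subsets of the disk *)

Section complex_exponential_bounds.
Context {R : realType}.
Implicit Types (z w : R[i]).

(** For |w| <= 1 / 2 the Taylor estimate gives |w| + 10 |w|^2 <= 6 |w|; otherwise 1 <= 2 |w| absorbs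
    the crude bound 1 + e^W. *)
Lemma cexp_sub1 w (W : R) : cabs w <= W ->
  cabs (1 - cexp w) <= (6 + 2 * (expR W + 1)) * cabs w.
Proof.
move=> wW; have w0 := cabs_ge0 w; have eW := expR_gt0 W.
have [h|h] := lerP (cabs w) 2^-1.
  have q := cexp_quad h.
  have -> : 1 - cexp w = - ((cexp w - 1 - w) + w) by ring.
  rewrite cabsN; apply: le_trans (ler_cabsD _ _) _.
  have : 10 * cabs w ^+ 2 <= 5 * cabs w.
    by rewrite expr2 mulrA; nra.
  have : 0 <= 2 * (expR W + 1) * cabs w by rewrite !mulr_ge0//; lra.
  lra.
apply: le_trans (ler_cabsB _ _) _; rewrite cabs1 cabs_cexp.
have : expR (complex.Re w) <= expR W.
  by rewrite ler_expR (le_trans _ wW)// (le_trans (ler_norm _))// ler_Re_cabs.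
have : (expR W + 1) * 1 <= (expR W + 1) * (2 * cabs w) by rewrite ler_wpM2l//; lra.
lra.
Qed.

Lemma cexp_close (x y eps : R) : 0 < eps -> exists2 d : R, 0 < d &
  forall a b : R, `|a - x| < d -> `|b - y| < d ->
  cabs (cexp (Complex a b) - cexp (Complex x y)) < eps.
Proof.
move=> e0.
pose K := cabs (cexp (Complex x y)) * (6 + 2 * (expR 1 + 1)) + 1.
have e1 := expR_gt0 (1 : R).
have K0 : 0 < K by rewrite ltr_wpDl// mulr_ge0 ?cabs_ge0//; lra.
pose d := Num.min 2^-1 (eps / (2 * K)).
have d0 : 0 < d by rewrite lt_min invr_gt0 ltr0n/= divr_gt0// mulr_gt0.
exists d => // a b h1 h2.
pose w := Complex (a - x) (b - y).
have wd : cabs w < 2 * d.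
  by apply: le_lt_trans (ler_cabs_ReIm _) _; rewrite /= mulr_natl mulr2n ltrD.
have wd1 : cabs w <= 1.
  apply: ltW; apply: lt_le_trans wd _.
  have : d <= 2^-1 by rewrite ge_min lexx.
  lra.
have -> : Complex (a) (b) = Complex x y + w.
  by rewrite complexD; apply: complex_eq; ring.
rewrite cexpD -[X in _ - X]mulr1 -mulrBr cabsM -[cexp w - 1]opprB cabsN.
have h := cexp_sub1 wd1.
apply: le_lt_trans (ler_wpM2l (cabs_ge0 _) h) _.
rewrite mulrA.
apply: (@le_lt_trans _ _ (K * cabs w)).
  by rewrite ler_wpM2r ?cabs_ge0// /K lerDl.
have dK : 2 * d <= eps / K.
  have : d <= eps / (2 * K) by rewrite ge_min lexx orbT.
  have -> : eps / (2 * K) = eps / K / 2 by field; rewrite gt_eqF.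
  lra.
rewrite mulrC -ltr_pdivlMr//; exact: lt_le_trans dK.
Qed.

Lemma cexp_cvg (a b : nat -> R) (x y : R) :
  a n @[n --> \oo] --> x -> b n @[n --> \oo] --> y ->
  forall eps : R, 0 < eps -> exists N, forall n, (N <= n)%N ->
  cabs (cexp (Complex (a n) (b n)) - cexp (Complex x y)) < eps.
Proof.
move=> ax by_ eps /(cexp_close x y)[d d0 hd].
have /cvgrPdist_lt/(_ _ d0)[N1 _ h1] := ax.
have /cvgrPdist_lt/(_ _ d0)[N2 _ h2] := by_.
exists (maxn N1 N2) => n; rewrite geq_max => /andP[n1 n2].
by apply: hd; rewrite distrC; [exact: h1|exact: h2].
Qed.

(** The modulus attains its supremum on a nonempty compact set, and there it is below 1. *)
Lemma compact_disk (K : set (R[i])^o) : compact K -> K `<=` Dsk ->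
  exists2 rho : R, 0 <= rho < 1 & forall z, K z -> cabs z <= rho.
Proof.
move=> cK KD.
have [->|/set0P[z0 Kz0]] := eqVneq K set0.
  by exists 0; [rewrite lexx ltr01|].
pose f : (R[i])^o -> R := cabs.
have cf : continuous f.
  move=> z; have FF : Filter (nbhs (z : (R[i])^o)) by exact: nbhs_filter.
  apply/(@cvgrPdist_lt _ _ _ _ FF) => eps e0.
  have e0' : 0 < (eps%:C)%C :> R[i] by rewrite ltcR.
  apply/(@nbhs_ballP _ (R[i])^o); exists (eps%:C)%C => //= y.
  rewrite -ball_normE /= normc_def ltcR => h.
  have h' : cabs (z - y) < eps by exact: h.
  apply: le_lt_trans h'; rewrite ler_norml lerB_cabs andbT.
  by rewrite lerNl opprB -[z - y]opprB cabsN lerB_cabs.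
have cC : compact (f @` K).
  by apply: continuous_compact => //; exact: continuous_subspaceT.
have ne : f @` K !=set0 by exists (f z0), z0.
have ub : has_ubound (f @` K) by exists 1 => _ [z Kz <-]; apply/ltW/KD.
have clC : closed (f @` K) by apply: compact_closed => //; exact: Rhausdorff.
have : (f @` K) (sup (f @` K)).
  by rewrite [X in X _](closure_id _).1//; exact: closure_sup.
move=> [z Kz fz]; exists (sup (f @` K)).
  rewrite -fz; apply/andP; split; [exact: cabs_ge0|exact: KD].
by move=> y Ky; apply: ub_le_sup => //; exists y.
Qed.

End complex_exponential_bounds.

(** * Uniform convergence of the series of |1 - w_n| *)

Section series_of_moduli.
Context {R : realType}.

(** The Weierstrass test: on a compact set the tails are bounded by C times the tails of the
    convergent series of the [d n]. *)
Lemma prod_abs_loc_unif_dominated (w : nat -> R[i] -> R[i]) (d : nat -> R) (D : R) :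
  (forall n, 0 <= d n) -> (forall n, \sum_(k < n) d k <= D) ->
  (forall rho : R, 0 <= rho < 1 -> exists C : R, forall n z, cabs z <= rho ->
     cabs (1 - w n z) <= C * d n) ->
  prod_abs_loc_unif w.
Proof.
move=> d0 dD hw K cK KD; have [rho rho01 Krho] := compact_disk cK KD.
have [C0 hC0] := hw _ rho01.
pose C := `|C0| + 1.
have C1 : 0 < C by rewrite ltr_wpDl.
have hC n z : K z -> cabs (1 - w n z) <= C * d n.
  move=> Kz; apply: le_trans (hC0 n z (Krho z Kz)) _.
  by rewrite ler_wpM2r// /C (le_trans (ler_norm _))// lerDl.
pose s n := \sum_(k < n) d k.
have nds : {homo s : n m / (n <= m)%N >-> n <= m}.
  move=> n m nm; rewrite /s -!(big_mkord xpredT) (big_cat_nat (leq0n n) nm)//= lerDl.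
  by apply: sumr_ge0.
have cs : cvgn s.
  by apply: nondecreasing_is_cvgn => //; exists D => _ [n _ <-]; exact: dD.
pose S z := lim ((\sum_(k < n) cabs (1 - w k z)) @[n --> \oo]).
exists S => eps e0.
have e1 : 0 < eps / (2 * C) by rewrite divr_gt0// mulr_gt0.
have /cvgrPdist_lt/(_ _ e1)[N _ hN] := cs.
exists N => M NM z Kz.
pose a n := \sum_(k < n) cabs (1 - w k z).
have tail n m : (n <= m)%N -> a n <= a m <= a n + C * (s m - s n).
  move=> nm; rewrite /a /s -!(big_mkord xpredT (fun k => cabs (1 - w k z))) -!(big_mkord xpredT d).
  rewrite !(big_cat_nat (leq0n n) nm)//= lerDl lerD2l [X in C * X]addrC addKr.
  rewrite mulr_sumr; apply/andP; split; first by apply: sumr_ge0 => k _; exact: cabs_ge0.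
  by apply: ler_sum => k _; exact: hC.
have sl n : s n <= lim (s m @[m --> \oo]) by apply: nondecreasing_cvgn_le.
have aub n : (M <= n)%N -> a n <= a M + C * (lim (s m @[m --> \oo]) - s M).
  move=> Mn; have /andP[_ h] := tail M n Mn; apply: le_trans h _.
  by rewrite lerD2l ler_wpM2l ?(ltW C1)// lerD2r.
have nda : {homo a : n m / (n <= m)%N >-> n <= m}.
  by move=> n m nm; have /andP[] := tail n m nm.
have ca : cvgn a.
  apply: nondecreasing_is_cvgn => //.
  exists (a M + C * (lim (s m @[m --> \oo]) - s M)) => _ [n _ <-].
  have [Mn|nM] := leqP M n; first exact: aub.
  by apply: le_trans (nda _ _ (ltnW nM)) _; exact: aub.
have l1 : a M <= S z by apply: nondecreasing_cvgn_le.
have l2 : S z <= a M + C * (lim (s m @[m --> \oo]) - s M).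
  by apply: limr_le => //; exists M => // n; exact: aub.
have := hN M NM; rewrite /= ger0_norm ?subr_ge0// => l3.
rewrite distrC ger0_norm ?subr_ge0//.
have : C * (lim (s m @[m --> \oo]) - s M) < C * (eps / (2 * C)) by rewrite ltr_pM2l.
have -> : C * (eps / (2 * C)) = eps / 2 by field; rewrite gt_eqF.
rewrite -/(a M) => l4.
by rewrite ltrBlDl; apply: le_lt_trans l2 _; rewrite ltrD2l; apply: lt_trans l4 _; lra.
Qed.

(** Uniform convergence is used on the compact set consisting of 0 alone; partial sums increase, so
    a bound past the index N bounds all of them. *)
Lemma prod_abs_loc_unif_bounded (w : nat -> R[i] -> R[i]) :
  prod_abs_loc_unif w -> exists D : R, forall n, \sum_(k < n) cabs (1 - w k 0) <= D.
Proof.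
move=> /(_ [set 0] _ _)[].
- exact: compact_set1.
- by move=> _ ->; rewrite /Dsk/= cabs0 ltr01.
move=> S /(_ 1 ltr01)[N hN]; exists (S 0 + 1) => n.
have := hN (maxn n N) (leq_maxr _ _) 0 erefl; rewrite ltr_norml => /andP[_ h].
apply: (@le_trans _ _ (\sum_(k < maxn n N) cabs (1 - w k 0))); last lra.
rewrite -!(big_mkord xpredT (fun k => cabs (1 - w k 0))).
rewrite [leRHS](big_cat_nat (leq0n n) (leq_maxl n N))//= lerDl.
by apply: sumr_ge0 => k _; exact: cabs_ge0.
Qed.

End series_of_moduli.

(** * Comparison of [phi] with x log^+ x *)

Section LlogL_phi_comparison.
Context {R : realType}.
Notation mu := (@lebesgue_measure R).
Notation L1 u := (mu.-integrable TT (EFin \o u)).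
Implicit Types (v : R -> R) (x : R).

Definition ll x : R := x * Num.max 0 (ln x).

Lemma ll_ge0 x : 0 <= x -> 0 <= ll x.
Proof. by move=> x0; rewrite mulr_ge0// le_max lexx. Qed.

Lemma ll_le_phi x : 0 <= x -> ll x <= phi x.
Proof.
move=> x0; rewrite /ll /phi ler_pM//; [by rewrite le_max lexx|lra|].
rewrite ge_max ln_ge0/=; last lra.
have [->|xn] := eqVneq x 0; first by rewrite ln0// addr0 ln1.
by rewrite ler_ln ?posrE; have := lt_neqAle 0 x; rewrite eq_sym xn x0; lra.
Qed.

(** Scaling costs only a constant: ln (1 + la x) <= ln (1 + la) + ln (1 + x), and ln (1 + x) <= ln 2
    + log^+ x. This makes all multiples of a function in L log L available. *)
Lemma phi_le_ll (la : R) : 0 < la ->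
  exists2 C : R, 0 <= C & forall x, 0 <= x -> phi (la * x) <= C * (1 + x + ll x).
Proof.
move=> la0.
pose c : R := ln (1 + la) + ln 2 + 1.
have l1 : 0 <= ln (1 + la) by rewrite ln_ge0//; lra.
have l2 : 0 <= ln 2 :> R by rewrite ln_ge0//; lra.
have c1 : 1 <= c by rewrite /c; lra.
exists (2 * (1 + la) * c) => [|x x0]; first by rewrite !mulr_ge0//; lra.
set m := Num.max 0 (ln x).
have m0 : 0 <= m by rewrite le_max lexx.
have h1 : ln (1 + x) <= ln 2 + m.
  have [x1|x1] := lerP x 1.
    by apply: ler_wpDr => //; rewrite ler_ln ?posrE; lra.
  apply: (@le_trans _ _ (ln (2 * x))).
    by rewrite ler_ln ?posrE; lra.
  have x0' : 0 < x by lra.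
  by rewrite lnM ?posrE// lerD2l le_max lexx orbT.
have mx : m <= x.
  rewrite ge_max x0/=; have [->|xn] := eqVneq x 0; first by rewrite ln0.
  by rewrite ltW// ln_sublinear// lt_neqAle eq_sym xn.
have h2 : ln (1 + la * x) <= c + m.
  apply: (@le_trans _ _ (ln ((1 + la) * (1 + x)))).
    have : 0 <= la * x by rewrite mulr_ge0// ltW.
    by move=> lx; rewrite ler_ln ?posrE; nra.
  have a1 : 0 < 1 + la by lra.
  have a2 : 0 < 1 + x by lra.
  by rewrite lnM ?posrE// /c; lra.
have h0 : 0 <= ln (1 + la * x) by rewrite ln_ge0// lerDl mulr_ge0// ltW.
have h3 : 1 + la * x <= (1 + la) * (1 + x).
  have : 0 <= la * x by rewrite mulr_ge0// ltW.
  nra.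
rewrite /phi; apply: (@le_trans _ _ ((1 + la) * (1 + x) * (c + m))).
  have lx : 0 <= la * x by rewrite mulr_ge0// ltW.
  have l1x : 0 <= 1 + la * x by lra.
  exact: ler_pM.
rewrite -!mulrA [2 * _]mulrCA ler_wpM2l//; first lra.
rewrite /ll -/m.
have xm : 0 <= x * m by rewrite mulr_ge0.
have : 0 <= (c - 1) * (x * m) by rewrite mulr_ge0//; lra.
have : 0 <= (c - 1) * m by rewrite mulr_ge0//; lra.
have : 0 <= c * x by rewrite mulr_ge0//; lra.
nra.
Qed.

Lemma measurable_phi (D : set (measurableTypeR R)) v :
  measurable_fun D v -> measurable_fun D (fun t => phi (v t)).
Proof.
move=> mv; apply: measurable_funM.
  by apply: measurable_funD => //; exact: measurable_cst.
apply: (measurableT_comp (@measurable_ln R)).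
by apply: measurable_funD => //; exact: measurable_cst.
Qed.

Lemma measurable_ll (D : set (measurableTypeR R)) v :
  measurable_fun D v -> measurable_fun D (fun t => ll (v t)).
Proof.
move=> mv; apply: measurable_funM => //.
apply: measurable_maxr; first exact: measurable_cst.
exact: (measurableT_comp (@measurable_ln R)).
Qed.

Lemma L1_phi_of_ll v : L1 v -> (forall t, 0 <= v t) -> L1 (fun t => ll (v t)) ->
  forall la : R, 0 < la -> L1 (fun t => phi (la * v t)).
Proof.
move=> iv v0 il la la0; have mT := @measurable_TT R.
have [C C0 hC] := phi_le_ll la0.
have i1 : L1 (fun t => 1 + v t).
  by have := integrableD mT (integrable_cst_TT 1) iv; apply: eq_integrable.
have i2 : L1 (fun t => 1 + v t + ll (v t)).
  by have := integrableD mT i1 il; apply: eq_integrable.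
have i3 : L1 (fun t => C * (1 + v t + ll (v t))).
  by have := integrableZl mT C i2; apply: eq_integrable.
have mv := measurable_L1 iv.
apply: le_integrable i3 => //.
  apply/measurable_EFinP; apply: (measurable_phi (v := fun t => la * v t)).
  by apply: measurable_funM => //; exact: measurable_cst.
move=> t _; rewrite /= lee_fin ger0_norm ?phi_ge0 ?mulr_ge0 ?(ltW la0)//.
by apply: le_trans (hC _ (v0 t)) _; exact: ler_norm.
Qed.

End LlogL_phi_comparison.

(** * The series of indicators and the equivalence of (a) and (b) *)

Section indicator_series.
Context {R : realType}.
Implicit Types (E : nat -> set R).

Lemma gt0_mule_lt_pinfty (c : R) (x : \bar R) : 0 < c -> (0 <= x)%E ->
  (c%:E * x < +oo)%E = (x < +oo)%E.
Proof.
move=> c0; case: x => [r _|_|//]; first by rewrite -EFinM !ltry.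
by rewrite gt0_muley ?lte_fin.
Qed.

Lemma lam_ge0 (A : set R) : (0 <= lam (A : set (LT R)))%E.
Proof. exact: measure_ge0. Qed.

Lemma indic_ge0 (A : set R) t : 0 <= (\1_A t : R).
Proof. by rewrite indicE ler0n. Qed.

Lemma sum_mT E : ((\sum_(0 <= n <oo) mT (E n) < +oo) =
  (\sum_(0 <= n <oo) lam (E n : set (LT R)) < +oo))%E.
Proof.
have c0 : 0 < (2 * pi)^-1 :> R by rewrite invr_gt0 pi2_gt0.
have -> : (\sum_(0 <= n <oo) mT (E n) =
    ((2 * pi)^-1)%:E * \sum_(0 <= n <oo) lam (E n : set (LT R)))%E.
  rewrite -nneseriesZl; last by move=> n _; exact: lam_ge0.
  by apply: eq_eseriesr => n _; rewrite /mT muleC.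
rewrite gt0_mule_lt_pinfty//.
by apply: nneseries_ge0 => n _ _; exact: lam_ge0.
Qed.

Lemma vfun_ge0 E t : (0 <= vfun E t)%E.
Proof.
rewrite mule_ge0 ?lee_fin ?pi_ge0//.
by apply: nneseries_ge0 => n _ _; rewrite lee_fin indic_ge0.
Qed.

Lemma measurable_indic_series E (D : set (LT R)) :
  (forall n, measurable (E n : set (LT R))) ->
  measurable_fun D (fun t : LT R => (\sum_(0 <= n <oo) (\1_(E n) t : R)%:E)%E).
Proof.
move=> mE; apply: (@ge0_emeasurable_sum _ (LT R) R D
  (fun n t => (\1_(E n) t : R)%:E) xpredT) => [n t _ _|n _].
  by rewrite lee_fin indic_ge0.
by apply/measurable_EFinP; apply: measurable_indic; exact: mE.
Qed.

Lemma measurable_vfun E (D : set (LT R)) :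
  (forall n, measurable (E n : set (LT R))) -> measurable_fun D (vfun E : LT R -> \bar R).
Proof. by move=> mE; apply: measurable_funeM; exact: measurable_indic_series. Qed.

(** Termwise integration of a nonnegative series: the integral of v over the period is pi times the
    sum of the measures of the E_n. *)
Lemma L1T_vfun E : (forall n, measurable (E n : set (LT R))) ->
  (forall n, E n `<=` TT) ->
  L1T (vfun E) <-> (\sum_(0 <= n <oo) lam (E n : set (LT R)) < +oo)%E.
Proof.
move=> mE ET.
have mT := @measurable_TT_LT R.
have S0 : (0 <= \sum_(0 <= n <oo) lam (E n : set (LT R)))%E.
  by apply: nneseries_ge0 => n _ _; exact: lam_ge0.
have -> : L1T (vfun E) <-> (intT (fun t => `|vfun E t|) < +oo)%E.
  by split=> [[]//|h]; split => //; exact: measurable_vfun.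
have -> : (intT (fun t => `|vfun E t|) =
    ((2 * pi)^-1)%:E * (pi%:E * \sum_(0 <= n <oo) lam (E n : set (LT R))))%E.
  rewrite /intT muleC; congr (_ * _)%E.
  transitivity (\int[lam]_(t in (TT : set (LT R)))
      (pi%:E * \sum_(0 <= n <oo) (\1_(E n) t : R)%:E))%E.
    by apply: eq_integral => t _; rewrite gee0_abs ?vfun_ge0.
  rewrite ge0_integralZl; last 4 first.
  - exact: mT.
  - exact: measurable_indic_series.
  - by move=> t _; apply: nneseries_ge0 => n _ _; rewrite lee_fin indic_ge0.
  - by rewrite lee_fin pi_ge0.
  rewrite integral_nneseries; last 3 first.
  - exact: mT.
  - by move=> n; apply/measurable_EFinP; apply: measurable_indic; exact: mE.
  - by move=> n t _; rewrite lee_fin indic_ge0.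
  apply: (congr1 (mule pi%:E)); apply: eq_eseriesr => n _.
  by rewrite integral_indic//; congr lam; apply/setIidPl; exact: ET.
by rewrite !gt0_mule_lt_pinfty// ?invr_gt0 ?pi2_gt0 ?pi_gt0// mule_ge0// lee_fin pi_ge0.
Qed.

Lemma nneseries_lt_pinftyP (a : nat -> \bar R) :
  (forall n, 0 <= a n)%E -> (forall n, a n \is a fin_num) ->
  (\sum_(0 <= n <oo) a n < +oo)%E <->
  exists D : R, forall n, \sum_(k < n) fine (a k) <= D.
Proof.
move=> a0 af.
have sE n : (\sum_(0 <= k < n) a k)%E = (\sum_(k < n) fine (a k))%:E.
  by rewrite big_mkord -sumEFin; apply: eq_bigr => k _; rewrite fineK.
split=> [h|[D hD]].
  have f : (\sum_(0 <= n <oo) a n)%E \is a fin_num.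
    by rewrite ge0_fin_numE//; apply: nneseries_ge0.
  exists (fine (\sum_(0 <= n <oo) a n)%E) => n.
  by rewrite -lee_fin -sE fineK//; apply: nneseries_lim_ge.
apply: (@le_lt_trans _ _ D%:E); last exact: ltry.
apply: lime_le; first exact: is_cvg_nneseries.
by apply: nearW => n; rewrite sE lee_fin.
Qed.

End indicator_series.

(** * Replacement of sets by Borel versions, and two-sided bounds for 1 - f_E *)

Section borel_versions.
Context {R : realType}.
Notation mu := (@lebesgue_measure R).
Notation L1 u := (mu.-integrable TT (EFin \o u)).
Implicit Types (A B : set R) (u v : R -> R) (r t : R).

Lemma indic_borel A : measurable (A : set (LT R)) -> exists B : set R,
  [/\ measurable (B : set (measurableTypeR R)), B `<=` A &
  {ae lam, forall t : LT R, (\1_A t : R) = \1_B t}].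
Proof.
move=> /borel_version[B [N [mB mN N0 BA ABN]]]; exists B; split => //.
exists (N : set (LT R)); split; first exact: measurable_LT.
  by rewrite -N0; exact: lamE.
move=> t /= h; apply: contrapT => Nt; apply: h.
rewrite !indicE; congr ((nat_of_bool _)%:R).
apply/idP/idP; rewrite !inE; last exact: BA.
by move=> /ABN[].
Qed.

Lemma kint_lam (k : R -> R -> R) u v r t (C : R) :
  continuous (k r) -> (forall x, `|k r x| <= C) ->
  measurable_fun (TT : set (LT R)) (u : LT R -> R) -> L1 v ->
  {ae lam, forall s : LT R, u s = v s} ->
  kint lam (TT : set (LT R)) thLT k u r t = kint mu TT (fun s : R => s) k v r t.
Proof.
move=> ck bk mu_ iv uv.
have mT := @measurable_TT R.
have ikv := integrable_kint mT (@measurable_idTT R) t ck bk iv.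
have mv := measurable_L1 iv.
rewrite /kint; congr (_ * _); have [_ <-] := integrable_lam mT ikv.
rewrite /Rintegral; congr fine; apply: ae_eq_integral.
- exact: measurable_TT_LT.
- apply/measurable_EFinP; apply: measurable_funM; last exact: mu_.
  exact: (measurable_kshift (@measurable_thLT R) t ck).
- apply/measurable_EFinP; apply: measurable_funM.
    exact: (measurable_kshift (@measurable_thLT R) t ck).
  exact: measurable_fun_LT.
- apply: (@filterS _ _ (ae_filter_ringOfSetsType lam) _ _ _ uv) => s us _.
  by rewrite /= us.
Qed.

Lemma L1_indic B : measurable (B : set (measurableTypeR R)) -> L1 (\1_B : R -> R).
Proof.
move=> mB; apply: (@integrable_bdd R (\1_B) 1).
  by apply: measurable_indic.
by move=> t _; rewrite indicE ger0_norm; case: (_ \in _).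
Qed.

Lemma Rintegral_indic B : measurable (B : set (measurableTypeR R)) -> B `<=` TT ->
  Rintegral mu TT (\1_B : R -> R) = fine (mu B).
Proof.
move=> mB BT; rewrite /Rintegral; congr fine.
rewrite (integral_indic mu (@measurable_TT R))//; congr mu.
exact/setIidPl.
Qed.

Lemma mu_fin_num B : measurable (B : set (measurableTypeR R)) -> B `<=` TT ->
  mu B \is a fin_num.
Proof.
move=> mB BT; rewrite ge0_fin_numE; last exact: measure_ge0.
apply: le_lt_trans (_ : (mu TT < +oo)%E); last by rewrite mu_TT ltry.
by apply: le_measure; rewrite ?inE//; exact: measurable_TT.
Qed.

Lemma mu_le_2pi B : measurable (B : set (measurableTypeR R)) -> B `<=` TT ->
  fine (mu B) <= 2 * pi.
Proof.
move=> mB BT; rewrite -lee_fin fineK ?mu_fin_num// -mu_TT.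
by apply: le_measure; rewrite ?inE//; exact: measurable_TT.
Qed.

(** The exponent is i pi (P + i Q), with P and Q the Poisson and conjugate integrals of the
    indicator of the Borel version. *)
Lemma fE_cpol A B r t : measurable (A : set (LT R)) ->
  measurable (B : set (measurableTypeR R)) ->
  {ae lam, forall t : LT R, (\1_A t : R) = \1_B t} -> 0 <= r < 1 ->
  fE A (cpol r t) = cexp (Complex (- (pi * QI \1_B r t)) (pi * PI \1_B r t)).
Proof.
move=> mA mB AB r01; have r1 := norm_lt1 r01.
have mA1 : measurable_fun (TT : set (LT R)) (\1_A : LT R -> R) by exact: measurable_indic.
have iB := L1_indic mB.
rewrite /fE schwarz_cpol// complexM; congr cexp; apply: complex_eq.
  rewrite mul0r sub0r; congr (- (_ * _)).
  apply: (kint_lam t (continuous_kim r1) _ mA1 iB AB) => x.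
  by have := kim_ub x (lexx `|r|) r1; apply.
rewrite mul0r add0r; congr (_ * _).
apply: (kint_lam t (continuous_kre r1) _ mA1 iB AB) => x.
by have := kre_ub x (lexx `|r|) r1; apply.
Qed.

Lemma kint_indic_le (k : R -> R -> R) B r t (C : R) :
  (forall x, `|k r x| <= C) -> continuous (k r) ->
  measurable (B : set (measurableTypeR R)) ->
  `|kint mu TT (fun s : R => s) k \1_B r t| <=
    (2 * pi)^-1 * (C * Rintegral mu TT (\1_B : R -> R)).
Proof.
move=> bk ck mB; have iB := L1_indic mB; have p0 := @pi2_gt0 R.
rewrite /kint normrM [`|_^-1|]ger0_norm ?invr_ge0 ?(ltW p0)//.
rewrite ler_wpM2l ?invr_ge0 ?(ltW p0)//.
have -> : Rintegral mu TT (\1_B : R -> R) = Rintegral mu TT (fun s => `|(\1_B s : R)|).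
  by apply: eq_Rintegral => s _; rewrite ger0_norm// indic_ge0.
apply: le_norm_RintegralM => //; first exact: measurable_TT.
exact: (measurable_kshift (@measurable_idTT R) t ck).
Qed.

(** On |z| <= rho both kernels are at most K = 2 / (1 - rho)^2, so the exponent of f_E has modulus
    at most K times the measure of B, hence at most 2 pi K. [cexp_sub1] then gives a constant
    depending on rho alone. *)
Lemma one_sub_fE_le (rho : R) : 0 <= rho < 1 -> exists C : R,
  forall A B z, measurable (A : set (LT R)) ->
  measurable (B : set (measurableTypeR R)) -> B `<=` TT ->
  {ae lam, forall t : LT R, (\1_A t : R) = \1_B t} -> cabs z <= rho ->
  cabs (1 - fE A z) <= C * fine (mu B).
Proof.
move=> /andP[rho0 rho1].
pose K := 2 / (1 - rho) ^+ 2 : R.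
have K0 : 0 <= K by rewrite divr_ge0// exprn_ge0//; lra.
exists ((6 + 2 * (expR (2 * (pi * K)) + 1)) * K) => A B z mA mB BT AB zr.
have [t zE] := polar z.
have z0 := cabs_ge0 z.
have r01 : 0 <= cabs z < 1 by rewrite z0/=; exact: le_lt_trans rho1.
have r1 := norm_lt1 r01.
have nz : `|cabs z| <= rho by rewrite ger0_norm.
have p0 := @pi_gt0 R.
have iE := Rintegral_indic mB BT.
have m0 : 0 <= fine (mu B) by rewrite fine_ge0// measure_ge0.
have m1 := mu_le_2pi mB BT.
have hP := kint_indic_le t (fun x => kre_ub x nz rho1) (continuous_kre r1) mB.
have hQ := kint_indic_le t (fun x => kim_ub x nz rho1) (continuous_kim r1) mB.
rewrite iE -/K in hP hQ.
rewrite [in fE _ _]zE (fE_cpol t mA mB AB r01).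
set w := Complex _ _.
have hw : cabs w <= K * fine (mu B).
  apply: le_trans (ler_cabs_ReIm _) _; rewrite /w /= normrN !(normrM pi) (ger0_norm (ltW p0)).
  apply: (@le_trans _ _ (pi * ((2 * pi)^-1 * (K * fine (mu B)) + (2 * pi)^-1 * (K * fine (mu B))))).
    by rewrite -mulrDr ler_pM2l//; exact: lerD hQ hP.
  rewrite le_eqVlt; apply/orP; left; apply/eqP.
  by have := lt0r_neq0 p0; move: (pi : R) => p pn0; field.
have hW : cabs w <= 2 * (pi * K).
  apply: le_trans hw _; rewrite mulrA mulrC ler_wpM2r//.
apply: le_trans (cexp_sub1 hW) _.
by rewrite -[leRHS]mulrA ler_wpM2l.
Qed.

(** The square of |1 - e^{ix}| is 2 (1 - cos x), and 1 - cos x is at least a multiple of x^2 up to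
    |x| = pi. *)
Lemma one_sub_cexp_ge : exists2 c : R, 0 < c & forall x : R, 0 <= x <= pi ->
  c * x <= cabs (1 - cexp (Complex 0 x)).
Proof.
have p0 := @pi_gt0 R.
have [|c c0 hc] := @one_sub_cos_ge R pi; first by rewrite lexx/=; lra.
exists (Num.sqrt (2 * c)); first by rewrite sqrtr_gt0 mulr_gt0.
move=> x /andP[x0 xp].
have sx : Num.sqrt (2 * c) * x = Num.sqrt (2 * c * x ^+ 2).
  by rewrite (@sqrtrM _ (2 * c)) ?mulr_ge0 ?(ltW c0)// sqrtr_sqr ger0_norm.
rewrite sx /cabs /cexp complex1 complexB /= expR0 !mul1r sub0r sqrrN ler_wsqrtr//.
have h := hc x; rewrite ger0_norm// in h; have := h xp.
have := cos2Dsin2 x; nra.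
Qed.

(** At the origin f_E is exp (i mu(B) / 2). As mu(B) is at most 2 pi, the angle stays in [0, pi] and
    cannot wrap back towards 0. *)
Lemma one_sub_fE0_ge : exists2 c : R, 0 < c & forall A B,
  measurable (A : set (LT R)) ->
  measurable (B : set (measurableTypeR R)) -> B `<=` TT ->
  {ae lam, forall t : LT R, (\1_A t : R) = \1_B t} ->
  c * fine (mu B) <= cabs (1 - fE A 0).
Proof.
have p0 := @pi_gt0 R; have pp := @pi2_gt0 R.
have [c c0 hc] := one_sub_cexp_ge.
exists (c / 2) => [|A B mA mB BT AB]; first by rewrite divr_gt0.
have iE := Rintegral_indic mB BT.
have m0 : 0 <= fine (mu B) by rewrite fine_ge0// measure_ge0.
have m1 := mu_le_2pi mB BT.
have r01 : 0 <= (0 : R) < 1 by rewrite lexx/=.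
have -> : (0 : R[i]) = cpol 0 0 by rewrite /cpol !mul0r.
rewrite (fE_cpol 0 mA mB AB r01) /QI /PI kint_kim0; last exact: measurable_TT.
rewrite kint_kre0 mulr0 oppr0 iE.
have -> : pi * ((2 * pi)^-1 * fine (mu B)) = fine (mu B) / 2 :> R.
  by have := lt0r_neq0 p0; move: (pi : R) => p pn0; field.
apply: le_trans (hc _ _); last by rewrite divr_ge0//=; lra.
by rewrite mulrAC -mulrA.
Qed.

End borel_versions.

(** * Summability of the measures and convergence of the product *)

Section convergence_of_product.
Context {R : realType}.
Notation mu := (@lebesgue_measure R).
Implicit Types (E B : nat -> set R).

Lemma prod_abs_loc_unif_fE E B : (forall n, measurable (E n : set (LT R))) ->
  (forall n, measurable (B n : set (measurableTypeR R))) ->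
  (forall n, B n `<=` TT) ->
  (forall n, {ae lam, forall t : LT R, (\1_(E n) t : R) = \1_(B n) t}) ->
  (\sum_(0 <= n <oo) mu (B n) < +oo)%E <-> prod_abs_loc_unif (fun n => fE (E n)).
Proof.
move=> mE mB BT EB.
have fB n : mu (B n) \is a fin_num by exact: mu_fin_num.
have m0 n : 0 <= fine (mu (B n)) by rewrite fine_ge0// measure_ge0.
rewrite nneseries_lt_pinftyP//; split=> [[D hD]|/prod_abs_loc_unif_bounded[D hD]].
  apply: (prod_abs_loc_unif_dominated m0 hD) => rho rho01.
  have [C hC] := one_sub_fE_le rho01.
  by exists C => n z; apply: hC.
have [c c0 hc] := @one_sub_fE0_ge R.
exists (D / c) => n; rewrite ler_pdivlMr// mulrC mulr_sumr.
by apply: le_trans (hD n); apply: ler_sum => k _; exact: hc.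
Qed.

End convergence_of_product.

(** * The boundary function v and the formula for the product *)

Section boundary_argument.
Context {R : realType}.
Notation mu := (@lebesgue_measure R).
Notation L1 u := (mu.-integrable TT (EFin \o u)).
Context (B : nat -> set R).
Context (mB : forall n, measurable (B n : set (measurableTypeR R))).
Context (BT : forall n, B n `<=` TT).
Context (sB : (\sum_(0 <= n <oo) mu (B n) < +oo)%E).
Implicit Types (r t : R).

Definition vpart n t : R := \sum_(k < n) pi * \1_(B k) t.

(** [fine] sends the value +oo to 0; on the period this concerns a null set only, once the measures
    are summable. *)
Definition vreal t : R := fine (vfun B t).

Lemma vreal_ge0 t : 0 <= vreal t.
Proof. by rewrite fine_ge0// vfun_ge0. Qed.

Lemma vpartS n : vpart n.+1 = (fun t => vpart n t + pi * \1_(B n) t).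
Proof. by apply/funext => t; rewrite /vpart big_ord_recr. Qed.

Lemma vpart_cvge t : (vpart n t)%:E @[n --> \oo] --> vfun B t.
Proof.
rewrite /vfun -nneseriesZl; last by move=> n _; rewrite lee_fin indic_ge0.
have -> : (fun n => (vpart n t)%:E) =
    (fun n => \sum_(0 <= k < n) (pi%:E * (\1_(B k) t : R)%:E))%E.
  by apply/funext => n; rewrite big_mkord -sumEFin.
apply: is_cvg_nneseries => n _ _.
by rewrite mule_ge0// ?lee_fin ?pi_ge0 ?indic_ge0.
Qed.

Lemma vpart_cvg t : vfun B t \is a fin_num -> vpart n t @[n --> \oo] --> vreal t.
Proof.
by move=> vf; have := @vpart_cvge t; rewrite -(fineK vf) => /fine_cvg.
Qed.

Lemma vpart_le n t : vfun B t \is a fin_num -> 0 <= vpart n t <= vreal t.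
Proof.
move=> vf; apply/andP; split.
  by apply: sumr_ge0 => k _; rewrite mulr_ge0 ?pi_ge0 ?indic_ge0.
rewrite -lee_fin fineK// /vfun -nneseriesZl; last first.
  by move=> k _; rewrite lee_fin indic_ge0.
rewrite /vpart -sumEFin -(big_mkord xpredT (fun k => (pi * \1_(B k) t)%:E)).
apply: nneseries_lim_ge => k _ _.
by rewrite lee_fin mulr_ge0 ?pi_ge0 ?indic_ge0.
Qed.

Lemma measurable_vfun_borel :
  measurable_fun (TT : set (measurableTypeR R)) (vfun B).
Proof.
apply: measurable_funeM; apply: (@ge0_emeasurable_sum _ _ R TT
  (fun n t => (\1_(B n) t : R)%:E) xpredT) => [n t _ _|n _].
  by rewrite lee_fin indic_ge0.
by apply/measurable_EFinP; apply: measurable_indic; exact: mB.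
Qed.

Lemma integrable_vfun : mu.-integrable TT (vfun B).
Proof.
apply/integrableP; split; first exact: measurable_vfun_borel.
have [_] : L1T (vfun B).
  apply/(L1T_vfun (fun n => measurable_LT (mB n)) BT).
  by rewrite (eq_eseriesr (g := fun n => mu (B n))).
rewrite /intT muleC gt0_mule_lt_pinfty ?invr_gt0 ?pi2_gt0//; last exact: integral_ge0.
rewrite (ge0_integral_lam (f := fun t => `|vfun B t|%E))//; first exact: measurable_TT.
exact: measurableT_comp measurable_vfun_borel.
Qed.

Lemma ae_vfun_fin_num : {ae mu, forall t, TT t -> vfun B t \is a fin_num}.
Proof. exact: (integrable_ae (@measurable_TT R) integrable_vfun). Qed.

Lemma measurable_vreal : measurable_fun (TT : set (measurableTypeR R)) vreal.
Proof.
by apply: (measurableT_comp (f := fine)); [exact: fine_measurable|exact: measurable_vfun_borel].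
Qed.

Lemma L1_vreal : L1 vreal.
Proof.
apply: (le_integrable (@measurable_TT R)) integrable_vfun.
  by apply/measurable_EFinP; exact: measurable_vreal.
move=> t _ /=; rewrite /vreal.
by have := vfun_ge0 B t; case: (vfun B t) => //= _; rewrite normr0 leey.
Qed.

(** Partial sums are pi times a natural number, where sin vanishes, and the vanishing passes to the
    limit by continuity. *)
Lemma sin_vreal t : vfun B t \is a fin_num -> sin (vreal t) = 0.
Proof.
move=> vf.
have h : sin (vpart n t) @[n --> \oo] --> sin (vreal t).
  by apply: continuous_cvg; [exact: continuous_sin|exact: vpart_cvg].
have e : (fun n => sin (vpart n t)) = (fun=> 0).
  apply/funext => n; rewrite /vpart.
  have -> : \sum_(k < n) pi * \1_(B k) t = pi * (\sum_(k < n) (t \in B k))%:R :> R.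
    by rewrite -mulr_sumr natr_sum; congr (_ * _).
  elim: (\sum_(k < n) _)%N => [|m ih]; first by rewrite mulr0 sin0.
  by rewrite -natr1 mulrDr mulr1 sinDpi ih oppr0.
by move: h; rewrite e => h; apply/esym/(cvg_unique _ _ h) => //; exact: cvg_cst.
Qed.

Lemma L1_vpart n : L1 (vpart n).
Proof.
elim: n => [|n ih].
  have := @integrable_cst_TT R 0; congr (mu.-integrable _ _).
  by apply/funext => t; rewrite /= /vpart big_ord0.
have mT := @measurable_TT R.
rewrite vpartS.
have i1 := integrableZl mT pi (L1_indic (mB n)).
by have := integrableD mT ih i1; apply: eq_integrable.
Qed.

(** Dominated convergence: the partial sums increase to v almost everywhere, so C v is a
    majorant. *)
Lemma kint_vpart_cvg (k : R -> R -> R) r t (C : R) :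
  continuous (k r) -> (forall x, `|k r x| <= C) ->
  kint mu TT (fun s : R => s) k (vpart n) r t @[n --> \oo] -->
  kint mu TT (fun s : R => s) k vreal r t.
Proof.
move=> ck bk; apply: cvgM; first exact: cvg_cst.
have mT := @measurable_TT R.
have mk := measurable_kshift (@measurable_idTT R) t ck.
have mvp n := measurable_L1 (L1_vpart n).
have i1 : L1 (fun s => C * vreal s).
  by have := integrableZl mT C L1_vreal; apply: eq_integrable.
apply: (@Rintegral_dominated R _ _ mu TT (@measurable_TT R)
  (fun n s => k r (t - s) * vpart n s) (fun s => k r (t - s) * vreal s)
  (fun s => C * vreal s) _ _ _ i1 _).2 => //.
- by move=> n; apply: measurable_funM.
- by apply: measurable_funM => //; exact: measurable_vreal.
- apply: (@filterS _ _ (ae_filter_ringOfSetsType mu) _ _ _ ae_vfun_fin_num) => s vf Ts.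
  by apply: cvgM; [exact: cvg_cst|apply: vpart_cvg; exact: vf].
apply: (@filterS _ _ (ae_filter_ringOfSetsType mu) _ _ _ ae_vfun_fin_num) => s vf n Ts.
have /andP[v0 vv] := vpart_le n (vf Ts).
by rewrite normrM (ger0_norm v0) ler_pM.
Qed.

Lemma prod_fE_cpol (E : nat -> set R) n r t :
  (forall n, measurable (E n : set (LT R))) ->
  (forall n, {ae lam, forall t : LT R, (\1_(E n) t : R) = \1_(B n) t}) ->
  0 <= r < 1 ->
  \prod_(k < n) fE (E k) (cpol r t) =
  cexp (Complex (- QI (vpart n) r t) (PI (vpart n) r t)).
Proof.
move=> mE EB r01; have r1 := norm_lt1 r01.
have mT := @measurable_TT R; have mid := @measurable_idTT R.
elim: n => [|n ih].
  have -> : vpart 0 = (fun=> 0) by apply/funext => s; rewrite /vpart big_ord0.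
  rewrite big_ord0 PI_cst// /QI /kint.
  under eq_Rintegral do rewrite mulr0.
  by rewrite Rintegral_cst_TT mul0r mulr0 oppr0 -cexp0.
have iB := L1_indic (mB n).
have iB' : L1 (fun s => pi * \1_(B n) s).
  by have := integrableZl mT pi iB; apply: eq_integrable.
rewrite big_ord_recr/= ih (fE_cpol t (mE n) (mB n) (EB n) r01) -cexpD complexD vpartS.
congr cexp; apply: complex_eq.
  by rewrite /QI kint_kimD ?kint_kimZ ?opprD//; exact: L1_vpart.
by rewrite /PI kint_kreD ?kint_kreZ//; exact: L1_vpart.
Qed.

(** Partial products are the exponentials attached to the partial sums of v; both sides are limits
    of them, and limits are unique. *)
Lemma prod_value_cpol (E : nat -> set R) F r t :
  (forall n, measurable (E n : set (LT R))) ->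
  (forall n, {ae lam, forall t : LT R, (\1_(E n) t : R) = \1_(B n) t}) ->
  prod_value (fun n => fE (E n)) F -> 0 <= r < 1 ->
  F (cpol r t) = cexp (Complex (- QI vreal r t) (PI vreal r t)).
Proof.
move=> mE EB pF r01; have r1 := norm_lt1 r01.
have /andP[r0 r1'] := r01.
have Dz : Dsk (cpol r t) by rewrite /Dsk /= cabs_cpol.
have cQ : QI (vpart n) r t @[n --> \oo] --> QI vreal r t.
  exact: (kint_vpart_cvg (t := t) (continuous_kim r1) (fun x => kim_ub x (lexx `|r|) r1)).
have cP : PI (vpart n) r t @[n --> \oo] --> PI vreal r t.
  exact: (kint_vpart_cvg (t := t) (continuous_kre r1) (fun x => kre_ub x (lexx `|r|) r1)).
set L := cexp _.
apply/eqP; rewrite -subr_eq0 -cabs_eq0 eq_le cabs_ge0 andbT.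
apply/ler_addgt0Pr => e e0; rewrite add0r.
have e2 : 0 < e / 2 by rewrite divr_gt0.
have [N1 h1] := pF _ Dz _ e2.
have [N2 h2] := cexp_cvg (cvgN cQ) cP e2.
have := h1 (maxn N1 N2) (leq_maxl _ _); have := h2 (maxn N1 N2) (leq_maxr _ _).
rewrite (prod_fE_cpol _ _ mE EB r01) -/L; set a := cexp _ => a1 a2.
have -> : F (cpol r t) - L = (a - L) - (a - F (cpol r t)) by ring.
by apply: le_trans (ler_cabsB _ _) _; lra.
Qed.

End boundary_argument.

(** * The criterion for membership of the product in R^+ *)

Section real_smirnov_criterion.
Context {R : realType}.
Notation mu := (@lebesgue_measure R).
Notation L1 u := (mu.-integrable TT (EFin \o u)).
Context (E B : nat -> set R).
Context (mE : forall n, measurable (E n : set (LT R))).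
Context (mB : forall n, measurable (B n : set (measurableTypeR R))).
Context (BT : forall n, B n `<=` TT).
Context (EB : forall n, {ae lam, forall t : LT R, (\1_(E n) t : R) = \1_(B n) t}).
Context (sB : (\sum_(0 <= n <oo) mu (B n) < +oo)%E).
Implicit Types (r t : R) (F : R[i] -> R[i]).

Lemma ae_vfun_vreal : {ae lam, forall t : LT R, TT t -> vfun E t = (vreal B t)%:E}.
Proof.
have h := ae_lam (ae_vfun_fin_num mB BT sB).
apply: (@filterS2 _ _ (ae_filter_ringOfSetsType lam) _ _ _ _ (ae_foralln EB) h) => t e vf Tt.
rewrite /vreal fineK; last exact: vf.
by rewrite /vfun; congr (_ * _)%E; apply: eq_eseriesr => n _; rewrite e.
Qed.

Lemma LlogL_vfun : LlogL (vfun E) <-> (\int[mu]_(t in TT) (ll (vreal B t))%:E < +oo)%E.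
Proof.
have mT := @measurable_TT R; have mTl := @measurable_TT_LT R.
have -> : LlogL (vfun E) <-> (intT (fun t => LlogL_phi (vfun E t)) < +oo)%E.
  by split=> [[]//|h]; split => //; exact: measurable_vfun.
have mll : measurable_fun (TT : set (measurableTypeR R)) (fun t => (ll (vreal B t))%:E).
  by apply/measurable_EFinP; apply: measurable_ll; exact: measurable_vreal.
have ll0 t : (0 <= (ll (vreal B t))%:E)%E by rewrite lee_fin ll_ge0// vreal_ge0.
have ae : ae_eq lam (TT : set (LT R)) (fun t => (ll (vreal B t))%:E)
    (fun t => LlogL_phi (vfun E t)).
  apply: (@filterS _ _ (ae_filter_ringOfSetsType lam) _ _ _ ae_vfun_vreal) => t e Tt.
  by rewrite (e Tt) /= /ll ger0_norm// vreal_ge0.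
have mllt := measurable_fun_LT mT mll.
(* Completeness of Lebesgue measure makes a function equal almost everywhere to a measurable one
   measurable. *)
have mL := ae_measurable_fun (@completed_lebesgue_measure_is_complete R) ae mllt.
have phi0 t : (0 <= LlogL_phi (vfun E t))%E.
  by case: (vfun E t) => //= r; rewrite lee_fin mulr_ge0// le_max lexx.
rewrite /intT muleC gt0_mule_lt_pinfty ?invr_gt0 ?pi2_gt0//; last exact: integral_ge0.
rewrite -(ge0_ae_eq_integral mTl mllt mL)//.
by rewrite (ge0_integral_lam mT mll).
Qed.

Context (F : R[i] -> R[i]).
Context (pF : prod_value (fun n => fE (E n)) F).

Lemma F_cpol r t : 0 <= r < 1 ->
  F (cpol r t) = cexp (Complex (- QI (vreal B) r t) (PI (vreal B) r t)).
Proof. exact: prod_value_cpol. Qed.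

Lemma schwarz_L1 u r t : L1 u -> 0 <= r < 1 ->
  schwarz u (cpol r t) = Complex (PI u r t) (QI u r t).
Proof.
move=> iu r01; have r1 := norm_lt1 r01.
have mu_ : measurable_fun (TT : set (LT R)) (u : LT R -> R).
  apply: measurable_fun_LT; first exact: measurable_TT.
  exact: measurable_L1 iu.
have e : {ae lam, forall s : LT R, u s = u s} by exact: aeW.
rewrite schwarz_cpol//; apply: complex_eq.
  exact: (kint_lam t (continuous_kre r1) (fun x => kre_ub x (lexx `|r|) r1) mu_ iu e).
exact: (kint_lam t (continuous_kim r1) (fun x => kim_ub x (lexx `|r|) r1) mu_ iu e).
Qed.

(** F g = f is bounded, which bounds - Q v pointwise by k + P |u|. A one-sided bound controls the
    mean of |Q v| because Q v itself has mean zero. *)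
Lemma Nplus_QI_bound : Nplus F -> exists K : R, forall r, 0 <= r < 1 ->
  Rintegral mu TT (fun t => `|QI (vreal B) r t|) <= K.
Proof.
move=> [f [g [[_ [M fM]] _ [c [c1 [u [iu gE]]]] FE]]].
have mT := @measurable_TT R; have mTl := @measurable_TT_LT R.
have iv := L1_vreal mB BT sB.
(* The maximum with 1 makes k nonnegative and the logarithm meaningful whatever M is. *)
pose k : R := ln (Num.max 1 M).
have k0 : 0 <= k by rewrite ln_ge0// le_max lexx.
have iau : lam.-integrable (TT : set (LT R)) (EFin \o (fun s : LT R => `|u s|)).
  exact: (integrable_norm iu).
pose Pa r t := kint lam (TT : set (LT R)) (@thLT R) kre (fun s => `|u s|) r t.
(* This is |x| = x + 2 max(0, - x), with max(0, - x) at most k + P |u|. *)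
have bound r t : 0 <= r < 1 -> `|QI (vreal B) r t| <= QI (vreal B) r t + 2 * (k + Pa r t).
  move=> r01; have r1 := norm_lt1 r01; have /andP[r0 r1'] := r01.
  have Dz : Dsk (cpol r t) by rewrite /Dsk /= cabs_cpol.
  pose Pu := kint lam (TT : set (LT R)) (@thLT R) kre u r t.
  have h : - QI (vreal B) r t + Pu <= k.
    rewrite -ler_expR expRD /k lnK ?posrE; last first.
      by rewrite lt_max ltr01.
    have e1 : cabs (F (cpol r t)) = expR (- QI (vreal B) r t).
      by rewrite F_cpol// cabs_cexp.
    have e2 : cabs (g (cpol r t)) = expR Pu.
      by rewrite gE// cabsM c1 mul1r cabs_cexp schwarz_cpol.
    have g0 : g (cpol r t) != 0 by rewrite -cabs_gt0 e2 expR_gt0.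
    rewrite -e1 -e2 -cabsM FE// divfK// le_max; apply/orP; right; exact: fM.
  have Pau : - Pu <= Pa r t.
    have iNu : lam.-integrable (TT : set (LT R)) (EFin \o (fun s : LT R => -1 * u s)).
      by have := integrableZl mTl (-1) iu; apply: eq_integrable.
    have := @le_kint_kre R _ (LT R) lam TT mTl (@thLT R) (@measurable_thLT R)
      (fun s => -1 * u s) (fun s => `|u s|) r t r1 iNu iau.
    rewrite (kint_kreZ mTl (@measurable_thLT R) (-1) t r1 iu) mulN1r; apply => s _.
    by rewrite mulN1r -normrN ler_norm.
  have Pa0 : 0 <= Pa r t by apply: kint_kre_ge0.
  clear iau iv iu.
  by case: (ger0P (QI (vreal B) r t)) => q0; lra.
exists (2 * (k * (2 * pi) + Rintegral lam (TT : set (LT R)) (fun s => `|u s|))) => r r01.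
have r1 := norm_lt1 r01.
have iQ := cp_intB (cp_PI iv) r1.
have iP := cp_intA (cp_kint mTl (@measurable_thLT R) iau) r1.
have ik := @integrable_cst_TT R k.
have i1 : L1 (fun t => k + Pa r t).
  by have := integrableD mT ik iP; apply: eq_integrable.
have i2 : L1 (fun t => 2 * (k + Pa r t)).
  by have := integrableZl mT 2 i1; apply: eq_integrable.
have i3 : L1 (fun t => QI (vreal B) r t + 2 * (k + Pa r t)).
  by have := integrableD mT iQ i2; apply: eq_integrable.
have := le_Rintegral mT (integrable_norm iQ) i3 (fun t _ => bound r t r01).
rewrite (RintegralD mT iQ i2) (RintegralZl 2 mT i1) (RintegralD mT ik iP) Rintegral_cst_TT.
rewrite (Rintegral_kint_kre mTl (@measurable_thLT R) iau r01).
rewrite (conj_pair_meanB (cp_PI iv) r01).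
have -> : Rintegral mu TT (QI (vreal B) 0) = Rintegral mu TT (fun=> 0).
  by apply: eq_Rintegral => s _; apply: (@kint_kim0 R _ _ mu TT mT (fun s : R => s)).
by rewrite Rintegral_cst_TT mul0r add0r.
Qed.

Lemma Nplus_LlogL : Nplus F -> LlogL (vfun E).
Proof.
move=> /Nplus_QI_bound[K hK]; apply/LlogL_vfun.
have mT := @measurable_TT R.
have mv := measurable_vreal mB.
have := L1_phi_of_QI (L1_vreal mB BT sB) (fun t _ => vreal_ge0 B t) hK.
apply: le_lt_trans; apply: ge0_le_integral => //.
- by move=> t _; rewrite lee_fin ll_ge0// vreal_ge0.
- by apply/measurable_EFinP; apply: measurable_ll.
- by apply/measurable_EFinP; apply: measurable_phi.
- by move=> t _; rewrite lee_fin ll_le_phi// vreal_ge0.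
Qed.

Lemma F_schwarz z : Dsk z -> F z = cexp (Complex 0 1 * schwarz (vreal B) z).
Proof.
move=> Dz; have [t zE] := polar z.
have r01 : 0 <= cabs z < 1 by rewrite cabs_ge0; exact: Dz.
rewrite zE (F_cpol t r01) (schwarz_L1 t (L1_vreal mB BT sB) r01).
by rewrite complexM !mul0r !mul1r sub0r add0r.
Qed.

Lemma LlogL_conjugate : LlogL (vfun E) -> exists h : R -> R,
  L1 h /\ forall r t, 0 <= r < 1 -> QI (vreal B) r t = PI h r t.
Proof.
move=> /LlogL_vfun Lv.
have iv := L1_vreal mB BT sB; have v0 := vreal_ge0 B.
have ill : L1 (fun t => ll (vreal B t)).
  apply/integrableP; split.
    by apply/measurable_EFinP; apply: measurable_ll; exact: measurable_vreal.
  apply: le_lt_trans Lv; rewrite le_eqVlt; apply/orP; left; apply/eqP.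
  by apply: eq_integral => t _; rewrite /= ger0_norm// ll_ge0.
by apply: QI_boundary => [//|s _ //|la la0]; exact: L1_phi_of_ll.
Qed.

(** With w the negative part of h, |g| = exp (- P w) and |F g| = exp (- P (h + w)). Both w and h + w
    are nonnegative, so both functions are bounded by 1. *)
Lemma Nplus_of_conjugate (h : R -> R) : L1 h ->
  (forall r t, 0 <= r < 1 -> QI (vreal B) r t = PI h r t) -> Nplus F.
Proof.
move=> ih Qh.
have mT := @measurable_TT R; have mid := @measurable_idTT R.
have iv := L1_vreal mB BT sB.
pose w (s : R) : R := Num.max 0 (- h s).
have w0 s : 0 <= w s by rewrite le_max lexx.
have mh := measurable_L1 ih.
have iw : L1 w.
  apply: le_integrable (integrable_norm ih) => //.
    apply/measurable_EFinP; apply: measurable_maxr; first exact: measurable_cst.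
    exact: measurable_funN.
  move=> s _; rewrite /= lee_fin normr_id ger0_norm// ge_max normr_ge0/=.
  by rewrite -normrN ler_norm.
have iNw : L1 (fun s => -1 * w s).
  by have := integrableZl mT (-1) iw; apply: eq_integrable.
have ihw : L1 (fun s => h s + w s).
  by have := integrableD mT ih iw; apply: eq_integrable.
have [ivl _] := integrable_lam mT iv.
have [iNwl _] := integrable_lam mT iNw.
pose g z := cexp (schwarz (fun s => -1 * w s) z).
have gpol r t : 0 <= r < 1 -> cabs (g (cpol r t)) = expR (- PI w r t).
  move=> r01; rewrite /g cabs_cexp (schwarz_L1 t iNw r01) /PI /=.
  by rewrite (kint_kreZ mT mid (-1) t (norm_lt1 r01) iw) mulN1r.
have PIw0 r t : 0 <= r < 1 -> 0 <= PI w r t.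
  by move=> r01; apply: kint_kre_ge0 => //; exact: norm_lt1.
have PIhw0 r t : 0 <= r < 1 -> 0 <= PI h r t + PI w r t.
  move=> r01; rewrite -(kint_kreD mT mid t (norm_lt1 r01) ih iw).
  apply: kint_kre_ge0 => //; first exact: norm_lt1.
  by move=> s _; rewrite -lerBlDl sub0r le_max lexx orbT.
have Dpol z : Dsk z -> exists r t, [/\ z = cpol r t & 0 <= r < 1].
  move=> Dz; have [t zE] := polar z; exists (cabs z), t; split => //.
  by rewrite cabs_ge0; exact: Dz.
exists (fun z => F z * g z), g; split.
- split.
    apply: (holo_qdiff (g := fun z => cexp (Complex 0 1 * schwarz (vreal B) z +
      schwarz (fun s => -1 * w s) z))) => z Dz.
      apply: qdiff_cexp; apply: qdiffD; last exact: qdiff_schwarz.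
      by apply: qdiffZ; exact: qdiff_schwarz.
    by rewrite cexpD -F_schwarz.
  exists 1 => _ /Dpol[r [t [-> r01]]].
  rewrite cabsM gpol// (F_cpol t r01) cabs_cexp /= -expRD.
  by rewrite -expR0 ler_expR Qh// -opprD oppr_le0; exact: PIhw0.
- split.
    by apply: (holo_qdiff (g := g)) => // z Dz; apply: qdiff_cexp; exact: qdiff_schwarz.
  exists 1 => _ /Dpol[r [t [-> r01]]].
  by rewrite gpol// -expR0 ler_expR oppr_le0; exact: PIw0.
- exists 1; split; first exact: cabs1.
  by exists (fun s => -1 * w s); split => // z _; rewrite mul1r.
- by move=> z _; rewrite mulfK//; exact: cexp_neq0.
Qed.

(** Fatou's theorem for v and for h gives the radial limit exp (- h + i v), whose imaginary part
    contains the factor sin v = 0. *)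
Lemma radial_real_of_conjugate (h : R -> R) : L1 h ->
  (forall r t, 0 <= r < 1 -> QI (vreal B) r t = PI h r t) -> radial_real_ae F.
Proof.
move=> ih Qh.
have iv := L1_vreal mB BT sB.
have vl := ae_lam (fatou_ae iv); have hl := ae_lam (fatou_ae ih).
have fl := ae_lam (ae_vfun_fin_num mB BT sB).
apply: (@filterS3 _ _ (ae_filter_ringOfSetsType lam) _ _ _ _ _ vl hl fl) => t vt ht ft Tt.
have {}vt := vt Tt; have {}ht := ht Tt; have s0 := sin_vreal (ft Tt).
exists (expR (- h t) * cos (vreal B t)) => eps eps0.
have [d d0 hd] := cexp_close (- h t) (vreal B t) eps0.
have [d1 d10 h1] := vt _ d0; have [d2 d20 h2] := ht _ d0.
exists (Num.min d1 d2); split; first by rewrite lt_min d10.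
move=> r r0 /andP[rd r1].
have r01 : 0 <= r < 1 by rewrite (ltW r0).
have m1 : Num.min d1 d2 <= d1 by rewrite ge_min lexx.
have m2 : Num.min d1 d2 <= d2 by rewrite ge_min lexx orbT.
rewrite -cpolE (F_cpol t r01) Qh//.
have -> : Complex (expR (- h t) * cos (vreal B t)) 0 = cexp (Complex (- h t) (vreal B t)).
  by apply: complex_eq => //=; rewrite s0 mulr0.
apply: hd; last by apply: h1; [exact: ltW|rewrite r1 andbT; lra].
by rewrite -opprD normrN; apply: h2; [exact: ltW|rewrite r1 andbT; lra].
Qed.

Lemma Rplus_LlogL : Rplus F <-> LlogL (vfun E).
Proof.
split=> [[NF _]|/LlogL_conjugate[h [ih Qh]]].
  exact: Nplus_LlogL NF.
by split; [exact: Nplus_of_conjugate Qh|exact: radial_real_of_conjugate Qh].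
Qed.

End real_smirnov_criterion.

Theorem theorem4p5 (R : realType) (E : nat -> set R)
    (mE : forall n, measurable (E n : set (LT R)))
    (ET : forall n, E n `<=` TT) :
  let condA := (\sum_(0 <= n <oo) mT (E n) < +oo)%E in
  let condB := L1T (vfun E) in
  let condC := prod_abs_loc_unif (fun n => fE (E n)) in
  ((condA <-> condB) /\ (condB <-> condC)) /\
  (condC -> forall F : R[i] -> R[i], prod_value (fun n => fE (E n)) F ->
     (Rplus F <-> LlogL (vfun E))).
Proof.
move=> condA condB condC.
(* One Borel version is fixed for each set; all integrals below are taken with these. *)
have [B hB] := choice (fun n => indic_borel (mE n)).
have mB n : measurable (B n : set (measurableTypeR R)) by have [] := hB n.
have BT n : B n `<=` TT by have [_ BE _] := hB n; exact: subset_trans BE (ET n).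
have EB n : {ae lam, forall t : LT R, (\1_(E n) t : R) = \1_(B n) t} by have [] := hB n.
(* Both measures are integrals over the period of indicators that agree almost everywhere. *)
have EBE n : lam (E n : set (LT R)) = lebesgue_measure (B n).
  have mTl := @measurable_TT_LT R.
  have lam1 (A : set R) : measurable (A : set (LT R)) -> A `<=` TT ->
      (\int[lam]_(t in (TT : set (LT R))) (\1_A t : R)%:E)%E = lam (A : set (LT R)).
    by move=> mA AT; rewrite integral_indic//; congr lam; exact/setIidPl.
  rewrite -(lamE (mB n)) -(lam1 _ (mE n) (ET n)) -(lam1 _ (measurable_LT (mB n)) (@BT n)).
  apply: ge0_ae_eq_integral.
  - exact: mTl.
  - by apply/measurable_EFinP; apply: measurable_indic; exact: mE.
  - by apply/measurable_EFinP; apply: measurable_indic; exact: measurable_LT.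
  - by move=> t _; rewrite lee_fin indic_ge0.
  - by move=> t _; rewrite lee_fin indic_ge0.
  - apply: (@filterS _ _ (ae_filter_ringOfSetsType lam) _ _ _ (EB n)) => t e _.
    by rewrite /= e.
have AS : condA <-> (\sum_(0 <= n <oo) lebesgue_measure (B n) < +oo)%E.
  by rewrite /condA sum_mT (eq_eseriesr (g := fun n => lebesgue_measure (B n))).
have AB : condA <-> condB by rewrite /condA sum_mT /condB L1T_vfun.
have SC := prod_abs_loc_unif_fE mE mB BT EB.
have BC : condB <-> condC by rewrite -AB AS; exact: SC.
split; first by split.
by move=> /SC sB F pF; exact: (Rplus_LlogL mE mB BT EB sB pF).
Qed.
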